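(* The metric measure space $(X_\infty,\hat d_\infty,\mu_\infty)$ admits a $(1,1)$-Poincaré inequality: there are constants $C,\lambda\ge1$ such that for every ball $B=B(p,r)\subset X_\infty$, every integrable function $u$ and every upper gradient $g$ of $u$, $$\frac{1}{\mu_\infty(B)}\int_B|u-u_B|\,d\mu_\infty\le C\,r\,\frac{1}{\mu_\infty(\lambda B)}\int_{\lambda B}g\,d\mu_\infty,$$ where $u_B$ is the mean of $u$ on $B$.
   Context: Standing construction ($n=2$). Fix an integer $L\ge100$, $m=4$, $m_v=3L$. For $j\in\mathbb Z$, $Y_j$ is the cell complex on $\mathbb R^2$ given by the tiling by rectangles $[am^{-j},(a+1)m^{-j}]\times[bm_v^{-j},(b+1)m_v^{-j}]$, $a,b\in\mathbb Z$. Let $\Phi(x,y)=(m^{-1}x,m_v^{-1}y)$. For $k,\ell\in\mathbb Z$, $i\in\{1,2,3\}$, $a_{k,\ell,i}=\{k+\tfrac i4\}\times[(3\ell+i-1)m_v^{-1},(3\ell+i)m_v^{-1}]$. $\mathcal R$ is the equivalence relation on $\mathbb R^2$ generated by $p\sim p+(0,m_v^{-1})$ for $p\in a_{k,\ell,i}$. $\Phi^j_*\mathcal R=\{(\Phi^jp,\Phi^jq):(p,q)\in\mathcal R\}$; $\mathcal R_\infty$ is generated by all $\Phi^j_*\mathcal R$. $X_\infty=\mathbb R^2/\mathcal R_\infty$, $\hat\pi^\infty$ the quotient map, $\hat d_\infty$ the largest pseudodistance on $X_\infty$ such that for every $i\in\mathbb Z$ and every $2$-cell $\hat\sigma$ of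 $Y_i$, $\hat\pi^\infty(\hat\sigma)$ has diameter $\le m^{-i}$; $\mu_\infty=\hat\pi^\infty_\#\mathcal L^2$. A Borel $g\ge0$ is an upper gradient of $u$ if $|u(\gamma(a))-u(\gamma(b))|\le\int_\gamma g\,ds$ for every rectifiable curve $\gamma:[a,b]\to X_\infty$. *)

(* Defs.v *)
From HB Require Import structures.
From mathcomp Require Import all_boot all_order all_algebra.
From mathcomp Require Import all_classical all_reals all_analysis measurable_realfun.
Set Implicit Arguments. Unset Strict Implicit. Unset Printing Implicit Defensive.
Import Order.TTheory GRing.Theory Num.Theory.
Local Open Scope classical_set_scope.
Local Open Scope ring_scope.

Section Construction.
Variables (R : realType) (L : nat).

Definition mh : R := 4.
Definition mv : R := (3 * L)%:R.

Definition Phi (j : int) (p : R * R) : R * R :=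
  (mh ^ (- j) * p.1, mv ^ (- j) * p.2).

Definition cell (j a b : int) : set (R * R) :=
  [set p | a%:~R * mh ^ (- j) <= p.1 <= (a + 1)%:~R * mh ^ (- j) /\
           b%:~R * mv ^ (- j) <= p.2 <= (b + 1)%:~R * mv ^ (- j)].

Definition aseg (k l : int) (i : nat) : set (R * R) :=
  [set p | p.1 = k%:~R + i%:R / 4 /\
           (3 * l + i%:Z - 1)%:~R / mv <= p.2 <= (3 * l + i%:Z)%:~R / mv].

Definition is_equivalence (E : R * R -> R * R -> Prop) :=
  (forall x, E x x) /\ (forall x y, E x y -> E y x) /\
  (forall x y z, E x y -> E y z -> E x z).

Definition gen_equiv (G : R * R -> R * R -> Prop) (x y : R * R) : Prop :=
  forall E, is_equivalence E -> (forall a b, G a b -> E a b) -> E x y.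

Definition Rgen (p q : R * R) : Prop :=
  exists (k l : int) (i : nat), (1 <= i <= 3)%N /\ aseg k l i p /\
    q = (p.1, p.2 + mv^-1).

Definition Rrel := gen_equiv Rgen.

Definition Rinf := gen_equiv (fun x y =>
  exists (j : int) p q, Rrel p q /\ x = Phi j p /\ y = Phi j q).

(* pseudodistances on X_infty (seen as Rinf-invariant pseudodistances on R^2)
   such that each projected 2-cell of Y_i has diameter <= m^{-i} *)
Definition admissible (delta : R * R -> R * R -> R) : Prop :=
  (forall x, delta x x = 0) /\ (forall x y, 0 <= delta x y) /\
  (forall x y, delta x y = delta y x) /\
  (forall x y z, delta x z <= delta x y + delta y z) /\
  (forall x y, Rinf x y -> delta x y = 0) /\
  (forall (i a b : int) x y, cell i a b x -> cell i a b y ->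
      delta x y <= mh ^ (- i)).

(* \hat d_\infty (pulled back to R^2): the largest admissible pseudodistance *)
Definition dinf (x y : R * R) : R :=
  sup [set delta x y | delta in admissible].

(* open balls of (X_infty, \hat d_infty), pulled back to R^2 *)
Definition dball (p : R * R) (r : R) : set (R * R) := [set x | dinf p x < r].

Definition dopen (A : set (R * R)) : Prop :=
  forall x, A x -> exists2 r : R, 0 < r & dball x r `<=` A.

(* Borel sets of X_infty, pulled back to R^2 *)
Definition Xborel : set (set (R * R)) := <<s dopen >>.

Definition Xmeasurable_fun (d : measure_display)
  (T' : measurableType d) (f : R * R -> T') : Prop :=
  forall B : set T', measurable B -> Xborel (f @^-1` B).

(* mu_infty = pushforward of Lebesgue measure on R^2 *)
Definition leb2 : set (R * R) -> \bar R :=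
  (@lebesgue_measure R \x @lebesgue_measure R)%E.

(* curves gamma : [a,b] -> X_infty (represented through R^2 representatives) *)
Definition dcontinuous_on (gam : R -> R * R) (a b : R) : Prop :=
  forall t, a <= t <= b -> forall e : R, 0 < e -> exists2 del : R, 0 < del &
    forall s, a <= s <= b -> `|s - t| < del -> dinf (gam s) (gam t) < e.

Definition curve_length (gam : R -> R * R) (a b : R) : \bar R :=
  ereal_sup [set v : \bar R | exists (n : nat) (t : nat -> R),
     t 0%N = a /\ t n = b /\ (forall i, (i < n)%N -> t i <= t i.+1) /\
     v = (\sum_(i < n) dinf (gam (t i)) (gam (t i.+1)))%:E].

Definition rectifiable (gam : R -> R * R) (a b : R) : Prop :=
  a <= b /\ dcontinuous_on gam a b /\ (curve_length gam a b < +oo)%E.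

Definition arclength_param (gam : R -> R * R) (a b : R) (gt : R -> R * R) :=
  forall t, a <= t <= b -> dinf (gt (fine (curve_length gam a t))) (gam t) = 0.

Definition upper_gradient (u : R * R -> R) (g : R * R -> \bar R) : Prop :=
  forall (gam : R -> R * R) (a b : R), rectifiable gam a b ->
  forall gt, arclength_param gam a b gt ->
  ((`| u (gam a) - u (gam b) |)%:E <=
     \int[@lebesgue_measure R]_(s in `[0%R, fine (curve_length gam a b)]) g (gt s))%E.

End Construction.

(* Main.v *)
(** Only horizontal curves are used. On a horizontal line the distance is [|x - x'|], so the upper gradient
    inequality controls [u] there, and [u] takes equal values at identified points because Borel sets
    of the quotient are saturated. Every column of width [4^-(n-1)] contains an abscissa at which a given
    row of height [mv^-n] is identified with the next one; hence translating [u] vertically by [mv^-n]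
    over a window costs in [L^1] at most [4^-(n-1)] times the integral of [g]. Expanding a vertical
    translation in base [mv] and using continuity of translations in [L^1] gives the Poincare inequality
    on rectangles of width [4^-i] and height [mv^-i].

    The distance is bounded below by testing it on a cutoff function, built from a map that collapses
    all fine identifications; the ball of radius [4^-i / 12] lies in at most three rectangles of
    scale [i], consecutive ones being identified along a common vertical segment by a coarse
    identification. This gives both the volume bounds and the inequality on balls. *)

Require Import Defs.
From HB Require Import structures.
From mathcomp Require Import all_boot all_order all_algebra.
From mathcomp Require Import all_classical all_reals all_analysis measurable_realfun.
From mathcomp Require Import zify ring lra.
Import Order.TTheory GRing.Theory Num.Theory.
Import numFieldNormedType.Exports.
Local Open Scope classical_set_scope.
Local Open Scope ring_scope.
Set Implicit Arguments.
Unset Strict Implicit.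

(** * Scales and the metric *)

(** The obstacle is that height has no meaning in the quotient: abscissas descend to it, while
    heights are disturbed by identifications of every generation. A lower bound on the distance at
    scale [i] thus needs a substitute for the height. Generations finer than [i] can be collapsed at
    a displacement of order [cv (i + 1)], with controlled oscillation on cells, because the slope
    [cv / cw] drops by at least 75 per generation while one collapse expands heights by at most 7;
    this uses [L >= 100]. Coarser generations cannot be collapsed so cheaply, but their abscissas
    are multiples of [cw i], at most one of which is closer than [cw i / 2] to a given point, and
    the distance to the at most three heights glued there takes over. The divisor 12 is 3 times 4:
    the cutoff has Lipschitz constant [3 * cv i / cw i] and a margin of [cv i / 4]. In the
    inequality, one row of generation [n] costs [2 * cw (n - 1)] and a digit is at most [5 * mv],
    whence a sum proportional to [mv]; what remains after finitely many digits is a small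
    translation of a function that is only integrable. *)

Section Scales.
Context {R : realType} (L : nat).

(* Width and height of the 2-cells of [Y_k]. *)
Definition cw (k : int) : R := mh R ^ (- k).
Definition cv (k : int) : R := mv R L ^ (- k).

Lemma cw_gt0 k : 0 < cw k.
Proof. by rewrite /cw exprz_gt0 // /mh; lra. Qed.

Lemma cwS k : cw k = 4 * cw (k + 1).
Proof.
rewrite /cw opprD expfzDr; last by rewrite /mh; apply/eqP; lra.
by rewrite exprN1 mulrCA /mh divff ?mulr1//; apply/eqP; lra.
Qed.

Lemma cwD k (n : nat) : cw k = 4 ^+ n * cw (k + n%:Z).
Proof.
elim: n => [|n IH]; first by rewrite addr0 mul1r.
by rewrite IH cwS -addrA intS (addrC 1) exprS; ring.
Qed.

Lemma cw_le k j : (k <= j)%R -> exists z : int, (1 <= z)%R /\ cw k = z%:~R * cw j.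
Proof.
move=> kj; have [n ->] : exists n : nat, j = k + n%:Z.
  by exists `|j - k|%N; rewrite gez0_abs ?subr_ge0//; lia.
exists (4 ^+ n); split; first by rewrite exprn_ege1.
by rewrite (cwD k n) rmorphXn.
Qed.

Lemma cw_lt k j : (k < j)%R -> exists z : int, (1 <= z)%R /\ cw k = (4 * z)%:~R * cw j.
Proof.
move=> kj; have [|z [z1 e]] := @cw_le (k+1) j; first lia.
by exists z; split=> //; rewrite cwS e intrM; ring.
Qed.

Hypothesis hL : (100 <= L)%N.

Lemma mv_ge : 300 <= mv R L.
Proof. by rewrite /mv ler_nat; lia. Qed.

Let M0 : mv R L != 0.
Proof. by apply/eqP; have := mv_ge; lra. Qed.

Lemma cv_gt0 k : 0 < cv k.
Proof. by rewrite /cv exprz_gt0 //; have := mv_ge; lra. Qed.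

Lemma cvS k : cv k = mv R L * cv (k + 1).
Proof. by rewrite /cv opprD expfzDr// exprN1 mulrCA divff ?mulr1. Qed.

Lemma cvD k (n : nat) : cv k = mv R L ^+ n * cv (k + n%:Z).
Proof.
elim: n => [|n IH]; first by rewrite addr0 mul1r.
by rewrite IH cvS -addrA intS (addrC 1) exprS; ring.
Qed.

Lemma cv_le k j : (k <= j)%R -> cv j <= cv k.
Proof.
move=> kj; have [n ->] : exists n : nat, j = k + n%:Z.
  by exists `|j - k|%N; rewrite gez0_abs ?subr_ge0//; lia.
rewrite (cvD k n) ler_peMl//; first exact/ltW/cv_gt0.
by rewrite exprn_ege1//; have := mv_ge; lra.
Qed.

Lemma cvS_le k : 300 * cv (k + 1) <= cv k.
Proof. by rewrite (cvS k) ler_pM2r ?cv_gt0// mv_ge. Qed.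

Lemma cw_pow_lt (e : R) : 0 < e -> exists k : int, cw k < e.
Proof.
move=> e0; have [n hn] : exists n : nat, e^-1 < n%:R.
  by exists (Num.truncn e^-1).+1; exact: truncnS_gt.
exists n%:Z.
have h : cw 0 = 1 by rewrite /cw oppr0 expr0z.
have := cwD 0 n; rewrite h add0r => h1.
have h2 : n%:R <= 4 ^+ n :> R.
  by rewrite -natrX ler_nat; apply: ltnW; exact: ltn_expl.
have c0 := cw_gt0 n%:Z.
have : 1 < n%:R * e by rewrite mulrC -ltr_pdivrMl// mulr1.
move=> h3; rewrite -(ltr_pM2l (_ : 0 < n%:R)); last first.
  by rewrite (lt_trans _ hn)// invr_gt0.
apply: le_lt_trans h3; rewrite [leRHS]h1; exact: ler_wpM2r (ltW c0) _ _ h2.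
Qed.

Lemma cw_cv_big (x : R) : exists k : int, `|x| < cw k /\ `|x| < cv k.
Proof.
have [n hn] : exists n : nat, `|x| < n%:R.
  by exists (Num.truncn `|x|).+1; exact: truncnS_gt.
exists (- n%:Z); have h2 : n%:R <= 4 ^+ n :> R.
  by rewrite -natrX ler_nat; apply: ltnW; exact: ltn_expl.
split; apply: (lt_le_trans hn); rewrite /cw /cv opprK; first exact: h2.
apply: le_trans h2 _; rewrite -exprnP; apply: lerXn2r; rewrite ?nnegrE; have := mv_ge; lra.
Qed.

Lemma between_scale (e : R) : 0 < e -> exists k : int, e <= cw k /\ cw k < 4 * e.
Proof.
move=> e0; have [j hj] := cw_pow_lt e0.
have [k0 [hk0 _]] := cw_cv_big e.
have hk : e < cw k0 by apply: le_lt_trans hk0; exact: ler_norm.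
pose P n := e <= cw (j - n%:Z).
have [n Pn] : exists n, P n.
  exists `|j - k0|%N; rewrite /P; apply: le_trans (ltW hk) _.
  have [|z [z1 ->]] := @cw_le (j - `|j - k0|%N%:Z) k0; first lia.
  by rewrite ler_peMl ?(ltW (cw_gt0 _))// ler1z.
case: (ex_minnP (ex_intro _ n Pn)) => m Pm mmin.
exists (j - m%:Z); split=> //.
case: m Pm mmin => [|m] Pm mmin; first by rewrite /P subr0 leNgt hj in Pm.
have : ~~ P m by apply/negP => /mmin; rewrite ltnn.
rewrite /P -ltNge => h.
have -> : (j - m.+1%:Z)%R = (j - m%:Z - 1)%R by rewrite intS; ring.
rewrite (cwS (j - m%:Z - 1)) subrK; lra.
Qed.

End Scales.

(** * The quotient distance and its elementary bounds *)

Section Metric.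
Context {R : realType} (L : nat).
Hypothesis hL : (100 <= L)%N.
Notation cw := (@cw R).
Notation cv := (@cv R L).

Lemma gen_equiv_equiv (G : R * R -> R * R -> Prop) : is_equivalence (gen_equiv G).
Proof.
split; first by move=> x E [].
split.
  by move=> x y xy E eE GE; case: (eE) => _ [sE _]; apply: sE; apply: xy.
move=> x y z xy yz E eE GE; case: (eE) => _ [_ tE].
by apply: (tE _ y); [apply: xy|apply: yz].
Qed.

(* Identifications are indexed by [n = j + 1] instead of the exponent [j] of [Phi]: those of generation
   [n] sit at the abscissas [(4 k + i) * cw n] and shift by one row of height [cv n]. In particular the
   abscissa determines [n], and those of generation [n <= i] are multiples of [cw i]. *)
Lemma Rinf_ind (E : R * R -> R * R -> Prop) : is_equivalence E ->
  (forall (n k l : int) (i : nat) y, (1 <= i <= 3)%N ->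
    (3 * l + i%:Z - 1)%:~R * cv n <= y <= (3 * l + i%:Z)%:~R * cv n ->
    E ((4 * k + i%:Z)%:~R * cw n, y) ((4 * k + i%:Z)%:~R * cw n, y + cv n)) ->
  forall p q, Rinf L p q -> E p q.
Proof.
move=> eE HE p q; apply => // _ _ [j [a [b [rab [-> ->]]]]].
have M0 := mv_ge (R:=R) hL.
apply: (rab (fun p q => E (Phi L j p) (Phi L j q))).
  case: eE => rE [sE tE]; split; first by move=> x; apply: rE.
  by split=> [x y|x y z]; [apply: sE|apply: tE].
move=> [x y] b' [k [l [i [hi [[/= h1 h2] ->]]]]]; rewrite /Phi /=.
have c0 := cv_gt0 (R := R) hL (j + 1).
have e1 : cw j * x = (4 * k + i%:Z)%:~R * cw (j + 1).
  by rewrite h1 (cwS j) intrD intrM; field.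
have e2 : cv j * y + cv (j + 1) = cv j * (y + (mv R L)^-1).
  by rewrite (cvS (R := R) hL j); field; apply/eqP; lra.
rewrite -/(cw j) -/(cv j) -e2 e1; apply: (HE _ _ l) => //.
rewrite (cvS (R := R) hL j); set c := cv (j + 1) in c0 *; set m := mv R L in M0 h2 *.
have m0 : 0 < m by lra.
move: h2; rewrite ler_pdivrMr// ler_pdivlMr// => /andP[h2 h3].
have -> : m * c * y = y * m * c by ring.
by apply/andP; split; rewrite ler_pM2r.
Qed.

Lemma Rinf_equiv : is_equivalence (@Rinf R L).
Proof. exact: gen_equiv_equiv. Qed.

Lemma Rinf_ident (n k l : int) (i : nat) (y : R) : (1 <= i <= 3)%N ->
  (3 * l + i%:Z - 1)%:~R * cv n <= y <= (3 * l + i%:Z)%:~R * cv n ->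
  Rinf L ((4 * k + i%:Z)%:~R * cw n, y) ((4 * k + i%:Z)%:~R * cw n, y + cv n).
Proof.
move=> hi /andP[h1 h2] E _; apply; have M0 := mv_ge (R:=R) hL.
have e : n - 1 + 1 = n by rewrite subrK.
have c0 := cv_gt0 (R := R) hL n; have Mn0 : mv R L != 0 by apply/eqP; lra.
have cn0 : cv n != 0 by apply/eqP; lra.
have ec := cvS (R := R) hL (n - 1); rewrite e in ec.
have ew := cwS (R := R) (n - 1); rewrite e in ew.
exists (n - 1), (k%:~R + i%:R / 4, y / cv (n - 1)),
  (k%:~R + i%:R / 4, y / cv (n - 1) + (mv R L)^-1); split.
  move=> E' _; apply; exists k, l, i; split=> //; split=> //; split=> //=.
  set m := mv R L in M0 Mn0 ec *; set c := cv n in c0 cn0 ec h1 h2 *.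
  have m0 : 0 < m by lra.
  have -> : y / cv (n - 1) = y / c / m by rewrite ec invfM mulrA mulrAC.
  by rewrite !ler_pM2r ?invr_gt0// ler_pdivlMr// ler_pdivrMr// h1 h2.
have ex : (4 * k + i%:Z)%:~R * cw n = cw (n - 1) * (k%:~R + i%:R / 4).
  by rewrite ew intrD intrM; field.
have ey z : cv (n - 1) * (y / cv (n - 1) + z / mv R L) = y + z * cv n.
  have cn1 : cv (n - 1) != 0 by rewrite ec mulf_neq0.
  rewrite mulrDr mulrCA divff// mulr1; congr (_ + _).
  by rewrite ec mulrCA mulrAC divff// mul1r.
rewrite /Phi -/(cw (n - 1)) -/(cv (n - 1)) /= ex; split; congr pair.
  by have := ey 0; rewrite !mul0r !addr0 => ->.
by have := ey 1; rewrite !mul1r => ->.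
Qed.

Lemma cell_floor k (p : R * R) :
  cell L k (Num.floor (p.1 / cw k)) (Num.floor (p.2 / cv k)) p.
Proof.
have w0 := cw_gt0 (R := R) k; have v0 := cv_gt0 (R := R) hL k.
rewrite /cell /= -/(cw k) -/(cv k).
have /andP[a1 a2] := floor_itv (p.1 / cw k); have /andP[b1 b2] := floor_itv (p.2 / cv k).
by rewrite -ler_pdivlMr// a1 -ler_pdivrMr// (ltW a2) -ler_pdivlMr// b1 -ler_pdivrMr// (ltW b2).
Qed.

Lemma admissible0 : admissible L (fun _ _ : R * R => 0).
Proof.
split=> //; split=> //; split=> //; split; first by move=> *; rewrite addr0.
by split=> // *; exact/ltW/cw_gt0.
Qed.

(** Boundedness is what makes the real supremum in [dinf] meaningful. Each point shares with the
    origin one large cell, chosen among the four around the origin by the signs of the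
    coordinates. *)
Lemma dinf_ub (x y : R * R) : exists M : R, forall d, admissible L d -> d x y <= M.
Proof.
have H (z : R * R) : exists k, forall d, admissible L d -> d z (0, 0) <= cw k.
  have [k1 [a1 a2]] := cw_cv_big (R := R) hL (`|z.1| + `|z.2|); exists k1 => d.
  move: a1 a2; rewrite (ger0_norm (addr_ge0 _ _))// => a1 a2.
  move=> [_ [_ [_ [_ [_ H]]]]].
  have b1 := normr_ge0 z.1; have b2 := normr_ge0 z.2.
  have [c1 c2] : `|z.1| <= cw k1 /\ `|z.2| <= cv k1 by split; lra.
  move: c1 c2; rewrite !ler_norml => /andP[c1 c2] /andP[c3 c4].
  have w0 := cw_gt0 (R := R) k1; have v0 := cv_gt0 (R := R) hL k1.
  apply: (H k1 (if 0 <= z.1 then 0 else -1) (if 0 <= z.2 then 0 else -1));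
  rewrite /cell /= -/(cw _) -/(cv _); (case: (lerP 0 z.1) => s1; case: (lerP 0 z.2) => s2;
   rewrite ?add0r ?mul0r ?mul1r ?addNr ?mul0r ?mulN1r; split; lra).
have [k Hk] := H x; have [k' Hk'] := H y; exists (cw k + cw k') => d ad.
have [_ [_ [sd [td _]]]] := ad.
apply: le_trans (td x (0, 0) y) _; rewrite lerD ?Hk// sd; exact: Hk'.
Qed.

Lemma dinf_ge d (x y : R * R) : admissible L d -> d x y <= dinf L x y.
Proof.
move=> ad; have [M HM] := dinf_ub x y; apply: ub_le_sup; last by exists d.
by exists M => _ [d' ad' <-]; apply: HM.
Qed.

Lemma dinf_le c (x y : R * R) : (forall d, admissible L d -> d x y <= c) -> dinf L x y <= c.
Proof.
move=> H; apply: ge_sup; last by move=> _ [d ad <-]; apply: H.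
by exists 0, (fun _ _ => 0) => //; exact: admissible0.
Qed.

Lemma dinf_ge0 (x y : R * R) : 0 <= dinf L x y.
Proof.
exact: (@dinf_ge (fun _ _ => 0) _ _ admissible0).
Qed.

Lemma dinf_Rinf (x y : R * R) : Rinf L x y -> dinf L x y = 0.
Proof.
move=> h; apply/eqP; rewrite eq_le dinf_ge0 andbT; apply: dinf_le => d.
by move=> [_ [_ [_ [_ [H _]]]]]; rewrite H.
Qed.

Lemma dinfxx (x : R * R) : dinf L x x = 0.
Proof. by apply: dinf_Rinf; case: Rinf_equiv => H _; apply: H. Qed.

Lemma dinf_sym (x y : R * R) : dinf L x y = dinf L y x.
Proof.
have H (a b : R * R) : dinf L a b <= dinf L b a.
  apply: dinf_le => d ad; have [_ [_ [-> _]]] := ad; exact: dinf_ge.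
by apply/eqP; rewrite eq_le !H.
Qed.

Lemma dinf_tri (y x z : R * R) : dinf L x z <= dinf L x y + dinf L y z.
Proof.
apply: dinf_le => d ad; have [_ [_ [_ [td _]]]] := ad.
by apply: le_trans (td x y z) _; rewrite lerD// dinf_ge.
Qed.

Lemma dinf_cell (k a b : int) (x y : R * R) : cell L k a b x -> cell L k a b y -> dinf L x y <= cw k.
Proof.
by move=> hx hy; apply: dinf_le => d [_ [_ [_ [_ [_ H]]]]]; apply: H hx hy.
Qed.

(** [|f x - f y|] is itself an admissible pseudodistance; the nontrivial lower bounds on [dinf] all
    come from a choice of [f]. *)
Lemma dinf_ge_fun (f : R * R -> R) :
  (forall (n k l : int) (i : nat) y, (1 <= i <= 3)%N ->
    (3 * l + i%:Z - 1)%:~R * cv n <= y <= (3 * l + i%:Z)%:~R * cv n ->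
    f ((4 * k + i%:Z)%:~R * cw n, y) = f ((4 * k + i%:Z)%:~R * cw n, y + cv n)) ->
  (forall (k a b : int) x y, cell L k a b x -> cell L k a b y -> `|f x - f y| <= cw k) ->
  forall x y, `|f x - f y| <= dinf L x y.
Proof.
move=> H1 H2 x y; apply: (@dinf_ge (fun x y => `|f x - f y|)).
split; first by move=> z; rewrite subrr normr0.
split; first by move=> *; exact: normr_ge0.
split; first by move=> *; rewrite distrC.
split; first by move=> u v t; exact: ler_distD.
split; last exact: H2.
suff H : forall p q, Rinf L p q -> f p = f q by move=> p q /H ->; rewrite subrr normr0.
apply: Rinf_ind => //; split=> //; split=> [? ? ->//|? ? ? -> ->//].
Qed.

(** Identifications preserve abscissas, so the first coordinate is a legitimate test function. *)
Lemma dinf_ge_fst (x y : R * R) : `|x.1 - y.1| <= dinf L x y.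
Proof.
apply: (@dinf_ge_fun fst) => // k a b p q [/andP[h1 h2] _] [/andP[h3 h4] _].
rewrite -/(cw k) in h1 h2 h3 h4.
by move: h2 h4; rewrite intrD mulrDl mul1r ler_norml => *; lra.
Qed.

(** Walk along one row of cells of scale [k]: each end costs one cell, and rounding both ends down
    to the grid lengthens the walk by at most one more. *)
Lemma dinf_horizontal_cells k (x x' y : R) : x <= x' ->
  dinf L (x, y) (x', y) <= x' - x + 3 * cw k.
Proof.
move=> xx'; have w0 := cw_gt0 (R := R) k.
set a := Num.floor (x / cw k); set a' := Num.floor (x' / cw k).
have aa' : (a <= a')%R by apply: le_floor; rewrite ler_pM2r ?invr_gt0.
have step z : dinf L (z, y) ((Num.floor (z / cw k))%:~R * cw k, y) <= cw k.
  have [/= h1 h2] := cell_floor k (z, y).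
  apply: (@dinf_cell k (Num.floor (z / cw k)) (Num.floor (y / cv k))); first by split.
  by split=> //=; rewrite -/(cw k) lexx ler_pM2r// ler_int; lia.
have grid n : dinf L (a%:~R * cw k, y) ((a + n%:Z)%:~R * cw k, y) <= n%:R * cw k.
  elim: n => [|n IH]; first by rewrite addr0 dinfxx mul0r.
  apply: le_trans (dinf_tri ((a + n%:Z)%:~R * cw k, y) _ _) _.
  rewrite -addn1 natrD mulrDl mul1r lerD//.
  have [/= _ h2] := cell_floor k (0, y).
  apply: (@dinf_cell k (a + n%:Z) (Num.floor (y / cv k))); split=> //=; rewrite -/(cw k) ?lexx /=.
    by rewrite ler_pM2r// ler_int; lia.
  by rewrite PoszD addrA lexx andbT ler_pM2r// ler_int; lia.
have ea : (a + `|a' - a|%N%:Z)%R = a' by lia.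
have := grid `|a' - a|%N; rewrite ea => g.
have e : (`|a' - a|%N%:R : R) = a'%:~R - a%:~R.
  by rewrite -intrB -[in RHS](gez0_abs (_ : (0 <= a' - a)%R)) ?subr_ge0.
rewrite e in g.
apply: le_trans (dinf_tri (a%:~R * cw k, y) _ _) _.
have t2 := dinf_tri (a'%:~R * cw k, y) (a%:~R * cw k, y) (x', y).
have s1 := step x; have s2 := step x'; rewrite dinf_sym in s2.
have /andP[] := floor_itv (x / cw k); rewrite ltr_pdivrMr// -/a intrD mulrDl mul1r => _ f1.
have /andP[] := floor_itv (x' / cw k); rewrite ler_pdivlMr// -/a' => f2 _.
rewrite mulrBl in g.
rewrite -/a in s1; rewrite -/a' in s2; lra.
Qed.

Lemma dinf_horizontal (x x' y : R) : dinf L (x, y) (x', y) = `|x - x'|.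
Proof.
apply/eqP; rewrite eq_le (dinf_ge_fst (x, y) (x', y)) andbT.
wlog xx' : x x' / x <= x' => [H|].
  by have /orP[h|h] := le_total x x'; [exact: H|rewrite dinf_sym distrC; exact: H].
rewrite ler0_norm ?subr_le0// opprB; apply/ler_addgt0Pr => e e0.
have [|k hk] := cw_pow_lt (_ : 0 < e / 3); first lra.
apply: le_trans (dinf_horizontal_cells k _ xx') _; lra.
Qed.

(** Two stacked cells cover such a vertical segment. *)
Lemma dinf_vertical_step k (x y t : R) : 0 <= t <= cv k ->
  dinf L (x, y) (x, y + t) <= 2 * cw k.
Proof.
move=> /andP[t0 t1]; have w0 := cw_gt0 (R := R) k; have v0 := cv_gt0 (R := R) hL k.
set a := Num.floor ((y + t) / cv k); set z := a%:~R * cv k.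
have [/= h0 _] := cell_floor k (x, y).
have /andP[] := floor_itv ((y + t) / cv k); rewrite -/a ler_pdivlMr// ltr_pdivrMr//.
rewrite intrD mulrDl mul1r -/z => a1 a2.
case: (lerP z y) => zy.
  suff : dinf L (x, y) (x, y + t) <= cw k by lra.
  apply: (@dinf_cell k (Num.floor (x / cw k)) a); split=> //=; rewrite -/(cv k) -/z.
    by rewrite intrD mulrDl mul1r -/z; lra.
  by rewrite intrD mulrDl mul1r -/z; lra.
apply: le_trans (dinf_tri (x, z) _ _) _.
rewrite mulr_natl mulr2n lerD//.
  apply: (@dinf_cell k (Num.floor (x / cw k)) (a - 1)); split=> //=; rewrite -/(cv k) subrK -/z ?lexx ?andbT.
    by rewrite intrD mulrDl mulN1r -/z; lra.
  by rewrite intrD mulrDl mulN1r -/z; lra.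
apply: (@dinf_cell k (Num.floor (x / cw k)) a); split=> //=; rewrite -/(cv k) -/z ?lexx.
  by rewrite intrD mulrDl mul1r -/z; lra.
by rewrite intrD mulrDl mul1r -/z; lra.
Qed.

Lemma dinf_vertical k (n : nat) (x y y' : R) : `|y - y'| <= n%:R * cv k ->
  dinf L (x, y) (x, y') <= 2 * n%:R * cw k.
Proof.
have v0 := cv_gt0 (R := R) hL k; have w0 := cw_gt0 (R := R) k.
wlog yy' : y y' / y <= y' => [H|].
  by have /orP[h|h] := le_total y y'; [exact: H|rewrite dinf_sym distrC; exact: H].
rewrite ler0_norm ?subr_le0// opprB.
elim: n y yy' => [|n IH] y yy'.
  move=> h; have -> : y' = y by move: h; rewrite mul0r => h; lra.
  by rewrite dinfxx !mulr_ge0// ltW.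
rewrite -natr1 mulrDl mul1r => h.
case: (lerP (y' - y) (cv k)) => h1.
  have := @dinf_vertical_step k x y (y' - y); rewrite addrCA subrr addr0.
  have h2 : 0 <= 2 * n%:R * cw k by rewrite !mulr_ge0// ltW.
  by move=> h3; apply: le_trans (h3 _) _; lra.
apply: le_trans (dinf_tri (x, y + cv k) _ _) _.
have h2 := IH (y + cv k); have h3 := @dinf_vertical_step k x y (cv k).
have -> : 2 * (n%:R + 1) * cw k = 2 * cw k + 2 * n%:R * cw k by ring.
by apply: lerD; [apply: h3|apply: h2]; lra.
Qed.

End Metric.

(** * Collapsing the fine identifications *)

Section Periodization.
Context {R : realType}.

(* The [P]-periodic function that agrees with [phi] on [0, P[. *)
Definition per (P : R) (phi : R -> R) (z : R) : R :=
  phi (z - (Num.floor (z / P))%:~R * P).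

Lemma per_eq (P : R) phi (n : int) (t : R) : 0 < P -> 0 <= t < P ->
  per P phi (n%:~R * P + t) = phi t.
Proof.
move=> P0 /andP[t0 t1]; rewrite /per (@floor_def _ _ n) ?[_ + t]addrC ?addrK//.
by rewrite ler_pdivlMr// ltr_pdivrMr// intrD mulrDl mul1r; lra.
Qed.

(** Points in different periods are compared through the common value [phi 0 = phi P] at the grid
    points between them, so the constant is preserved. *)
Lemma per_lip (P : R) phi (K : R) : 0 < P ->
  (forall s t, `|phi s - phi t| <= K * `|s - t|) -> phi P = phi 0 ->
  forall z z', `|per P phi z - per P phi z'| <= K * `|z - z'|.
Proof.
move=> P0 Kphi phiP z z'.
wlog zz' : z z' / z <= z' => [H|].
  by have /orP[h|h] := le_total z z'; [exact: H|rewrite distrC (distrC z); exact: H].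
rewrite /per; set n := Num.floor (z / P); set n' := Num.floor (z' / P).
have nn' : (n <= n')%R by apply: le_floor; rewrite ler_pM2r ?invr_gt0.
have [->|nne] := eqVneq n n'.
  by apply: le_trans (Kphi _ _) _; rewrite opprB addrA subrK.
have n1 : (n + 1 <= n')%R by lia.
have /andP[a1 a2] := floor_itv (z / P); have /andP[b1 b2] := floor_itv (z' / P).
rewrite -/n ler_pdivlMr// ltr_pdivrMr// in a1 a2; rewrite -/n' ler_pdivlMr// ltr_pdivrMr// in b1 b2.
have K0 : 0 <= K by have := Kphi 1 0; rewrite subr0 normr1 mulr1 => /(le_trans (normr_ge0 _)).
have h1 : `|phi (z - n%:~R * P) - phi 0| <= K * (P - (z - n%:~R * P)).
  rewrite -phiP; apply: le_trans (Kphi _ _) _.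
  rewrite intrD mulrDl mul1r in a2.
  by rewrite ler_wpM2l// distrC ger0_norm; lra.
have h2 : `|phi 0 - phi (z' - n'%:~R * P)| <= K * (z' - n'%:~R * P).
  apply: le_trans (Kphi _ _) _.
  by rewrite ler_wpM2l// distrC ger0_norm; lra.
apply: le_trans (ler_distD (phi 0) _ _) _; apply: le_trans (lerD h1 h2) _.
rewrite -mulrDr ler_wpM2l// ler0_norm ?subr_le0// opprB.
have : (n + 1)%:~R * P <= n'%:~R * P by rewrite ler_pM2r// ler_int.
rewrite intrD mulrDl mul1r; lra.
Qed.

Lemma per_bound (P : R) phi (a b : R) : 0 < P ->
  (forall t, 0 <= t <= P -> a <= phi t <= b) -> forall z, a <= per P phi z <= b.
Proof.
move=> P0 H z; apply: H.
have /andP[a1 a2] := floor_itv (z / P).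
rewrite ler_pdivlMr// in a1; rewrite ltr_pdivrMr// intrD mulrDl mul1r in a2; lra.
Qed.

(** For [i] from 1 to 3 the tent vanishes at 0 and 4, so [theta i] is continuous. It is 1 at the
    integers congruent to [i] modulo 4 and 0 at the others: it switches a collapse on and off along
    the abscissa. *)
Definition tent (i : nat) (t : R) : R := Num.max 0 (1 - `|t - i%:R|).
Definition theta (i : nat) : R -> R := per 4 (tent i).
(* [t + kap t] is constant on [0, 2], so that [z + kappa z] collapses two rows out of three. *)
Definition kap (t : R) : R := Num.max (1 - t) (2 * t - 5).
Definition kappa : R -> R := per 3 kap.

Lemma max_lip (a b c d e : R) : `|a - c| <= e -> `|b - d| <= e ->
  `|Num.max a b - Num.max c d| <= e.
Proof. by rewrite !ler_norml /Num.max; do 2!case: ltP => ?; lra. Qed.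

Lemma tent_lip i s t : `|tent i s - tent i t| <= 1 * `|s - t|.
Proof.
rewrite mul1r; apply: max_lip; first by rewrite subrr normr0.
have -> : 1 - `|s - i%:R| - (1 - `|t - i%:R|) = `|t - i%:R| - `|s - i%:R| by ring.
apply: le_trans (ler_dist_dist _ _) _; rewrite distrC.
by have -> : s - i%:R - (t - i%:R) = s - t by ring.
Qed.

Lemma ideal_range (i : nat) : (1 <= i <= 3)%N -> 1 <= (i%:R : R) <= 3.
Proof. by case/andP => h1 h2; rewrite (ler_nat _ 1) (ler_nat _ _ 3) h1 h2. Qed.

Lemma tent_ends i : (1 <= i <= 3)%N -> tent i 0 = 0 /\ tent i 4 = 0.
Proof.
move=> /ideal_range /andP[h1 h2]; rewrite /tent; split; apply/max_idPl.
  by rewrite sub0r normrN ger0_norm; lra.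
by rewrite ger0_norm; lra.
Qed.

Lemma theta_lip i z z' : (1 <= i <= 3)%N -> `|theta i z - theta i z'| <= `|z - z'|.
Proof.
move=> hi; rewrite -[leRHS]mul1r; apply: per_lip; [lra|exact: tent_lip|].
by have [-> ->] := tent_ends hi.
Qed.

Lemma theta_bound i z : 0 <= theta i z <= 1.
Proof.
apply: per_bound; first lra.
move=> t _; rewrite /tent le_max lexx /= ge_max ler01 /=.
have := normr_ge0 (t - i%:R); lra.
Qed.

Lemma theta_nat i j (n : int) : (1 <= i <= 3)%N -> (1 <= j <= 3)%N ->
  theta i ((4 * n + j%:Z)%:~R) = (i == j)%:R.
Proof.
move=> hi hj; rewrite /theta intrD intrM mulrC.
have /andP[h1 h2] := ideal_range hj.
rewrite per_eq; [|lra|rewrite -pmulrn; lra].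
rewrite /tent; have [->|ne] := eqVneq i j; first by rewrite subrr normr0 subr0; apply/max_idPr; lra.
apply/max_idPl; rewrite subr_le0.
have /orP[h|h] : (i.+1 <= j)%N || (j.+1 <= i)%N by move: ne; lia.
  by rewrite ger0_norm; move: h; rewrite -(ler_nat R) -natr1 -pmulrn; lra.
by rewrite ler0_norm; move: h; rewrite -(ler_nat R) -natr1 -pmulrn; lra.
Qed.

Lemma theta_int i (n : int) : (1 <= i <= 3)%N -> theta i (4 * n)%:~R = 0.
Proof.
move=> hi; rewrite /theta intrM mulrC -[X in per _ _ X]addr0 per_eq; [|lra..].
by have [-> _] := tent_ends hi.
Qed.

Lemma kap_lip s t : `|kap s - kap t| <= 2 * `|s - t|.
Proof.
have h : forall x : R, `|2 * x| = 2 * `|x| by move=> x; rewrite normrM ger0_norm//; lra.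
have h1 := normr_ge0 (s - t).
apply: max_lip.
  have -> : 1 - s - (1 - t) = t - s by ring.
  by rewrite distrC; lra.
have -> : 2 * s - 5 - (2 * t - 5) = 2 * (s - t) by ring.
by rewrite h.
Qed.

Lemma kappa_lip z z' : `|kappa z - kappa z'| <= 2 * `|z - z'|.
Proof.
apply: per_lip; [lra|exact: kap_lip|rewrite /kap].
by have /max_idPr -> : 1 - 3 <= 2 * 3 - 5 :> R; [lra|have /max_idPl -> : 2 * 0 - 5 <= 1 - 0 :> R; lra].
Qed.

Lemma kappa_bound z : `|kappa z| <= 1.
Proof.
rewrite ler_norml; apply: per_bound; first lra.
by move=> t /andP[t0 t3]; rewrite /kap /Num.max; case: ltP => ?; lra.
Qed.

(** Both [z] and [z + 1] lie in the part of the period where [t + kap t] is constant. *)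
Lemma kappa_shift (l : int) (z : R) : (3 * l)%:~R <= z <= (3 * l + 1)%:~R ->
  kappa (z + 1) = kappa z - 1.
Proof.
rewrite intrD !intrM => /andP[h1 h2].
have -> : z = l%:~R * 3 + (z - l%:~R * 3) by ring.
rewrite -addrA /kappa !per_eq; [|lra..].
rewrite /kap; set t := z - _; have [t0 t1] : 0 <= t /\ t <= 1 by rewrite /t; split; lra.
by have /max_idPl -> : 2 * t - 5 <= 1 - t; [lra|have /max_idPl -> : 2 * (t + 1) - 5 <= 1 - (t + 1); lra].
Qed.

End Periodization.

(** * Composition of the collapses of all fine generations *)

Section Collapse.
Context {R : realType} (L : nat).
Hypothesis hL : (100 <= L)%N.
Notation cw := (@cw R).
Notation cv := (@cv R L).
Let cw0 n : 0 < cw n. Proof. exact: cw_gt0. Qed.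
Let cv0 n : 0 < cv n. Proof. exact: cv_gt0. Qed.

Definition hterm (n : int) (x y : R) (i : nat) : R :=
  theta i (x / cw n) * kappa (y / cv n - (i%:R - 1)).

(* Collapses the pairs of rows identified at generation [n], fully at the abscissas of these
   identifications and not at all at the multiples of [cw (n - 1)], by linear interpolation. *)
Definition Hl (n : int) (x y : R) : R :=
  y + cv n * (hterm n x y 1 + hterm n x y 2 + hterm n x y 3).

Lemma hterm_bound n x y i : `|hterm n x y i| <= 1.
Proof.
rewrite /hterm normrM -[leRHS]mulr1 ler_pM ?normr_ge0 ?kappa_bound//.
by have /andP[h1 h2] := theta_bound i (x / cw n); rewrite ger0_norm.
Qed.

Lemma hterm_lip n x y x' y' i : (1 <= i <= 3)%N ->
  cv n * `|hterm n x y i - hterm n x' y' i| <= 2 * `|y - y'| + cv n / cw n * `|x - x'|.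
Proof.
move=> hi; rewrite /hterm; set t := theta i _; set k := kappa _.
set t' := theta i _; set k' := kappa _.
have e : t * k - t' * k' = t * (k - k') + (t - t') * k' by ring.
have h1 : `|t| <= 1 by have /andP[h1 h2] := theta_bound i (x / cw n); rewrite ger0_norm.
have h2 : `|k'| <= 1 := kappa_bound _.
have h3 : `|t - t'| <= `|x - x'| / cw n.
  apply: le_trans (theta_lip _ _ hi) _; rewrite -mulrBl normrM (ger0_norm (_ : 0 <= (cw n)^-1))//.
  by rewrite invr_ge0 ltW.
have h4 : `|k - k'| <= 2 * (`|y - y'| / cv n).
  apply: le_trans (kappa_lip _ _) _.
  have -> : y / cv n - (i%:R - 1) - (y' / cv n - (i%:R - 1)) = (y - y') / cv n by ring.
  by rewrite normrM (ger0_norm (_ : 0 <= (cv n)^-1))// invr_ge0 ltW.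
have h5 : `|t * (k - k')| <= 2 * (`|y - y'| / cv n).
  by rewrite normrM -[leRHS]mul1r ler_pM ?normr_ge0.
have h6 : `|(t - t') * k'| <= `|x - x'| / cw n.
  by rewrite normrM -[leRHS]mulr1 ler_pM ?normr_ge0.
rewrite e; apply: le_trans (_ : cv n * (2 * (`|y - y'| / cv n) + `|x - x'| / cw n) <= _).
  by rewrite ler_wpM2l ?(ltW (cv0 _))//; apply: le_trans (ler_normD _ _) _; exact: lerD.
rewrite mulrDr lerD//; last by rewrite mulrCA mulrC.
by rewrite mulrCA (mulrCA (cv n)) divff ?mulr1// gt_eqF.
Qed.

Lemma Hl_disp n x y : `|Hl n x y - y| <= 3 * cv n.
Proof.
have c0 := cv0 n; rewrite /Hl [y + _]addrC addrK normrM (ger0_norm (ltW c0)) mulrC ler_pM2r//.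
have h := hterm_bound n x y.
apply: le_trans (ler_normD _ _) _; have := ler_normD (hterm n x y 1) (hterm n x y 2).
have := h 1; have := h 2; have := h 3; lra.
Qed.

(** The 7 is 1 for [y] itself plus 2, the slope of [kappa], for each of the three terms; in [x] each
    term has slope [cv n / cw n]. *)
Lemma Hl_lip n x y x' y' :
  `|Hl n x y - Hl n x' y'| <= 7 * `|y - y'| + 3 * (cv n / cw n * `|x - x'|).
Proof.
have c0 := cv0 n; rewrite /Hl.
set a1 := hterm n x y 1; set a2 := hterm n x y 2; set a3 := hterm n x y 3.
set b1 := hterm n x' y' 1; set b2 := hterm n x' y' 2; set b3 := hterm n x' y' 3.
have -> : y + cv n * (a1 + a2 + a3) - (y' + cv n * (b1 + b2 + b3)) =
  (y - y') + (cv n * (a1 - b1) + cv n * (a2 - b2) + cv n * (a3 - b3)) by ring.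
have h i hi := @hterm_lip n x y x' y' i hi.
have h1 := h 1%N isT; have h2 := h 2%N isT; have h3 := h 3%N isT.
apply: le_trans (ler_normD _ _) _.
have g1 := ler_normD (cv n * (a1 - b1) + cv n * (a2 - b2)) (cv n * (a3 - b3)).
have g2 := ler_normD (cv n * (a1 - b1)) (cv n * (a2 - b2)).
rewrite !normrM !(ger0_norm (ltW c0)) in g1 g2.
rewrite -/a1 -/b1 in h1; rewrite -/a2 -/b2 in h2; rewrite -/a3 -/b3 in h3.
lra.
Qed.

Lemma Hl_id n (k : int) y : Hl n ((4 * k)%:~R * cw n) y = y.
Proof.
rewrite /Hl /hterm mulfK ?gt_eqF// !theta_int//.
by rewrite !mul0r !addr0 mulr0 addr0.
Qed.

Lemma Hl_ident n (k l : int) (i : nat) y : (1 <= i <= 3)%N ->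
  (3 * l + i%:Z - 1)%:~R * cv n <= y <= (3 * l + i%:Z)%:~R * cv n ->
  Hl n ((4 * k + i%:Z)%:~R * cw n) y = Hl n ((4 * k + i%:Z)%:~R * cw n) (y + cv n).
Proof.
move=> hi hy; have c0 := cv0 n.
have H z : Hl n ((4 * k + i%:Z)%:~R * cw n) z = z + cv n * kappa (z / cv n - (i%:R - 1)).
  rewrite /Hl /hterm mulfK ?gt_eqF// !theta_nat//.
  by case: i hi {hy} => [|[|[|[|]]]]//= _; rewrite ?mul0r ?mul1r ?add0r ?addr0.
rewrite !H mulrDl divff ?gt_eqF//.
have -> : y / cv n + 1 - (i%:R - 1) = y / cv n - (i%:R - 1) + 1 by ring.
rewrite (@kappa_shift _ l); first by ring.
move: hy => /andP[h1 h2]; rewrite -ler_pdivlMr// in h1; rewrite -ler_pdivrMr// in h2.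
rewrite !intrD -!pmulrn in h1 h2 *; set a := y / cv n in h1 h2 *.
by apply/andP; split; lra.
Qed.

(** The finest generation acts innermost. At an abscissa of some generation the finer ones are the
    identity, so that generation sees the original rows and collapses them, and the coarser ones are
    then applied to equal arguments. *)
Fixpoint Hc (m : nat) (n : int) (x y : R) : R :=
  if m is m'.+1 then Hl n x (Hc m' (n + 1) x y) else y.

Lemma Hc_disp m n x y : `|Hc m n x y - y| <= 4 * cv n.
Proof.
elim: m n => [|m IH] n /=; first by rewrite subrr normr0 mulr_ge0// ltW.
have := Hl_disp n x (Hc m (n + 1) x y); have := IH (n + 1); have := cvS_le (R := R) hL n.
have := cv0 n; rewrite !ler_norml => h0 h1 /andP[h2 h3] /andP[h4 h5].
by apply/andP; split; lra.
Qed.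

Lemma cvcw (i k : int) : (i <= k)%R -> cv k / cw k <= cv i / cw i.
Proof.
move=> ik; have [n ->] : exists n : nat, k = i + n%:Z.
  by exists `|k - i|%N; rewrite gez0_abs ?subr_ge0//; lia.
rewrite ler_pdivrMr// mulrAC ler_pdivlMr// (cvD (R := R) hL i n) (cwD i n).
have h : (4 : R) ^+ n <= mv R L ^+ n.
  by apply: lerXn2r; rewrite ?nnegrE; have := mv_ge (R := R) hL; lra.
have -> : mv R L ^+ n * cv (i + n%:Z) * cw (i + n%:Z) = mv R L ^+ n * (cv (i + n%:Z) * cw (i + n%:Z)) by ring.
have -> : cv (i + n%:Z) * (4 ^+ n * cw (i + n%:Z)) = 4 ^+ n * (cv (i + n%:Z) * cw (i + n%:Z)) by ring.
by rewrite ler_pM2r// mulr_gt0.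
Qed.

(** One level turns the bound into 7 times 2 plus 3, that is 17, times the slope of generation
    [i + 1], which is at most 1/75 of the slope of generation [i]. Hence the constant 2 survives any
    number of levels. *)
Lemma Hc_osc m i k x y x' y' : (i <= k)%R -> `|x - x'| <= cw k -> `|y - y'| <= cv k ->
  `|Hc m (i + 1) x y - Hc m (i + 1) x' y'| <= 2 * (cv i / cw i * cw k).
Proof.
move=> + hx hy; elim: m i => [|m IH] i ik /=.
  apply: le_trans hy _; have := cvcw ik; rewrite ler_pdivrMr// => h.
  by have := ltW (cv0 k); lra.
(* The induction stops at [k = i]; there the displacement, at most [4 * cv (i + 1)] for each point,
   is small against [cv i]. *)
have [e|ne] := eqVneq i k.
  subst k; rewrite divfK ?gt_eqF//.
  have := Hc_disp m.+1 (i + 1) x y; have := Hc_disp m.+1 (i + 1) x' y'.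
  have := cvS_le (R := R) hL i; have := cv0 i; move: hy; rewrite /= !ler_norml.
  by move=> /andP[? ?] ? ? /andP[? ?] /andP[? ?]; apply/andP; split; lra.
have ik1 : (i + 1 <= k)%R by move: ne ik; lia.
apply: le_trans (Hl_lip _ _ _ _ _) _.
have := IH _ ik1; have e : cv (i + 1) / cw (i + 1) * 75 <= cv i / cw i.
  rewrite (cwS (R := R) i) ler_pdivlMr ?mulr_gt0//.
  have -> : cv (i + 1) / cw (i + 1) * 75 * (4 * cw (i + 1)) = 300 * cv (i + 1).
    by field; rewrite gt_eqF.
  exact: cvS_le.
have e1 : cv (i + 1) / cw (i + 1) * `|x - x'| <= cv (i + 1) / cw (i + 1) * cw k.
  by rewrite ler_wpM2l// divr_ge0// ltW.
have e2 : cv (i + 1) / cw (i + 1) * 75 * cw k <= cv i / cw i * cw k by rewrite ler_pM2r.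
have e3 : 0 <= cv i / cw i * cw k by rewrite !mulr_ge0 ?invr_ge0 ?ltW.
lra.
Qed.

Lemma Hc_id m i (k : int) y : Hc m (i + 1) (k%:~R * cw i) y = y.
Proof.
elim: m i k => [//|m IH] i k /=.
have e : k%:~R * cw i = (4 * k)%:~R * cw (i + 1) by rewrite (cwS (R := R) i) intrM; ring.
by rewrite e IH Hl_id.
Qed.

Lemma Hc_ident m (d : nat) i (k l : int) (a : nat) y : (d < m)%N -> (1 <= a <= 3)%N ->
  let n := (i + d%:Z)%R in
  (3 * l + a%:Z - 1)%:~R * cv n <= y <= (3 * l + a%:Z)%:~R * cv n ->
  Hc m i ((4 * k + a%:Z)%:~R * cw n) y = Hc m i ((4 * k + a%:Z)%:~R * cw n) (y + cv n).
Proof.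
move=> + ha; elim: d m i => [|d IH] [//|m] i dm /=.
  by rewrite addr0 => hy; rewrite !Hc_id; exact: Hl_ident hy.
have -> : (i + d.+1%:Z)%R = (i + 1 + d%:Z)%R by rewrite intS; ring.
by move=> hy; rewrite IH.
Qed.

(** The additional innermost level moves the height by at most [3 * cv (n + m)], and each of the [m]
    outer levels expands this by at most 7, against a decay of [cv] by at least 300 per
    generation. *)
Lemma Hc_cauchy m n x y : `|Hc m.+1 n x y - Hc m n x y| <= 3 * cv n * (2^-1) ^+ m.
Proof.
elim: m n => [|m IH] n; first by rewrite expr0 mulr1; exact: Hl_disp.
have := Hl_lip n x (Hc m.+1 (n + 1) x y) x (Hc m (n + 1) x y).
rewrite subrr normr0 !mulr0 addr0 => h; apply: le_trans h _.
apply: le_trans (_ : 7 * (3 * cv (n + 1) * 2^-1 ^+ m) <= _); first by rewrite ler_pM2l ?IH//; lra.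
have p0 : 0 < (2^-1 : R) ^+ m by rewrite exprn_gt0//; lra.
have := cvS_le (R := R) hL n; have := cv0 (n + 1); rewrite exprS => h1 h2.
have -> : 7 * (3 * cv (n + 1) * 2^-1 ^+ m) = 21 * cv (n + 1) * 2^-1 ^+ m by ring.
have -> : 3 * cv n * (2^-1 * 2^-1 ^+ m) = (3 / 2 * cv n) * 2^-1 ^+ m by field.
rewrite ler_pM2r//; lra.
Qed.

Lemma geo_cauchy_cvg (u : nat -> R) (C : R) :
  (forall m, `|u m.+1 - u m| <= C * (2^-1) ^+ m) -> cvgn u.
Proof.
move=> H; have -> : u = cst (u 0%N) + series (telescope u).
  by apply/funext => n; rewrite (eq_sum_telescope u n).
apply: is_cvgD; first exact: is_cvg_cst.
apply: normed_cvg; apply: (@series_le_cvg _ _ (geometric C 2^-1)) => //.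
- by move=> n; exact: normr_ge0.
- by move=> n; apply: le_trans (H n); exact: normr_ge0.
- by apply: is_cvg_geometric_series; rewrite ger0_norm; lra.
Qed.

(* All generations from [n] on are collapsed: [HH n] is invariant under their identifications, is the
   identity at the abscissas of the coarser ones, and stays at the scale [cv n] from the height. *)
Definition HH (n : int) (x y : R) : R := limn (fun m => Hc m n x y).

Lemma HH_cvg n x y : (fun m => Hc m n x y) @ \oo --> HH n x y.
Proof. exact: geo_cauchy_cvg (fun m => Hc_cauchy m n x y). Qed.

Lemma cvg_norm_le (u : nat -> R) (l c : R) : u @ \oo --> l -> (forall n, `|u n| <= c) -> `|l| <= c.
Proof.
move=> ul H; have h : (fun n => `|u n|) @ \oo --> `|l| by exact: cvg_norm.
by rewrite -(cvg_lim (@Rhausdorff R) h); apply: limr_le; [exact: cvgP h|exact: nearW].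
Qed.

Lemma HH_disp n x y : `|HH n x y - y| <= 4 * cv n.
Proof.
apply: (@cvg_norm_le (fun m => Hc m n x y - y)); last by move=> m; exact: Hc_disp.
by apply: cvgB; [exact: HH_cvg|exact: cvg_cst].
Qed.

Lemma HH_osc i k x y x' y' : (i <= k)%R -> `|x - x'| <= cw k -> `|y - y'| <= cv k ->
  `|HH (i + 1) x y - HH (i + 1) x' y'| <= 2 * (cv i / cw i * cw k).
Proof.
move=> ik hx hy.
apply: (@cvg_norm_le (fun m => Hc m (i + 1) x y - Hc m (i + 1) x' y')); last by move=> m; exact: Hc_osc.
by apply: cvgB; exact: HH_cvg.
Qed.

Lemma HH_id i (k : int) y : HH (i + 1) (k%:~R * cw i) y = y.
Proof.
rewrite /HH; under eq_fun do rewrite Hc_id.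
exact: lim_cst.
Qed.

Lemma HH_ident (i n k l : int) (a : nat) y : (i <= n)%R -> (1 <= a <= 3)%N ->
  (3 * l + a%:Z - 1)%:~R * cv n <= y <= (3 * l + a%:Z)%:~R * cv n ->
  HH i ((4 * k + a%:Z)%:~R * cw n) y = HH i ((4 * k + a%:Z)%:~R * cw n) (y + cv n).
Proof.
move=> hin ha; have [d ->] : exists d : nat, n = i + d%:Z.
  by exists `|n - i|%N; rewrite gez0_abs ?subr_ge0//; lia.
move=> hy; set x := _ * cw _.
(* Iterates with at most [d] levels do not reach generation [n]; shifting the sequence by [d + 1]
   discards them. *)
rewrite [LHS]/HH; apply: cvg_lim => //.
have e : (fun m => Hc (m + d.+1) i x y) = (fun m => Hc (m + d.+1) i x (y + cv (i + d%:Z))).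
  by apply/funext => m; apply: Hc_ident => //; lia.
have := @HH_cvg i x (y + cv (i + d%:Z)); rewrite -(cvg_shiftn d.+1) /= -e => h.
by rewrite -(cvg_shiftn d.+1).
Qed.

End Collapse.

(** * Structure of small balls *)

Lemma int_neq_lt (m n : int) : m != n -> (m < n)%R \/ (n < m)%R.
Proof. by rewrite neq_lt => /orP. Qed.

Lemma int_le_or_lt (m n : int) : (m <= n)%R \/ (n < m)%R.
Proof. by case: (leP m n); [left|right]. Qed.

(** * Truncated distance to a finite set of heights *)

Section CappedDistance.
Context {R : realType}.

(** The truncation makes the function constant at distance [cap] or more from [A], so that
    identifications between such heights leave it unchanged. *)
Definition distA (cap : R) (A : seq R) (h : R) : R :=
  foldr (fun a m => Num.min `|h - a| m) cap A.

Lemma distA_cap cap A h : distA cap A h <= cap.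
Proof. by elim: A => [|a A IH] //=; rewrite ge_min IH orbT. Qed.

Lemma distA_mem cap A h a : a \in A -> distA cap A h <= `|h - a|.
Proof.
elim: A => [|b A IH] //=; rewrite inE => /orP[/eqP ->|/IH h1]; rewrite ge_min ?lexx//.
by rewrite h1 orbT.
Qed.

Lemma distA_ge cap A h c : c <= cap -> (forall a, a \in A -> c <= `|h - a|) -> c <= distA cap A h.
Proof.
move=> ccap; elim: A => [|b A IH] //= H; rewrite le_min H ?mem_head//=.
by apply: IH => a aA; apply: H; rewrite inE aA orbT.
Qed.

Lemma distA_lt cap A h c : c <= cap -> distA cap A h < c -> exists2 a, a \in A & `|h - a| < c.
Proof.
move=> ccap H; apply: contrapT => N.
have : c <= distA cap A h.
  by apply: distA_ge => // a aA; rewrite leNgt; apply/negP => ?; apply: N; exists a.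
by rewrite leNgt H.
Qed.

Lemma distA_lip cap A h h' : `|distA cap A h - distA cap A h'| <= `|h - h'|.
Proof.
wlog hh' : h h' / distA cap A h <= distA cap A h' => [H|].
  have /orP[?|?] := le_total (distA cap A h) (distA cap A h'); first exact: H.
  by rewrite distrC (distrC h); exact: H.
rewrite distrC ger0_norm ?subr_ge0//.
suff : distA cap A h' - `|h - h'| <= distA cap A h by lra.
apply: distA_ge => [|a aA].
  by apply: le_trans (distA_cap cap A h'); rewrite lerBlDl lerDr.
have := distA_mem cap h' aA; have := ler_distD h h' a; rewrite (distrC h' h); lra.
Qed.

Lemma distA_mono cap A h h' :
  (forall a, a \in A -> cap <= `|h - a| \/ exists2 a', a' \in A & `|h' - a'| <= `|h - a|) ->
  distA cap A h' <= distA cap A h.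
Proof.
move=> H; apply: distA_ge => [|a /H[ca|[a' a'A]]]; first exact: distA_cap.
- exact: le_trans (distA_cap _ _ _) ca.
- by move=> h1; apply: le_trans h1; exact: distA_mem.
Qed.

Lemma distA_eq_cap cap A h : (forall a, a \in A -> cap <= `|h - a|) -> distA cap A h = cap.
Proof. by move=> H; apply/eqP; rewrite eq_le distA_cap distA_ge. Qed.

Lemma ge_dist (x y c : R) : x + c <= y \/ y + c <= x -> c <= `|x - y|.
Proof. by rewrite ler_normr => -[h|h]; apply/orP; [right|left]; lra. Qed.

End CappedDistance.

(* One abscissa with its identifications of a coarse generation: [b l, b l + s] is glued to
   [b l + s, b l + 2 s], and [P] is a height. The gluing has classes of at most three points, and a
   neighbourhood of size [v <= s] of the class of [P] is what a small ball sees. *)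
Section Heights.
Context {R : realType}.
Variables (s v P : R) (a0 : int).
Hypotheses (v0 : 0 < v) (vs : v <= s).

Let b (l : int) : R := (3 * l + a0 - 1)%:~R * s.

Definition hlink (a a' : R) : Prop := a' = a + s /\
  exists e l, [/\ a - v <= e, e + v / 4 <= a + v, b l <= e & e + v / 4 <= b l + s].

Let bS l l' : (l < l')%R -> b l + 3 * s <= b l'.
Proof.
have v0' := v0; have vs' := vs.
move=> ll'; rewrite /b -mulrDl ler_pM2r; last lra.
have -> : 3 = (3 : int)%:~R :> R by [].
by rewrite -intrD ler_int; lia.
Qed.

(** Close to an endpoint of a glued row the reference set is the class of the endpoint instead of
    that of [P]: a neighbourhood of [P] may straddle the endpoint and meet all three levels. *)
Lemma heights_near l : `|P - b l| <= v / 4 \/ `|P - (b l + s)| <= v / 4 \/ `|P - (b l + 2 * s)| <= v / 4 ->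
  let A := [:: b l; b l + s; b l + 2 * s] in
  [/\ forall l' y, b l' <= y <= b l' + s -> distA (v / 2) A y = distA (v / 2) A (y + s),
      distA (v / 2) A P <= v / 4, hlink (b l) (b l + s) & hlink (b l + s) (b l + 2 * s)].
Proof.
have v0' := v0; have vs' := vs.
move=> hP A.
have m1 : b l \in A by rewrite !inE eqxx.
have m2 : b l + s \in A by rewrite !inE eqxx orbT.
have m3 : b l + 2 * s \in A by rewrite !inE eqxx !orbT.
split; last 3 first.
- by case: hP => [h|[h|h]]; apply: le_trans h; exact: distA_mem.
- by split=> //; exists (b l), l; split; lra.
- by split; [ring|exists (b l + s - v / 4), l; split; lra].
move=> l' y /andP[y1 y2].
have [e|ne] := eqVneq l' l.
  subst l'; apply/eqP; rewrite eq_le; apply/andP; split; apply: distA_mono => a;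
    rewrite !inE => /or3P[]/eqP ->.
  - by left; apply: ge_dist; right; lra.
  - by right; exists (b l) => //; have -> : y + s - (b l + s) = y - b l by ring.
  - right; exists (b l + s) => //.
    by have -> : y + s - (b l + 2 * s) = y - (b l + s) by ring.
  - by right; exists (b l + s) => //; have -> : y + s - (b l + s) = y - b l by ring.
  - right; exists (b l + 2 * s) => //.
    by have -> : y + s - (b l + 2 * s) = y - (b l + s) by ring.
  - by left; apply: ge_dist; left; lra.
have hl : b l' + 3 * s <= b l \/ b l + 3 * s <= b l'.
  have [h|h] := int_neq_lt ne.
      by left; exact: bS.
    by right; exact: bS.
rewrite !distA_eq_cap// => a; rewrite !inE => /or3P[]/eqP ->; apply: ge_dist;
  by case: hl => h; [left|right]; lra.
Qed.

(** Away from the endpoints the class of [P] has one or two points, and their neighbourhoods of size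
    [v / 4] stay inside rows, so no further level is met. *)
Lemma heights_far l : b l + v / 4 < P -> P < b l + 3 * s - v / 4 ->
  v / 4 < `|P - (b l + s)| -> v / 4 < `|P - (b l + 2 * s)| ->
  exists A, [/\ forall l' y, b l' <= y <= b l' + s -> distA (v / 4) A y = distA (v / 4) A (y + s),
      P \in A & (A = [:: P] \/ exists2 a, hlink a (a + s) & A = [:: a; a + s])].
Proof.
have v0' := v0; have vs' := vs.
move=> h0 h3; rewrite !lter_normr => h1 h2.
have {}h1 : P < b l + s - v / 4 \/ b l + s + v / 4 < P by case/orP: h1; [right|left]; lra.
have {}h2 : P < b l + 2 * s - v / 4 \/ b l + 2 * s + v / 4 < P by case/orP: h2; [right|left]; lra.
have pair a : a = P \/ a + s = P -> b l + v / 4 < a -> a < b l + s - v / 4 ->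
    exists A, [/\ forall l' y, b l' <= y <= b l' + s -> distA (v / 4) A y = distA (v / 4) A (y + s),
      P \in A & (A = [:: P] \/ exists2 a, hlink a (a + s) & A = [:: a; a + s])].
  move=> aP a1 a2; exists [:: a; a + s].
  have m1 : a \in [:: a; a + s] by rewrite !inE eqxx.
  have m2 : a + s \in [:: a; a + s] by rewrite !inE eqxx orbT.
  split; last 2 first.
  - by case: aP => <-.
  - by right; exists a => //; split=> //; exists (a - v / 4), l; split; lra.
  move=> l' y /andP[y1 y2].
  have [e|ne] := eqVneq l' l.
    subst l'; apply/eqP; rewrite eq_le; apply/andP; split; apply: distA_mono => a';
      rewrite !inE => /orP[]/eqP ->.
    - by left; apply: ge_dist; right; lra.
    - by right; exists a => //; have -> : y + s - (a + s) = y - a by ring.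
    - by right; exists (a + s) => //; have -> : y + s - (a + s) = y - a by ring.
    - by left; apply: ge_dist; left; lra.
  have hl : b l' + 3 * s <= b l \/ b l + 3 * s <= b l'.
    have [h|h] := int_neq_lt ne.
      by left; exact: bS.
    by right; exact: bS.
  rewrite !distA_eq_cap// => a'; rewrite !inE => /orP[]/eqP ->; apply: ge_dist;
    by case: hl => h; [left|right]; lra.
case: h1 => h1; first by apply: (pair P); [left|..]; lra.
case: h2 => h2; first by apply: (pair (P - s)); [right; ring|..]; lra.
exists [:: P]; split; [|by rewrite mem_head|by left].
move=> l' y /andP[y1 y2].
have hl : b l' <= b l \/ b l + 3 * s <= b l'.
  have [e|ne] := eqVneq l' l; first by left; rewrite e.
  have [h|h] := int_neq_lt ne.
    by left; have := bS h; lra.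
  by right; exact: bS.
rewrite !distA_eq_cap// => a; rewrite !inE => /eqP ->; apply: ge_dist;
  by case: hl => h; [left|right]; lra.
Qed.

(** In both cases the truncated distance at [P] lies at least [v / 4] below [cap]; this margin later
    fixes the radius of the ball. *)
Lemma heights : exists cap a A,
  [/\ 0 < cap <= v / 2, (size A <= 2)%N, path (fun a a' => `[< hlink a a' >]) a A,
      distA cap (a :: A) P + v / 4 <= cap &
      forall l y, b l <= y <= b l + s -> distA cap (a :: A) y = distA cap (a :: A) (y + s)].
Proof.
have v0' := v0; have vs' := vs.
have [[l hl]|N] := pselect (exists l, `|P - b l| <= v / 4 \/ `|P - (b l + s)| <= v / 4 \/
    `|P - (b l + 2 * s)| <= v / 4).
  have [H1 H2 H3 H4] := heights_near hl.
  exists (v / 2), (b l), [:: b l + s; b l + 2 * s]; split=> //; [lra| |lra].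
  by rewrite /= andbT; apply/andP; split; apply/asboolP.
have s0 : 0 < s by lra.
(* The period of length [3 * s] of the gluing that contains [P]. *)
pose l := Num.floor ((P / s - a0%:~R + 1) / 3).
have /andP[f1 f2] := floor_itv ((P / s - a0%:~R + 1) / 3).
have g1 : b l <= P.
  rewrite /b -ler_pdivlMr// intrB intrD intrM; rewrite -/l in f1; lra.
have g2 : P < b l + 3 * s.
  rewrite /b -mulrDl -ltr_pdivrMr// intrB intrD intrM; rewrite -/l intrD in f2; lra.
have n1 : v / 4 < `|P - b l| by rewrite ltNge; apply/negP => h; apply: N; exists l; left.
have n2 : v / 4 < `|P - (b l + s)| by rewrite ltNge; apply/negP => h; apply: N; exists l; right; left.
have n3 : v / 4 < `|P - (b l + 2 * s)| by rewrite ltNge; apply/negP => h; apply: N; exists l; right; right.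
have n4 : v / 4 < `|P - b (l + 1)| by rewrite ltNge; apply/negP => h; apply: N; exists (l + 1); left.
have e : b (l + 1) = b l + 3 * s by rewrite /b !(intrD, intrM, intrB); ring.
rewrite ger0_norm ?subr_ge0// in n1; rewrite e ltr0_norm ?subr_lt0// in n4.
have [||A [H1 PA H2]] := heights_far _ _ n2 n3; [lra|lra|].
have D0 : distA (v / 4) A P + v / 4 <= v / 4.
  by have := distA_mem (v / 4) P PA; rewrite subrr normr0; lra.
case: H2 => [eA|[a aA eA]]; subst A.
  by exists (v / 4), P, [::]; split=> //; lra.
exists (v / 4), a, [:: a + s]; split=> //; first lra.
by rewrite /= andbT; apply/asboolP.
Qed.

End Heights.

(** * Cutoff functions and the shape of a ball *)

Section Structure.
Context {R : realType} (L : nat).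
Hypothesis hL : (100 <= L)%N.
Notation cw := (@cw R).
Notation cv := (@cv R L).
Let cw0 n : 0 < cw n. Proof. exact: cw_gt0. Qed.
Let cv0 n : 0 < cv n. Proof. exact: cv_gt0. Qed.

(* A stretch of heights around [a] is identified with its translate around [a'] along the abscissa
   [(c + 1) * cw i], the middle of the window [c * cw i, (c + 2) * cw i]. *)
Definition link (i c : int) (a a' : R) : Prop :=
  exists e, [/\ a - cv i <= e, e + cv i / 4 <= a + cv i &
    forall t, 0 <= t <= cv i / 4 ->
      Rinf L ((c + 1)%:~R * cw i, e + t) ((c + 1)%:~R * cw i, e + t + (a' - a))].

(** In units of the finer width the coarser abscissa is a multiple of 4, whereas [4 * k' + a'] is
    not. *)
Lemma ident_unique (n n' k k' : int) (a a' : nat) : (1 <= a <= 3)%N -> (1 <= a' <= 3)%N ->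
  (4 * k + a%:Z)%:~R * cw n = (4 * k' + a'%:Z)%:~R * cw n' -> n = n' /\ a = a'.
Proof.
wlog nn' : n n' k k' a a' / (n <= n')%R => [H ha ha' e|ha ha'].
  have [h|h] : (n <= n')%R \/ (n' <= n)%R by lia.
    exact: H e.
  by have [] := H _ _ _ _ _ _ h ha' ha (esym e).
have [<-|ne] := eqVneq n n'.
  by move/(mulIf (lt0r_neq0 (cw0 n)))/(@intr_inj R) => e; split=> //; lia.
have [|z [_ ez]] := @cw_lt R n n'; first by move: ne => /eqP; lia.
rewrite ez mulrA -intrM => /(mulIf (lt0r_neq0 (cw0 n')))/(@intr_inj R).
have -> : (4 * k + a%:Z) * (4 * z) = 4 * ((4 * k + a%:Z) * z) :> int by ring.
by set t := (_ * z); lia.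
Qed.

Section Cutoff.
Variables (p : R * R) (i : int) (cap : R) (A : seq R).

(* After rescaling, [cutoff] is 1-Lipschitz on [X_infty] and bounds [dinf] from below. Identifications of
   generation at most [i] away from the middle abscissa are met where the cutoff is constant. *)
Definition cutoff (q : R * R) : R :=
  Num.min cap (cv i / cw i * `|q.1 - p.1| + distA cap A (HH L (i + 1) q.1 q.2)).

Hypotheses (cap0 : 0 < cap) (capv : cap <= cv i / 2).
Hypothesis inv : forall (n k l : int) (a : nat) y, (n <= i)%R -> (1 <= a <= 3)%N ->
  `|(4 * k + a%:Z)%:~R * cw n - p.1| < cw i / 2 ->
  (3 * l + a%:Z - 1)%:~R * cv n <= y <= (3 * l + a%:Z)%:~R * cv n ->
  distA cap A y = distA cap A (y + cv n).

Let r0 : 0 < cv i / cw i. Proof. by rewrite divr_gt0. Qed.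

Let distA_ge0 h : 0 <= distA cap A h.
Proof. by apply: distA_ge => [|a _]; [exact: ltW|exact: normr_ge0]. Qed.

Lemma cutoff_ge0 q : 0 <= cutoff q.
Proof.
by rewrite /cutoff le_min (ltW cap0) addr_ge0 ?distA_ge0// mulr_ge0 ?normr_ge0// ltW.
Qed.

Lemma cutoff_ident (n k l : int) (a : nat) y : (1 <= a <= 3)%N ->
  (3 * l + a%:Z - 1)%:~R * cv n <= y <= (3 * l + a%:Z)%:~R * cv n ->
  cutoff ((4 * k + a%:Z)%:~R * cw n, y) = cutoff ((4 * k + a%:Z)%:~R * cw n, y + cv n).
Proof.
move=> ha hy; rewrite /cutoff /=.
(* Finer generations are absorbed by [HH]. At a coarser abscissa [HH] is the identity: near [p] the
   hypothesis [inv] applies, and farther away the horizontal term alone reaches [cap]. *)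
have [h|h] := int_le_or_lt n i; last first.
  by move: h; rewrite -lezD1 => h; rewrite (HH_ident hL k h ha hy).
have [z [_ ez]] := @cw_le R n i h.
set x := (4 * k + a%:Z)%:~R * cw n.
have ex : x = ((4 * k + a%:Z) * z)%:~R * cw i by rewrite /x ez mulrA -intrM.
have [hx|hx] := ltP `|x - p.1| (cw i / 2).
  by rewrite ex !HH_id (inv h ha hx hy).
have hc : cap <= cv i / cw i * `|x - p.1|.
  apply: le_trans capv _; apply: (@le_trans _ _ (cv i / cw i * (cw i / 2))).
    by rewrite mulrA divfK ?gt_eqF.
  by rewrite ler_pM2l.
by rewrite !(min_idPl _)// ler_wpDr.
Qed.

Lemma min_lip (c a b : R) : `|Num.min c a - Num.min c b| <= `|a - b|.
Proof.
have := ler_norm (a - b); have := ler_norm (b - a); rewrite (distrC b) => h1 h2.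
by rewrite ler_norml /Num.min; do 2!case: ltP => ?; lra.
Qed.

(** The 3 is 2 from the collapsed height plus 1 from the horizontal term. On cells coarser than
    scale [i] the total variation [cap] is already below the bound. *)
Lemma cutoff_osc (k a b : int) q q' : cell L k a b q -> cell L k a b q' ->
  `|cutoff q - cutoff q'| <= 3 * (cv i / cw i) * cw k.
Proof.
move=> [/andP[x1 x2] /andP[y1 y2]] [/andP[x3 x4] /andP[y3 y4]].
rewrite -/(cw k) -/(cv k) in x1 x2 y1 y2 x3 x4 y3 y4.
rewrite intrD mulrDl mul1r in x2 x4; rewrite intrD mulrDl mul1r in y2 y4.
have dx : `|q.1 - q'.1| <= cw k by rewrite ler_norml; apply/andP; split; lra.
have dy : `|q.2 - q'.2| <= cv k by rewrite ler_norml; apply/andP; split; lra.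
have c0 := cw0 k; have c1 := cap0; have c2 := capv; have c3 := cw0 i; have c4 := r0.
have [ik|ki] := int_le_or_lt i k.
  apply: le_trans (min_lip _ _ _) _.
  have h1 := HH_osc hL ik dx dy.
  have h2 := distA_lip cap A (HH L (i + 1) q.1 q.2) (HH L (i + 1) q'.1 q'.2).
  have h3 : cv i / cw i * `|q.1 - p.1| - cv i / cw i * `|q'.1 - p.1| <= cv i / cw i * cw k.
    rewrite -mulrBr ler_pM2l//; apply: le_trans dx.
    by have := ler_distD q'.1 q.1 p.1; lra.
  have h4 : cv i / cw i * `|q'.1 - p.1| - cv i / cw i * `|q.1 - p.1| <= cv i / cw i * cw k.
    rewrite -mulrBr ler_pM2l//; apply: le_trans dx.
    by have := ler_distD q.1 q'.1 p.1; rewrite (distrC q'.1 q.1); lra.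
  have := le_trans h2 h1; rewrite !ler_norml => /andP[h5 h6].
  by apply/andP; split; lra.
have g1 : cutoff q <= cap by rewrite /cutoff ge_min lexx.
have g2 : cutoff q' <= cap by rewrite /cutoff ge_min lexx.
have g3 := cutoff_ge0 q; have g4 := cutoff_ge0 q'.
apply: (@le_trans _ _ cap); first by rewrite ler_norml; apply/andP; split; lra.
apply: le_trans capv _.
have [z [z1 ez]] := @cw_le R k i (ltW ki).
have wk : cw i <= cw k by rewrite ez ler_peMl ?ler1z// ltW.
apply: (@le_trans _ _ (cv i / cw i * cw i)).
  by rewrite divfK ?gt_eqF//; have := cv0 i; lra.
by have : cv i / cw i * cw i <= cv i / cw i * cw k; [rewrite ler_pM2l|
  have : 0 < cv i / cw i * cw k by [rewrite mulr_gt0]; lra].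
Qed.

(** Dividing by [3 * cv i / cw i] yields a test function for [dinf]; the radius is chosen so that
    the variation is the available margin. *)
Lemma cutoff_dinf q : dinf L p q < cw i / 12 -> `|cutoff p - cutoff q| < cv i / 4.
Proof.
have c0 := cw0 i; have c1 := cv0 i.
have K0 : 0 < cw i / (3 * cv i) by rewrite divr_gt0// mulr_gt0.
pose f q := cutoff q * (cw i / (3 * cv i)).
have H : `|f p - f q| <= dinf L p q.
  apply: (dinf_ge_fun hL) => [n k l a y ha hy|k a b x y hx hy].
    by rewrite /f (cutoff_ident _ ha hy).
  rewrite /f -mulrBl normrM (ger0_norm (ltW K0)) -ler_pdivlMr//.
  apply: le_trans (cutoff_osc hx hy) _.
  rewrite le_eqVlt; apply/orP; left; apply/eqP; field.
  by rewrite !gt_eqF.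
move=> h; have := le_lt_trans H h.
rewrite /f -mulrBl normrM (ger0_norm (ltW K0)) -ltr_pdivlMr//.
have -> // : cw i / 12 / (cw i / (3 * cv i)) = cv i / 4.
by field; rewrite !gt_eqF.
Qed.

(** The cutoff cannot climb to [cap] inside the ball, so the collapsed height of [q] is within
    [cv i / 2] of [A]; the true height differs from it by at most [4 * cv (i + 1)]. *)
Lemma cutoff_ball q : distA cap A (HH L (i + 1) p.1 p.2) + cv i / 4 <= cap ->
  dinf L p q < cw i / 12 -> exists2 a, a \in A & `|q.2 - a| <= cv i.
Proof.
move=> hcap /cutoff_dinf h.
have fp : cutoff p <= distA cap A (HH L (i + 1) p.1 p.2).
  by rewrite /cutoff subrr normr0 mulr0 add0r ge_min lexx orbT.
have fq : cutoff q < cap by move: h; rewrite ltr_norml => /andP[h1 h2]; lra.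
have : distA cap A (HH L (i + 1) q.1 q.2) < cap.
  move: fq; rewrite /cutoff gt_min ltxx /=; apply: le_lt_trans.
  by rewrite lerDr mulr_ge0 ?normr_ge0// ltW.
move=> /(distA_lt (lexx _)) [a aA ha]; exists a => //.
have := HH_disp hL (i + 1) q.1 q.2; have := cvS_le (R := R) hL i; have := cv0 i.
have c2 := capv; move: ha; rewrite !ler_norml ltr_norml.
by move=> /andP[? ?] ? ? /andP[? ?]; apply/andP; split; lra.
Qed.

End Cutoff.

(** Subtracting one half before rounding puts [p] in the middle half of a window of two cells, so
    the midpoint is the only multiple of [cw i] that can be closer than [cw i / 2]. *)
Lemma window (p : R) (i : int) (c := Num.floor (p / cw i - 2^-1)) :
  [/\ forall x, `|x - p| < cw i / 12 -> c%:~R * cw i <= x <= (c + 2)%:~R * cw i &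
     forall z : int, `|z%:~R * cw i - p| < cw i / 2 -> z = c + 1].
Proof.
have w0 := cw0 i; have /andP[] := floor_itv (p / cw i - 2^-1); rewrite -/c.
rewrite lerBrDr ltrBlDr ler_pdivlMr// ltr_pdivrMr// intrD !mulrDl mul1r => h1 h2.
split=> [x|z]; first by rewrite ltr_norml intrD mulrDl => /andP[h3 h4]; apply/andP; split; lra.
rewrite ltr_norml => /andP[h3 h4].
have : c%:~R * cw i < z%:~R * cw i by lra.
have : z%:~R * cw i < (c + 2)%:~R * cw i by rewrite intrD mulrDl; lra.
by rewrite !ltr_pM2r// !ltr_int; lia.
Qed.

(** The middle of the window is the only abscissa where a coarse identification can disturb the
    cutoff. If it carries one, [A] comes from its class near the collapsed height of [p]. *)
Lemma ball_structure (p : R * R) (i : int) : exists c a A,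
  [/\ (size A <= 2)%N, path (fun a a' => `[< link i c a a' >]) a A &
   forall q, dinf L p q < cw i / 12 -> c%:~R * cw i <= q.1 <= (c + 2)%:~R * cw i /\
     exists2 a', a' \in a :: A & `|q.2 - a'| <= cv i].
Proof.
have [W1 W2] := window p.1 i; set c := Num.floor _ in W1 W2.
have w0 := cw0 i; have v0 := cv0 i; set P := HH L (i + 1) p.1 p.2.
have W q : dinf L p q < cw i / 12 -> c%:~R * cw i <= q.1 <= (c + 2)%:~R * cw i.
  by move=> h; apply: W1; apply: le_lt_trans h; rewrite distrC dinf_ge_fst.
have mult n k (a : nat) : (n <= i)%R -> `|(4 * k + a%:Z)%:~R * cw n - p.1| < cw i / 2 ->
    (4 * k + a%:Z)%:~R * cw n = (c + 1)%:~R * cw i.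
  move=> ni; have [z [_ ->]] := @cw_le R n i ni.
  by rewrite mulrA -intrM => /W2 ->.
have [[n [k [a [ni ha ex]]]]|N] := pselect (exists n k (a : nat),
    [/\ (n <= i)%R, (1 <= a <= 3)%N & (4 * k + a%:Z)%:~R * cw n = (c + 1)%:~R * cw i]).
  have vs : cv i <= cv n := cv_le (R := R) hL ni.
  have [cap [h [A [/andP[cap0 capv] sA pA dA invA]]]] := heights P a v0 vs.
  exists c, h, A; split=> //.
    apply: sub_path pA => b b' /asboolP[-> [e [l [e1 e2 e3 e4]]]].
    apply/asboolP; exists e; split=> // t /andP[t0 t1].
    have -> : b + cv n - b = cv n by ring.
    rewrite -ex; apply: (@Rinf_ident R L hL n k l a _ ha).
    by apply/andP; split; [lra|move: e4; rewrite intrB mulrBl mul1r; lra].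
  move=> q hq; split; first exact: W.
  apply: (cutoff_ball (i := i) (p := p) cap0 capv) => //.
  move=> n' k' l' a' y ni' ha' hx hy.
  have [en ea] := ident_unique ha ha' (etrans ex (esym (mult _ _ _ ni' hx))).
  subst n' a'; apply: (invA l'); move: hy => /andP[y1 y2]; apply/andP; split=> //.
  by rewrite intrB mulrBl mul1r; lra.
(* No coarse identification at the middle, which happens only at abscissa 0: the height [P] alone
   suffices. *)
exists c, P, [::]; split=> // q hq; split; first exact: W.
apply: (@cutoff_ball p i (cv i / 4)) => //; try lra.
  by move=> n k l a y ni ha hx hy; case: N; exists n, k, a; split=> //; exact: mult.
have H (x : R) : distA (cv i / 4) [:: x] x + cv i / 4 <= cv i / 4.
  by have := distA_mem (cv i / 4) x (mem_head x [::]); rewrite subrr normr0; lra.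
exact: H.
Qed.

End Structure.

(** * Translations and iterated integrals *)

Section Translation.
Context {R : realType}.
Notation mu := (@lebesgue_measure R).
Local Open Scope ereal_scope.

Let shift (a : R) : measurableTypeR R -> measurableTypeR R := fun x => (x + a)%R.

Let mshift a : measurable_fun setT (shift a).
Proof. by apply: measurable_funD => //; exact: measurable_cst. Qed.

Let shift_mixin a := isMeasurableFun.Build _ _ _ _ _ (mshift a).
Let shift_pack a : {mfun _ >-> _} := HB.pack (shift a) (shift_mixin a).

Lemma lebesgue_measure_shift (a : R) (A : set (measurableTypeR R)) : measurable A ->
  mu A = pushforward mu (shift_pack a) A.
Proof.
apply: (lebesgue_measure_unique (mu := pushforward mu (shift_pack a))).
move=> _ [[b c] _ <-]; rewrite /pushforward /=.
transitivity (mu `](b - a)%R, (c - a)%R]%classic); last first.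
  by congr (mu _); apply/seteqP; split => x /=; rewrite /shift !in_itv /= ltrBlDr lerBrDr.
rewrite !lebesgue_measure_itv /= !lte_fin ltrBlDr subrK; case: ifP => // _.
by rewrite -!EFinD; congr EFin; ring.
Qed.

Lemma integral_shift (a : R) (D : set (measurableTypeR R)) (f : measurableTypeR R -> \bar R) :
  measurable D -> measurable_fun D f -> (forall x, 0 <= f x) ->
  \int[mu]_(x in D) f x = \int[mu]_(x in [set x | D (x + a)%R]) f (x + a)%R.
Proof.
move=> mD mf f0.
transitivity (\int[pushforward mu (shift_pack a)]_(x in D) f x).
  by apply: eq_measure_integral => A mA _; exact: lebesgue_measure_shift.
by rewrite (ge0_integral_pushforward (mshift a)).
Qed.

Lemma integral_shift_itv (a b c : R) (f : measurableTypeR R -> \bar R) :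
  measurable_fun setT f -> (forall x, 0 <= f x) ->
  \int[mu]_(x in `[(b + a)%R, (c + a)%R]) f x = \int[mu]_(x in `[b, c]) f (x + a)%R.
Proof.
move=> mf f0; rewrite (integral_shift a)//; last exact: measurable_funTS.
by congr (integral _ _ _); apply/seteqP; split=> x /=; rewrite !in_itv /= !lerD2r.
Qed.

End Translation.

(** * Tonelli on rectangles *)

Section FubiniTools.
Context {R : realType}.
Notation mu := (@lebesgue_measure R).
Notation RR := (measurableTypeR R).
Local Open Scope ereal_scope.

Lemma measurable_fun_integral_x d (T : measurableType d) (I : set RR) (f : RR * T -> \bar R) :
  measurable I -> measurable_fun setT f -> (forall z, 0 <= f z) ->
  measurable_fun setT (fun y => \int[mu]_(x in I) f (x, y)).
Proof.
move=> mI mf f0.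
pose f' : RR * T -> \bar R := f \_ (I `*` setT).
have mf' : measurable_fun setT f'.
  apply/(measurable_restrict _ _ measurableT); first exact: measurableX.
  by rewrite setTI; exact: measurable_funTS.
have f'0 z : 0 <= f' z by rewrite /f' patchE; case: ifP.
rewrite [X in measurable_fun _ X](_ : _ = fubini_G mu f'); first exact: measurable_fun_fubini_tonelli_G.
apply/funext => y; rewrite /fubini_G [LHS]integral_mkcond; apply: eq_integral => x _.
rewrite /f' !patchE; congr (if _ then _ else _).
by apply/idP/idP; rewrite !inE /=; [move=> ?; split|case].
Qed.

Lemma restrict_rectangle (I J : set RR) (f : RR * RR -> \bar R) :
  measurable I -> measurable J -> measurable_fun setT f -> (forall z, 0 <= f z) ->
  exists f' : RR * RR -> \bar R, [/\ measurable_fun setT f', forall z, 0 <= f' z,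
    forall x y, f' (x, y) = if x \in I then if y \in J then f (x, y) else 0 else 0 &
    f' = f \_ (I `*` J)].
Proof.
move=> mI mJ mf f0; exists (f \_ (I `*` J)); split => //.
- apply/(measurable_restrict _ _ measurableT); first exact: measurableX.
  by rewrite setTI; exact: measurable_funTS.
- by move=> z; rewrite patchE; case: ifP.
- by move=> x y; rewrite patchE in_setX; case: (x \in I); case: (y \in J).
Qed.

Lemma integral_swap (I J : set RR) (f : RR * RR -> \bar R) :
  measurable I -> measurable J -> measurable_fun setT f -> (forall z, 0 <= f z) ->
  \int[mu]_(x in I) \int[mu]_(y in J) f (x, y) = \int[mu]_(y in J) \int[mu]_(x in I) f (x, y).
Proof.
move=> mI mJ mf f0; have [f' [mf' f'0 fE _]] := restrict_rectangle mI mJ mf f0.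
transitivity (\int[mu]_x \int[mu]_y f' (x, y)).
  rewrite [LHS]integral_mkcond; apply: eq_integral => x _; rewrite patchE.
  under [RHS]eq_integral do rewrite fE.
  case: ifP => xI; last by rewrite integral0.
  by rewrite [LHS]integral_mkcond; apply: eq_integral => y _; rewrite patchE.
rewrite (fubini_tonelli f' mf' f'0).
rewrite [RHS]integral_mkcond; apply: eq_integral => y _; rewrite patchE.
under eq_integral do rewrite fE.
case: ifP => yJ; last by rewrite integral0_eq// => x _; case: ifP.
by rewrite [RHS]integral_mkcond; apply: eq_integral => x _; rewrite patchE.
Qed.

Lemma integral_rectangle (I J : set RR) (f : RR * RR -> \bar R) :
  measurable I -> measurable J -> measurable_fun setT f -> (forall z, 0 <= f z) ->
  \int[mu \x mu]_(z in I `*` J) f z = \int[mu]_(y in J) \int[mu]_(x in I) f (x, y).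
Proof.
move=> mI mJ mf f0; have [f' [mf' f'0 fE ef]] := restrict_rectangle mI mJ mf f0.
rewrite [LHS]integral_mkcond -ef; etransitivity.
  exact: (fubini_tonelli2 (m1 := mu) (m2 := mu) f' mf' f'0).
rewrite [RHS]integral_mkcond; apply: eq_integral => y _; rewrite patchE /fubini_G.
under eq_integral do rewrite fE.
case: ifP => yJ; last by rewrite integral0_eq// => x _; case: ifP.
by rewrite [RHS]integral_mkcond; apply: eq_integral => x _; rewrite patchE.
Qed.

(* [leb2] is integrated with respect to the measurable structure that MathComp-Analysis puts on
   [R * R] by default; it has the same measurable sets as the square of [measurableTypeR R], on
   which the product measure lives, but another display. *)
Lemma leb2_integral (D : set (RR * RR)) (f : RR * RR -> \bar R) :
  measurable D -> measurable_fun D f -> (forall x, 0 <= f x) ->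
  \int[@leb2 R]_(x in (D : set (R * R))) (f : R * R -> \bar R) x = \int[mu \x mu]_(x in D) f x.
Proof.
move=> mD mf f0.
pose phi : RR * RR -> (R * R)%type := fun x => x.
have mphi : measurable_fun setT phi by move=> _ Y mY; rewrite setTI; exact: mY.
have H := @ge0_integral_pushforward _ _ _ _ R phi mphi (mu \x mu) D f mD mf.
by etransitivity; last by apply: H => x _.
Qed.

Lemma measurable_EFin_dist d (T : measurableType d) (f h : T -> RR) :
  measurable_fun setT f -> measurable_fun setT h ->
  measurable_fun setT (fun x => (`|f x - h x|%R)%:E : \bar R).
Proof.
move=> mf mh; apply/measurable_EFinP; apply: measurableT_comp => //.
by apply: measurable_funB.
Qed.

Lemma measurable_shift d (T : measurableType d) (f : RR -> T) t : measurable_fun setT f ->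
  measurable_fun setT (fun y : RR => f (y + t)%R).
Proof.
by move=> mf; apply: (measurableT_comp mf); apply: measurable_funD => //; exact: measurable_cst.
Qed.

Lemma integral_itv_cst (c : \bar R) (A B : R) : (A <= B)%R ->
  \int[mu]_(x in `[A, B]) c = c * (B - A)%:E.
Proof.
move=> AB; have := @integral_cst _ RR R mu `[A, B]%classic (measurable_itv _) c.
rewrite /= => ->; congr (_ * _); rewrite lebesgue_measure_itv /= lte_fin.
case: ltP => h; first by rewrite -EFinD.
by have -> : (B - A = 0)%R by lra.
Qed.

End FubiniTools.

(** * Continuity of translations in mean *)

Section TranslationContinuity.
Context {R : realType}.
Notation mu := (@lebesgue_measure R).
Notation RR := (measurableTypeR R).
Local Open Scope ereal_scope.

Lemma continuous_shift_L1 (h : R -> R) (A B : R) (s : nat -> R) :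
  continuous h -> (forall n, 0 <= s n <= 1)%R -> s @ \oo --> 0%R ->
  \int[mu]_(y in `[A, B]) (`|h y - h (y + s n)|%R)%:E @[n --> \oo] --> 0.
Proof.
move=> ch s01 s0.
have mh : measurable_fun setT (h : RR -> RR) by exact: continuous_measurable_fun.
have [M HM] : exists M : R, forall y, `[A, (B + 1)%R]%classic y -> (`|h y| <= M)%R.
  have := @continuous_compact _ _ h `[A, (B + 1)%R]%classic.
  move=> /(_ (continuous_subspaceT ch) (@segment_compact _ _ _)) /compact_bounded [M [_ HM]].
  exists (M + 1)%R => y yAB; apply: (HM (M + 1)%R); first by rewrite ltrDl.
  by exists y.
have := @dominated_convergence _ RR R mu `[A, B]%classic (measurable_itv _)
  (fun n y => (`|h y - h (y + s n)|%R)%:E) (cst 0) (cst (2 * M)%:E).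
case.
- by move=> n; apply: measurable_funTS; apply: measurable_EFin_dist => //; exact: measurable_shift.
- exact: measurable_cst.
- apply: aeW => y _; apply: cvg_EFin; first exact: nearW.
  rewrite (_ : 0%R = `|h y - h (y + 0)|%R :> R); last by rewrite addr0 subrr normr0.
  apply: cvg_norm; apply: cvgB; first exact: cvg_cst.
  by apply: continuous_cvg; [exact: ch|apply: cvgD => //; exact: cvg_cst].
- apply/integrableP; split; first exact: measurable_cst.
  have [AB|BA] := leP A B; first by rewrite /= integral_itv_cst// -EFinM ltry.
  by rewrite set_itv_ge ?integral_set0 ?ltry// bnd_simp -ltNge.
- apply: aeW => y n; rewrite /= in_itv /= => /andP[yA yB].
  rewrite lee_fin normr_id; have /andP[n0 n1] := s01 n.
  have h1 := HM y; have h2 := HM (y + s n)%R.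
  rewrite /= !in_itv /= in h1 h2.
  have {}h1 : (`|h y| <= M)%R by apply: h1; lra.
  have {}h2 : (`|h (y + s n)| <= M)%R by apply: h2; lra.
  by have := ler_normB (h y) (h (y + s n)%R); lra.
by move=> _ _; rewrite integral0.
Qed.

(** Approximation by continuous functions on [[A, B + 1]], which contains the translates of [[A, B]]
    because [s n <= 1]. The approximation error counts twice, for [f] and for its translate. *)
Lemma integrable_shift_L1 (f : RR -> RR) (A B : R) (s : nat -> R) :
  measurable_fun setT f -> \int[mu]_y (`|f y|%R)%:E < +oo ->
  (forall n, 0 <= s n <= 1)%R -> s @ \oo --> 0%R ->
  \int[mu]_(y in `[A, B]) (`|f y - f (y + s n)|%R)%:E @[n --> \oo] --> 0.
Proof.
move=> mf fint s01 s0.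
pose E : set RR := `[A, (B + 1)%R]%classic.
have mE : measurable E by exact: measurable_itv.
have fE : mu.-integrable E (EFin \o f).
  apply: (@integrableS _ _ _ _ setT) => //; apply/integrableP; split; first exact/measurable_EFinP.
  exact: fint.
have muE : mu E < +oo.
  by rewrite lebesgue_measure_itv /=; case: ifP => _; rewrite // -EFinD ltry.
have [h [ch hint hcvg]] := approximation_continuous_integrable mE muE fE.
have mh n : measurable_fun setT (h n : RR -> RR) by exact: continuous_measurable_fun.
have key m n : \int[mu]_(y in `[A, B]) (`|f y - f (y + s n)|%R)%:E <=
   2%:E * \int[mu]_(y in E) (`|f y - h m y|%R)%:E +
   \int[mu]_(y in `[A, B]) (`|h m y - h m (y + s n)|%R)%:E.
  have /andP[n0 n1] := s01 n.
  pose F1 (y : RR) := (`|f y - h m y|%R)%:E : \bar R.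
  have mF1 : measurable_fun setT F1.
    exact: measurable_EFin_dist.
  have F10 y : 0 <= F1 y by rewrite lee_fin.
  pose F2 (y : RR) := (`|h m y - h m (y + s n)|%R)%:E : \bar R.
  have mF2 : measurable_fun setT F2.
    by apply: measurable_EFin_dist => //; exact: measurable_shift.
  have F20 y : 0 <= F2 y by rewrite lee_fin.
  have mF1s : measurable_fun setT (fun y : RR => F1 (y + s n)%R).
    by apply: (measurableT_comp mF1) => //; apply: measurable_funD => //; exact: measurable_cst.
  have i1 : \int[mu]_(y in `[A, B]) F1 y <= \int[mu]_(y in E) F1 y.
    apply: ge0_subset_integral => //; first exact: measurable_funTS.
    by move=> y; rewrite /E /= !in_itv /=; lra.
  have i2 : \int[mu]_(y in `[A, B]) F1 (y + s n)%R <= \int[mu]_(y in E) F1 y.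
    rewrite -(@integral_shift_itv R (s n) A B F1 mF1 F10).
    apply: ge0_subset_integral => //; first exact: measurable_funTS.
    by move=> y; rewrite /E /= !in_itv /=; lra.
  apply: (@le_trans _ _ (\int[mu]_(y in `[A, B]) (F1 y + F1 (y + s n)%R + F2 y))).
    apply: ge0_le_integral => //.
    - by apply: measurable_funTS; apply: measurable_EFin_dist => //; exact: measurable_shift.
    - by apply: measurable_funTS; apply: emeasurable_funD => //; exact: emeasurable_funD.
    - move=> y _; rewrite /F1 /F2 -!EFinD lee_fin.
      have -> : (f y - f (y + s n) = (f y - h m y) + (h m y - h m (y + s n)) - (f (y + s n) - h m (y + s n)))%R by ring.
      have := ler_normB ((f y - h m y) + (h m y - h m (y + s n)))%R (f (y + s n) - h m (y + s n))%R.
      by have := ler_normD (f y - h m y)%R (h m y - h m (y + s n))%R; lra.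
  rewrite ge0_integralD//; [|by move=> y _; exact: adde_ge0|by apply: measurable_funTS; exact: emeasurable_funD|exact: measurable_funTS].
  rewrite ge0_integralD//; [|exact: measurable_funTS..].
  have -> : 2%:E = 1 + 1 :> \bar R by rewrite -EFinD.
  by rewrite ge0_muleDl// mul1e; apply: leeD => //; exact: leeD.
apply/fine_cvgP; split.
  apply: nearW => n; rewrite ge0_fin_numE; last by apply: integral_ge0 => y _; rewrite lee_fin.
  pose n' := n; have /andP[n0 n1] := s01 n.
  have i0 : \int[mu]_(y in E) (`|f y|%R)%:E < +oo by have /integrableP[_] := fE.
  have mfa : measurable_fun setT (fun y : RR => (`|f y|%R)%:E : \bar R).
    by apply/measurable_EFinP; exact: measurableT_comp.
  apply: (@le_lt_trans _ _ (\int[mu]_(y in E) (`|f y|%R)%:E + \int[mu]_(y in E) (`|f y|%R)%:E)); last exact: lte_add_pinfty.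
  apply: (@le_trans _ _ (\int[mu]_(y in `[A, B]) ((`|f y|%R)%:E + (`|f (y + s n)|%R)%:E))).
    apply: ge0_le_integral => //.
    - by apply: measurable_funTS; apply: measurable_EFin_dist => //; exact: measurable_shift.
    - apply: measurable_funTS; apply: emeasurable_funD => //.
      by apply/measurable_EFinP; apply: measurableT_comp => //; exact: measurable_shift.
    - by move=> y _; rewrite -EFinD lee_fin ler_normB.
  rewrite ge0_integralD//; [|exact: measurable_funTS|].
    apply: leeD.
      apply: ge0_subset_integral => //; first exact: measurable_funTS.
      by move=> y; rewrite /E /= !in_itv /=; lra.
    have f0 (y : RR) : 0 <= (`|f y|%R)%:E :> \bar R by rewrite lee_fin.
    rewrite -(@integral_shift_itv R (s n) A B _ mfa f0).
    apply: ge0_subset_integral => //; first exact: measurable_funTS.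
    by move=> y; rewrite /E /= !in_itv /=; lra.
  apply: measurable_funTS; apply/measurable_EFinP; apply: measurableT_comp => //; exact: measurable_shift.
apply/cvgrPdist_lt => e e0.
have [m Hm] : exists m, \int[mu]_(y in E) (`|f y - h m y|%R)%:E <= (e / 8)%:E.
  have /fine_cvgP[h1 /cvgrPdist_lt /(_ (e / 8)%R)] := hcvg.
  have e8 : (0 < e / 8)%R by lra.
  move=> /(_ e8) h2; near \oo => m.
  exists m; have fin : \int[mu]_(y in E) (`|f y - h m y|%R)%:E \is a fin_num by near: m; exact: h1.
  rewrite -(fineK fin) lee_fin.
  have : (`|0 - fine (\int[mu]_(y in E) `|(f y - h m y)%:E|)| < e / 8)%R by near: m.
  by rewrite sub0r normrN => /ltW; apply: le_trans; rewrite ler_norm.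
have /fine_cvgP[g1 /cvgrPdist_lt /(_ (e / 2)%R)] := @continuous_shift_L1 _ A B _ (ch m) s01 s0.
have e2 : (0 < e / 2)%R by lra.
move=> /(_ e2) g2; near=> n.
have fin : \int[mu]_(y in `[A, B]) (`|h m y - h m (y + s n)|%R)%:E \is a fin_num by near: n.
have lt2 : (`|0 - fine (\int[mu]_(y in `[A, B]) (`|h m y - h m (y + s n)|%R)%:E)| < e / 2)%R by near: n.
have := key m n; rewrite -(fineK fin) => hk.
have : \int[mu]_(y in `[A, B]) (`|f y - f (y + s n)|%R)%:E <= (2 * (e / 8) + e / 2)%:E.
  have -> : (2 * (e / 8) + e / 2)%:E = 2%:E * (e / 8)%:E + (e / 2)%:E :> \bar R by rewrite -EFinM -EFinD.
  apply: le_trans hk _; apply: leeD; first by rewrite lee_pmul2l// lte_fin.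
  by rewrite lee_fin; move: lt2; rewrite sub0r normrN => /ltW; apply: le_trans; rewrite ler_norm.
set X := integral _ _ _; have X0 : 0 <= X by apply: integral_ge0 => y _; rewrite lee_fin.
move=> hX; have Xf : X \is a fin_num by rewrite ge0_fin_numE// (le_lt_trans hX)// ltry.
rewrite sub0r normrN ger0_norm ?fine_ge0//.
have h5 : (fine X <= 2 * (e / 8) + e / 2)%R by rewrite -lee_fin fineK.
by apply: (le_lt_trans h5); lra.
Unshelve. all: by end_near. Qed.

(** Dominated convergence in [x] after exchanging the integrals: almost every vertical slice is
    integrable, and twice its norm dominates. *)
Lemma integrable_shift_L1_vertical (u : RR * RR -> RR) (I : set RR) (A B : R) (s : nat -> R) :
  measurable I -> measurable_fun setT u -> \int[mu \x mu]_z (`|u z|%R)%:E < +oo ->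
  (forall n, 0 <= s n <= 1)%R -> s @ \oo --> 0%R ->
  \int[mu]_(y in `[A, B]) \int[mu]_(x in I) (`|u (x, y) - u (x, (y + s n)%R)|%R)%:E
    @[n --> \oo] --> 0.
Proof.
move=> mI mu_ uint s01 s0.
have mabs : measurable_fun setT (fun z : RR * RR => (`|u z|%R)%:E : \bar R).
  by apply/measurable_EFinP; exact: measurableT_comp.
have abs0 (z : RR * RR) : 0 <= (`|u z|%R)%:E :> \bar R by rewrite lee_fin.
have mushift t : measurable_fun setT (fun z : RR * RR => u (z.1, (z.2 + t)%R)).
  apply: measurableT_comp => //; apply/measurable_fun_pairP; split => /=.
    exact: measurable_fst.
  by apply: measurable_funD; [exact: measurable_snd|exact: measurable_cst].
pose F n (z : RR * RR) := (`|u z - u (z.1, (z.2 + s n)%R)|%R)%:E : \bar R.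
have mF n : measurable_fun setT (F n) by apply: measurable_EFin_dist => //; exact: mushift.
have F0 n z : 0 <= F n z by rewrite lee_fin.
pose Ua (x : RR) := \int[mu]_y (`|u (x, y)|%R)%:E : \bar R.
have mUa : measurable_fun setT Ua by exact: (measurable_fun_fubini_tonelli_F (m2 := mu) _ mabs abs0).
have Ua0 x : 0 <= Ua x by exact: integral_ge0.
have iUa : mu.-integrable setT Ua.
  apply/integrableP; split => //; under eq_integral do rewrite gee0_abs//.
  apply: le_lt_trans uint; rewrite le_eqVlt; apply/orP; left; apply/eqP/esym.
  exact: (fubini_tonelli1 (m1 := mu) (m2 := mu) _ mabs abs0).
have mu1 x : measurable_fun setT (fun y : RR => u (x, y)) by exact: measurableT_comp.
have m1 x : measurable_fun setT (fun y : RR => (`|u (x, y)|%R)%:E : \bar R).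
  by apply/measurable_EFinP; exact: measurableT_comp.
pose phi n (x : RR) := \int[mu]_(y in `[A, B]) F n (x, y).
have bound n x : phi n x <= Ua x + Ua x.
  apply: (@le_trans _ _ (\int[mu]_(y in `[A, B]) ((`|u (x, y)|%R)%:E + (`|u (x, (y + s n)%R)|%R)%:E))).
    apply: ge0_le_integral => //.
    - by apply: measurable_funTS; apply: measurable_EFin_dist => //; exact: measurable_shift (mu1 x).
    - apply: measurable_funTS; apply: emeasurable_funD => //.
      by apply/measurable_EFinP; apply: measurableT_comp => //; exact: measurable_shift (mu1 x).
    - by move=> y _; rewrite -EFinD lee_fin ler_normB.
  have mm : measurable_fun setT (fun y : RR => (`|u (x, (y + s n)%R)|%R)%:E : \bar R).
    by apply/measurable_EFinP; apply: measurableT_comp => //; exact: measurable_shift (mu1 x).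
  rewrite ge0_integralD//; [|exact: measurable_funTS..].
  apply: leeD; first by apply: ge0_subset_integral.
  rewrite /Ua (integral_shift (s n) (D := setT))//.
  have -> : [set y | [set: RR] (y + s n)%R] = [set: RR] by apply/seteqP.
  by apply: ge0_subset_integral.
have mphi n : measurable_fun setT (phi n).
  pose F' (z : RR * RR) := F n (z.2, z.1).
  have mF' : measurable_fun setT F' by apply: measurableT_comp => //; exact: measurable_swap.
  by apply: (@measurable_fun_integral_x R _ RR `[A, B]%classic F') => // z; exact: F0.
have -> : (fun n => \int[mu]_(y in `[A, B]) \int[mu]_(x in I) (`|u (x, y) - u (x, (y + s n)%R)|%R)%:E) =
    (fun n => \int[mu]_(x in I) phi n x).
  by apply/funext => n; rewrite (integral_swap (f := F n)).
have := @dominated_convergence _ RR R mu I mI phi (cst 0) (fun x => Ua x + Ua x).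
case.
- by move=> n; exact: measurable_funTS.
- exact: measurable_cst.
- have := @integrable_ae _ _ _ mu setT measurableT Ua iUa.
  apply: filterS => x /(_ Logic.I) finU _; apply: integrable_shift_L1 => //.
  by rewrite -ge0_fin_numE; [exact: finU|exact: Ua0].
- by apply: integrableD => //; apply: (@integrableS _ _ _ _ setT).
- apply: aeW => x n _; rewrite gee0_abs; first exact: bound.
  exact: integral_ge0.
by move=> _ _; rewrite integral0.
Qed.

End TranslationContinuity.

(** * The Poincare inequality on rectangles *)

Section Slices.
Context {R : realType} (L : nat).
Hypothesis hL : (100 <= L)%N.
Notation cw := (@cw R).
Notation cv := (@cv R L).
Notation mu := (@lebesgue_measure R).
Notation RR := (measurableTypeR R).
Let cw0 n : (0 < cw n)%R. Proof. exact: cw_gt0. Qed.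
Let cv0 n : (0 < cv n)%R. Proof. exact: cv_gt0. Qed.
Local Open Scope ereal_scope.

(** The bound on [F] is constant on each column, so integrating it there multiplies it by the width
    [d]. *)
Lemma integral_columns (F psi : RR -> \bar R) (d a : R) (m : nat) : (0 < d)%R ->
  measurable_fun setT F -> measurable_fun setT psi -> (forall x, 0 <= F x) -> (forall x, 0 <= psi x) ->
  (forall k : nat, (k < m)%N -> forall x, (a + k%:R * d <= x < a + k.+1%:R * d)%R ->
     F x <= \int[mu]_(s in `[(a + k%:R * d)%R, (a + k.+1%:R * d)%R[) psi s) ->
  \int[mu]_(x in `[a, (a + m%:R * d)%R[) F x <= d%:E * \int[mu]_(x in `[a, (a + m%:R * d)%R[) psi x.
Proof.
move=> d0 mF mpsi F0 psi0; elim: m => [|m IH] H.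
  rewrite mul0r addr0 set_itv_ge ?bnd_simp ?ltxx// !integral_set0.
  by rewrite mule0.
have md0 : (0 <= m%:R * d)%R by rewrite mulr_ge0// ltW.
have e : (a + m.+1%:R * d = a + m%:R * d + d)%R by rewrite -natr1; ring.
have -> : `[a, (a + m.+1%:R * d)%R[%classic = `[a, (a + m%:R * d)%R[%classic `|`
    `[(a + m%:R * d)%R, (a + m.+1%:R * d)%R[%classic :> set RR.
  apply/seteqP; split => x /=; rewrite !in_itv /=.
    by move=> /andP[h1 ->]; rewrite h1 andbT /=; case: ltP => h; [left|right].
  by case=> /andP[h1 h2]; apply/andP; split; lra.
have dis : [disjoint `[a, (a + m%:R * d)%R[%classic & `[(a + m%:R * d)%R, (a + m.+1%:R * d)%R[%classic : set RR].
  by apply/disj_setPS => x [] /=; rewrite !in_itv /= => /andP[_ h1] /andP[h2 _]; lra.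
rewrite !ge0_integral_setU//; [|exact: measurable_funTS..].
rewrite ge0_muleDr ?integral_ge0//; apply: leeD.
  by apply: IH => k km; apply: H; exact: ltnW.
set C := \int[mu]_(x in `[(a + m%:R * d)%R, (a + m.+1%:R * d)%R[) psi x.
apply: (@le_trans _ _ (\int[mu]_(x in `[(a + m%:R * d)%R, (a + m.+1%:R * d)%R[) (cst C x))).
  apply: ge0_le_integral => //; [exact: measurable_funTS|].
  by move=> x /=; rewrite in_itv /= => hx; apply: H.
rewrite integral_cst//= lebesgue_measure_itv /= lte_fin e ltrDl d0 -EFinB muleC.
by have -> : (a + m%:R * d + d - (a + m%:R * d) = d)%R by ring.
Qed.

Variables (u : RR * RR -> RR) (g : RR * RR -> \bar R).
Hypotheses (mu_ : measurable_fun setT u) (mg : measurable_fun setT g) (g0 : forall z, 0 <= g z).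
Hypothesis ug : forall x x' y, (x <= x')%R ->
  (`|u (x, y) - u (x', y)|%R)%:E <= \int[mu]_(s in `[x, x']) g (s, y).
Hypothesis uinv : forall p q, Rinf L p q -> u p = u q.

Definition Nd (I : set RR) (y y' : R) : \bar R :=
  \int[mu]_(x in I) (`|u (x, y) - u (x, y')|%R)%:E.
Definition Gd (I : set RR) (y : R) : \bar R := \int[mu]_(x in I) g (x, y).

Lemma mu_x y : measurable_fun setT (fun x : RR => u (x, y)).
Proof. exact: measurableT_comp. Qed.

Lemma mg_x y : measurable_fun setT (fun x : RR => g (x, y)).
Proof. exact: measurableT_comp. Qed.

Lemma Nd_ge0 I y y' : 0 <= Nd I y y'.
Proof. by apply: integral_ge0 => x _; rewrite lee_fin. Qed.

Lemma Gd_ge0 I y : 0 <= Gd I y.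
Proof. exact: integral_ge0. Qed.

Lemma measurable_Gd I : measurable I -> measurable_fun setT (Gd I : RR -> \bar R).
Proof. by move=> mI; exact: (measurable_fun_integral_x mI mg g0). Qed.

Lemma measurable_Nd I : measurable I -> measurable_fun setT (fun z : RR * RR => Nd I z.1 z.2).
Proof.
move=> mI.
pose f (z : RR * (RR * RR)) := (`|u (z.1, z.2.1) - u (z.1, z.2.2)|%R)%:E : \bar R.
have mf : measurable_fun setT f.
  apply: measurable_EFin_dist; apply: measurableT_comp => //; apply/measurable_fun_pairP; split => /=.
  - exact: measurable_fst.
  - exact: (measurableT_comp measurable_fst measurable_snd).
  - exact: measurable_fst.
  - exact: (measurableT_comp measurable_snd measurable_snd).
have f0 z : 0 <= f z by rewrite lee_fin.
exact: (measurable_fun_integral_x mI mf f0).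
Qed.

Lemma measurable_Nd_shift I t : measurable I -> measurable_fun setT (fun y : RR => Nd I y (y + t)).
Proof.
move=> mI.
have mp : measurable_fun setT (fun y : RR => (y, (y + t)%R) : RR * RR).
  apply/measurable_fun_pairP; split => /=; first exact: measurable_id.
  by apply: measurable_funD => //; exact: measurable_cst.
exact: (measurableT_comp (measurable_Nd mI) mp).
Qed.

Lemma Nd_triangle I y y' y'' : measurable I -> Nd I y y'' <= Nd I y y' + Nd I y' y''.
Proof.
move=> mI; have m a b : measurable_fun I (fun x : RR => (`|u (x, a) - u (x, b)|%R)%:E : \bar R).
  by apply: measurable_funTS; apply: measurable_EFin_dist; exact: mu_x.
rewrite /Nd -ge0_integralD//.
apply: ge0_le_integral => //; first exact: emeasurable_funD.
by move=> x _; rewrite -EFinD lee_fin ler_distD.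
Qed.

Lemma ug_itv (l r x x' y : R) : (l <= x <= r)%R -> (l <= x' <= r)%R ->
  (`|u (x, y) - u (x', y)|%R)%:E <= Gd `[l, r]%classic y.
Proof.
wlog xx' : x x' / (x <= x')%R => [H hx hx'|hx hx'].
  by have /orP[h|h] := le_total x x'; [exact: H|rewrite distrC; exact: H].
apply: le_trans (ug y xx') _; apply: ge0_subset_integral => //.
  by apply: measurable_funTS; exact: mg_x.
by move=> s /=; rewrite !in_itv /=; move: hx hx'; lra.
Qed.

Lemma int_mod3 (r : int) : exists (l : int) (a : nat), (1 <= a <= 3)%N /\ r = (3 * l + a%:Z - 1)%R.
Proof.
have e := divz_eq r 3; have h1 := modz_ge0 r (isT : 3 != 0 :> int); have h2 := ltz_pmod r (isT : 0 < 3 :> int)%R.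
exists (r %/ 3)%Z, (`|(r %% 3)%Z|.+1)%N; move: h1 h2 e.
set q := (r %/ 3)%Z; set t := (r %% 3)%Z; lia.
Qed.

(** The three abscissas inside a column serve the three residues of rows modulo 3. The comparison
    goes to the right one at height [y], jumps, and returns at height [y + cv n]. *)
Lemma column_swap (z n : int) (x y : R) (J := `[(z%:~R * cw (n - 1))%R, ((z + 1)%:~R * cw (n - 1))%R]%classic) :
  J x -> (`|u (x, y) - u (x, y + cv n)|%R)%:E <= Gd J y + Gd J (y + cv n).
Proof.
rewrite /J /= in_itv /= => hx; have w0 := cw0 n; have v0 := cv0 n.
have ew : cw (n - 1) = (4 * cw n)%R by rewrite (cwS (R := R) (n - 1)) subrK.
have [l [a [ha er]]] := int_mod3 (Num.floor (y / cv n)).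
have /andP[] := floor_itv (y / cv n); rewrite ler_pdivlMr// ltr_pdivrMr// er => y1 y2.
have e1 : u (((4 * z + a%:Z)%:~R * cw n)%R, y) = u (((4 * z + a%:Z)%:~R * cw n)%R, (y + cv n)%R).
  apply: uinv; apply: (@Rinf_ident R L hL n z l a _ ha); rewrite y1 /=.
  by move: y2; rewrite subrK => /ltW.
have hx1 : (z%:~R * cw (n - 1) <= (4 * z + a%:Z)%:~R * cw n <= (z + 1)%:~R * cw (n - 1))%R.
  rewrite ew !mulrA !ler_pM2r//.
  have -> : (4 = 4%:~R :> R)%R by [].
  by rewrite -!intrM !ler_int; move: ha; lia.
set x1 := (_%:~R * cw n)%R in e1 hx1.
have h1 := @ug_itv _ _ x x1 y hx hx1; have h2 := @ug_itv _ _ x1 x (y + cv n) hx1 hx.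
apply: le_trans (leeD h1 h2); rewrite -EFinD lee_fin e1; exact: ler_distD.
Qed.

Lemma integral_itv_co (l r : R) (f : RR -> \bar R) : measurable_fun setT f ->
  \int[mu]_(x in `[l, r[) f x = \int[mu]_(x in `[l, r]) f x.
Proof. by move=> mf; apply: integral_itv_bndo_bndc; exact: measurable_funTS. Qed.

Lemma Nd_row (z n : int) (m : nat) (y : R)
    (I := `[(z%:~R * cw (n - 1))%R, ((z + m%:Z)%:~R * cw (n - 1))%R]%classic) :
  Nd I y (y + cv n) <= (cw (n - 1))%:E * (Gd I y + Gd I (y + cv n)).
Proof.
set d := cw (n - 1); have d0 : (0 < d)%R by exact: cw0.
have e k : ((z + k%:Z)%:~R * d = z%:~R * d + k%:R * d)%R by rewrite intrD mulrDl.
have mF : measurable_fun setT (fun x : RR => (`|u (x, y) - u (x, (y + cv n)%R)|%R)%:E : \bar R).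
  by apply: measurable_EFin_dist; exact: mu_x.
have mpsi : measurable_fun setT (fun s : RR => g (s, y) + g (s, (y + cv n)%R)).
  by apply: emeasurable_funD; exact: mg_x.
rewrite /Nd /Gd /I -/d -ge0_integralD//; [|by apply: measurable_funTS; exact: mg_x..].
rewrite e -!integral_itv_co//; apply: integral_columns => //.
  by move=> x; exact: adde_ge0.
move=> k km x /andP[x1 x2].
rewrite integral_itv_co// ge0_integralD//; [|by apply: measurable_funTS; exact: mg_x..].
have ez : (z + k%:Z + 1 = z + k.+1%:Z)%R by rewrite intS; ring.
have := @column_swap (z + k%:Z) n x y; rewrite -/d ez !e /= in_itv /= x1 (ltW x2).
by apply.
Qed.

(* The [L^1] modulus of continuity of [u] under the vertical translation by [t]. *)
Definition Dd (I : set RR) (a b t : R) : \bar R := \int[mu]_(y in `[a, b]) Nd I y (y + t).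

Lemma Dd_add I (a b s t : R) : measurable I ->
  Dd I a b (s + t) <= Dd I a b s + Dd I (a + s) (b + s) t.
Proof.
move=> mI; rewrite /Dd.
rewrite (@integral_shift_itv R s a b _ (measurable_Nd_shift t mI) (fun y => Nd_ge0 I _ _)).
have m1 : measurable_fun setT (fun y : RR => Nd I (y + s) (y + s + t)).
  exact: (measurable_shift s (measurable_Nd_shift t mI)).
rewrite -ge0_integralD//; [|by move=> *; exact: Nd_ge0|
  by apply: measurable_funTS; exact: measurable_Nd_shift|by move=> *; exact: Nd_ge0|exact: measurable_funTS].
apply: ge0_le_integral => //.
- by move=> *; exact: Nd_ge0.
- by apply: measurable_funTS; exact: measurable_Nd_shift.
- by apply: measurable_funTS; apply: emeasurable_funD => //; exact: measurable_Nd_shift.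
- by move=> y _; rewrite addrA; exact: Nd_triangle.
Qed.

(** * Translations and oscillation over a window of two cells *)

Section Window.
Variables (i c : int).
Let w := cw i.
Let I : set RR := `[(c%:~R * w)%R, ((c + 2)%:~R * w)%R]%classic.
Let mI : measurable I. Proof. exact: measurable_itv. Qed.

(** The window is a union of whole columns of width [cw (n - 1)], since [n - 1] is at least [i]. *)
Lemma Nd_window (n : int) (y : R) : (i + 1 <= n)%R ->
  Nd I y (y + cv n) <= (cw (n - 1))%:E * (Gd I y + Gd I (y + cv n)).
Proof.
move=> hn; have [|z [z1 ez]] := @cw_le R i (n - 1)%R; first by rewrite lerBrDr.
have := @Nd_row (c * z)%R n `|(2 * z)%R|%N y.
rewrite gez0_abs; last by rewrite mulr_ge0// (le_trans _ z1).
have -> : (c * z + 2 * z = (c + 2) * z)%R by ring.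
by rewrite !intrM -!mulrA -ez.
Qed.

Lemma Dd_row (n : int) (a b A0 B0 : R) : (i + 1 <= n)%R -> (A0 <= a)%R -> (b + cv n <= B0)%R ->
  Dd I a b (cv n) <= (2 * cw (n - 1))%:E * \int[mu]_(y in `[A0, B0]) Gd I y.
Proof.
move=> hn ha hb; have v0 := cv0 n; have mG := measurable_Gd mI.
have mGs := measurable_shift (cv n) mG.
apply: (@le_trans _ _ (\int[mu]_(y in `[a, b]) ((cw (n - 1))%:E * (Gd I y + Gd I (y + cv n))))).
  apply: ge0_le_integral => //.
  - by move=> *; exact: Nd_ge0.
  - by apply: measurable_funTS; exact: measurable_Nd_shift.
  - by apply: measurable_funTS; apply: emeasurable_funM => //; exact: emeasurable_funD.
  - by move=> y _; exact: Nd_window.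
rewrite ge0_integralZl//; last first.
- by rewrite lee_fin ltW.
- by move=> y _; rewrite adde_ge0 ?Gd_ge0.
- by apply: measurable_funTS; exact: emeasurable_funD.
rewrite mulrC EFinM -muleA lee_pmul2l ?lte_fin//.
rewrite ge0_integralD//; [|by move=> *; exact: Gd_ge0|exact: measurable_funTS|by move=> *; exact: Gd_ge0|exact: measurable_funTS].
have -> : 2%:E = 1 + 1 :> \bar R by rewrite -EFinD.
rewrite ge0_muleDl// mul1e; apply: leeD.
  apply: ge0_subset_integral => //; [exact: measurable_funTS|by move=> *; exact: Gd_ge0|].
  by move=> y /=; rewrite !in_itv /=; lra.
rewrite -(@integral_shift_itv R (cv n) a b _ mG (Gd_ge0 I)).
apply: ge0_subset_integral => //; [exact: measurable_funTS|by move=> *; exact: Gd_ge0|].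
by move=> y /=; rewrite !in_itv /=; lra.
Qed.

Lemma Dd0 a b : Dd I a b 0 = 0.
Proof.
rewrite /Dd integral0_eq// => y _; rewrite addr0 /Nd integral0_eq// => x _.
by rewrite subrr normr0.
Qed.

Lemma Dd_rows (n : int) (m : nat) (a b A0 B0 : R) : (i + 1 <= n)%R -> (A0 <= a)%R ->
  (b + m%:R * cv n <= B0)%R ->
  Dd I a b (m%:R * cv n) <= (m%:R * (2 * cw (n - 1)))%:E * \int[mu]_(y in `[A0, B0]) Gd I y.
Proof.
move=> hn ha; have v0 := cv0 n; have w1 := cw0 (n - 1).
elim: m => [|m IH]; first by rewrite mul0r Dd0 mul0r mul0e.
have e : (m.+1%:R * cv n = m%:R * cv n + cv n)%R by rewrite -natr1; ring.
have mv0 : (0 <= m%:R * cv n)%R by rewrite mulr_ge0// ltW.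
rewrite e => hb; apply: le_trans (Dd_add _ _ _ _ mI) _.
rewrite -natr1 mulrDl mul1r EFinD ge0_muleDl ?lee_fin ?mulr_ge0//; [|exact: ltW|exact: ltW].
apply: leeD; first by apply: IH; lra.
by apply: Dd_row => //; lra.
Qed.

(* Greedy expansion of [t] in base [mv]; the costs of the digits form a geometric series of ratio 1/4. *)
Lemma Dd_approx (k : nat) (t a b A0 B0 : R) : (0 <= t <= 5 * cv i)%R -> (A0 <= a)%R -> (b + t <= B0)%R ->
  exists tau, (0 <= tau <= t)%R /\ (t - tau <= 5 * cv (i + k%:Z))%R /\
   Dd I a b tau <= (40 / 3 * mv R L * (cw i - cw (i + k%:Z)))%:E * \int[mu]_(y in `[A0, B0]) Gd I y.
Proof.
move=> /andP[t0 t1] ha hb; have M0 := mv_ge (R := R) hL.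
elim: k => [|k [tau [/andP[h0 h1] [h2 h3]]]].
  exists 0%R; rewrite addr0 subr0 lexx t0; split => //; split => //.
  by rewrite Dd0 subrr mulr0 mul0e.
set n : int := (i + k.+1%:Z)%R.
have en : (n - 1 = i + k%:Z)%R by rewrite /n intS; ring.
have v0 := cv0 n; have w1 := cw0 n.
pose m := Num.truncn ((t - tau) / cv n).
have dt : (0 <= (t - tau) / cv n)%R by rewrite divr_ge0 ?subr_ge0// ltW.
have /andP[] := truncn_itv dt; rewrite -/m ler_pdivlMr// ltr_pdivrMr// => m1 m2.
have ev : cv (i + k%:Z) = (mv R L * cv n)%R by rewrite -en (cvS (R := R) hL (n - 1)) subrK.
have ew : cw (i + k%:Z) = (4 * cw n)%R by rewrite -en (cwS (R := R) (n - 1)) subrK.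
have m5 : (m%:R <= 5 * mv R L)%R.
  rewrite -(ler_pM2r v0); apply: le_trans m1 _; rewrite -mulrA -ev; exact: h2.
have mv0 : (0 <= m%:R * cv n)%R by rewrite mulr_ge0// ltW.
exists (tau + m%:R * cv n)%R; split; first by apply/andP; split; lra.
split; first by move: m2; rewrite -natr1 mulrDl mul1r; lra.
apply: le_trans (Dd_add _ _ _ _ mI) _.
have hn : (i + 1 <= n)%R by rewrite /n intS addrA lerDl.
apply: (@le_trans _ _ ((40 / 3 * mv R L * (cw i - cw (i + k%:Z)))%:E * \int[mu]_(y in `[A0, B0]) Gd I y +
   (m%:R * (2 * cw (n - 1)))%:E * \int[mu]_(y in `[A0, B0]) Gd I y)).
  by apply: leeD => //; apply: Dd_rows => //; lra.
have [|z [z1 ez]] := @cw_le R i (i + k%:Z)%R; first by rewrite lerDl.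
have wk : (cw (i + k%:Z) <= cw i)%R by rewrite ez ler_peMl ?ler1z// ltW.
rewrite -ge0_muleDl ?lee_fin; last 2 first.
- by rewrite mulr_ge0 ?subr_ge0// mulr_ge0//; lra.
- by rewrite mulr_ge0// mulr_ge0// ltW.
rewrite -EFinD; apply: lee_wpmul2r; first by apply: integral_ge0 => *; exact: Gd_ge0.
rewrite lee_fin en ew -/n.
have : (m%:R * cw n <= 5 * mv R L * cw n)%R by rewrite ler_pM2r.
(* A digit at most [5 * mv] at cost [8 * cw n] each gives [40 * mv * cw n]; the width drops by
   [3 * cw n] at this step, whence [40 / 3] and a telescoping sum. *)
have -> : (40 / 3 * mv R L * (cw i - cw n) = 40 / 3 * mv R L * (cw i - 4 * cw n) + 8 * (5 * mv R L * cw n))%R by field.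
have -> : (m%:R * (2 * (4 * cw n)) = 8 * (m%:R * cw n))%R by ring.
lra.
Qed.

Hypothesis uint : \int[mu \x mu]_z (`|u z|%R)%:E < +oo.

(** The digits cost less than the whole series, and the cost of the remainder [t - tau k] tends to 0
    by continuity in mean. *)
Lemma Dd_le (t a b A0 B0 : R) : (0 <= t <= 5 * cv i)%R -> (A0 <= a)%R -> (b + t <= B0)%R ->
  Dd I a b t <= (40 / 3 * mv R L * cw i)%:E * \int[mu]_(y in `[A0, B0]) Gd I y.
Proof.
move=> ht ha hb; have M0 := mv_ge (R := R) hL.
set Gam := integral _ _ _; have Gam0 : 0 <= Gam by apply: integral_ge0 => *; exact: Gd_ge0.
have [tau Htau] := choice (fun k => Dd_approx k ht ha hb).
(* The minimum only meets the bound required by the continuity lemma; it is inactive for large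
   [k]. *)
pose s k := Num.min 1%R (t - tau k)%R.
have s01 k : (0 <= s k <= 1)%R.
  have [/andP[_ h] _] := Htau k.
  by rewrite /s le_min ler01 subr_ge0 h ge_min lexx.
have tle k : (t - tau k <= 5 * cv i / k.+1%:R)%R.
  have [_ [h _]] := Htau k; apply: le_trans h _.
  rewrite ler_pdivlMr ?ltr0n// -mulrA ler_pM2l; last lra.
  rewrite (cvD (R := R) hL i k) mulrC ler_pM2r//.
  apply: (@le_trans _ _ (2 ^+ k)%R); first by rewrite -natrX ler_nat ltn_expl.
  by apply: lerXn2r; rewrite ?nnegrE; lra.
have harm : (fun k : nat => 5 * cv i / k.+1%:R)%R @ \oo --> 0%R.
  rewrite -[X in _ --> X](mulr0 (5 * cv i)%R); apply: cvgM; first exact: cvg_cst.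
  exact: cvg_harmonic.
have s0 : s @ \oo --> 0%R.
  apply: (squeeze_cvgr _ (cvg_cst 0%R) harm); apply: nearW => k.
  have /andP[-> _] := s01 k; rewrite /= /s ge_min; apply/orP; right; exact: tle.
have V := @integrable_shift_L1_vertical R u I a (b + t)%R s mI mu_ uint s01 s0.
apply/lee_addgt0Pr => e e0.
have /fine_cvgP[V1 /cvgrPdist_lt /(_ e e0) V2] := V.
have harm1 : \forall k \near \oo, (`|0 - 5 * cv i / k.+1%:R| < 1)%R.
  by move/cvgrPdist_lt : harm => /(_ 1%R ltr01).
near \oo => k.
have [/andP[h0 h1] [h2 h3]] := Htau k.
have fin : \int[mu]_(y in `[a, (b + t)%R]) \int[mu]_(x in I) (`|u (x, y) - u (x, (y + s k)%R)|%R)%:E \is a fin_num.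
  by near: k; exact: V1.
have lt2 : (`|0 - fine (\int[mu]_(y in `[a, (b + t)%R]) \int[mu]_(x in I) (`|u (x, y) - u (x, (y + s k)%R)|%R)%:E)| < e)%R.
  by near: k; exact: V2.
have hk : (`|0 - 5 * cv i / k.+1%:R| < 1)%R by near: k.
have sk : s k = (t - tau k)%R.
  apply/min_idPr; apply: le_trans (tle k) _; apply: le_trans (ltW hk).
  by rewrite sub0r normrN ler_norm.
have -> : t = (tau k + (t - tau k))%R by ring.
apply: le_trans (Dd_add _ _ _ _ mI) _; apply: leeD.
  apply: le_trans h3 _; apply: lee_wpmul2r => //; rewrite lee_fin ler_pM2l.
    by rewrite gerBl ltW.
  lra.
rewrite -sk; apply: (@le_trans _ _ (Dd I a (b + t) (s k))).
  apply: ge0_subset_integral => //.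
  - by apply: measurable_funTS; exact: measurable_Nd_shift.
  - by move=> *; exact: Nd_ge0.
  - by move=> y /=; rewrite !in_itv /=; lra.
rewrite /Dd /Nd -(fineK fin) lee_fin; apply: le_trans (ltW lt2).
by rewrite sub0r normrN ler_norm.
Unshelve. all: by end_near. Qed.

Lemma width_ge0 : (0 <= 2 * w)%R.
Proof. by rewrite mulr_ge0// ltW// cw0. Qed.

Lemma integral_I_cst (k : \bar R) : \int[mu]_(x in I) k = k * (2 * w)%:E.
Proof.
have w0 := cw0 i; rewrite /I integral_itv_cst; last by rewrite ler_pM2r// ler_int lerDl.
by congr (_ * _); congr EFin; rewrite intrD mulrDl -/w; ring.
Qed.

Definition qd (m y : R) : \bar R := \int[mu]_(x in I) (`|u (x, y) - m|%R)%:E.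
Definition Osc (a m : R) : \bar R := \int[mu]_(y in `[(a - cv i)%R, (a + cv i)%R]) qd m y.

Lemma measurable_dist_cst m : measurable_fun setT (fun z : RR * RR => (`|u z - m|%R)%:E : \bar R).
Proof. by apply: measurable_EFin_dist => //; exact: measurable_cst. Qed.

Lemma measurable_dist_cst_x m y : measurable_fun setT (fun x : RR => (`|u (x, y) - m|%R)%:E : \bar R).
Proof. by apply: measurable_EFin_dist; [exact: mu_x|exact: measurable_cst]. Qed.

Lemma qd_ge0 m y : 0 <= qd m y.
Proof. by apply: integral_ge0 => x _; rewrite lee_fin. Qed.

Lemma measurable_qd m : measurable_fun setT (qd m : RR -> \bar R).
Proof.
have f0 z : 0 <= (`|u z - m|%R)%:E :> \bar R by rewrite lee_fin.
exact: (measurable_fun_integral_x mI (measurable_dist_cst m) f0).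
Qed.

(* The factor 2 makes the averaging inequality strict when [K > 0]. *)
Lemma good_point (V : set RR) (Phi : RR -> \bar R) (K : R) : measurable V -> 0 < mu V -> mu V < +oo ->
  measurable_fun setT Phi -> (forall y, 0 <= Phi y) -> (0 <= K)%R ->
  \int[mu]_(y in V) Phi y <= K%:E * mu V -> exists2 y, V y & Phi y <= (2 * K)%:E.
Proof.
move=> mV V0 Vfin mPhi Phi0 K0 H; apply: contrapT => N.
have lt y : V y -> (2 * K)%:E < Phi y.
  by move=> Vy; rewrite ltNge; apply/negP => h; apply: N; exists y.
have Vf : mu V \is a fin_num by rewrite ge0_fin_numE// ltW.
move: K0; rewrite le_eqVlt => /orP[/eqP K0|K0].
  have int0 : \int[mu]_(y in V) `|Phi y| = 0.
    under eq_integral do rewrite gee0_abs//.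
    apply/eqP; rewrite eq_le integral_ge0// andbT; apply: le_trans H _.
    by rewrite -K0 mul0e.
  have [Z [mZ Z0 VZ]] := (ae_eq_integral_abs mu mV (measurable_funTS mPhi)).1 int0.
  have : mu V <= mu Z.
    apply: le_measure; rewrite ?inE//.
    move=> y Vy; apply: VZ => /= /(_ Vy) h; have := lt y Vy.
    by rewrite h -K0 mulr0 ltxx.
  by rewrite Z0 leNgt V0.
have : \int[mu]_(y in V) (cst (2 * K)%:E y) <= \int[mu]_(y in V) Phi y.
  apply: ge0_le_integral => //; [|exact: measurable_funTS|].
    by move=> y _; rewrite /= lee_fin mulr_ge0// ltW.
  by move=> y /lt /ltW.
rewrite integral_cst// => /le_trans /(_ H) h.
have : (2 * K * fine (mu V) <= K * fine (mu V))%R by rewrite -lee_fin !EFinM fineK// -EFinM.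
have : (0 < fine (mu V))%R by rewrite fine_gt0// V0.
move=> f0; rewrite ler_pM2r//; lra.
Qed.

Lemma integral_Nd_shift (y b1 b2 T : R) : (0 <= b1 - y)%R -> (b2 - y <= T)%R ->
  \int[mu]_(y' in `[b1, b2]) Nd I y y' <= \int[mu]_(t in `[0%R, T]) Nd I y (y + t).
Proof.
move=> h1 h2.
have m1 : measurable_fun setT (fun y' : RR => Nd I y y').
  exact: (measurableT_comp (measurable_Nd mI) (measurable_pair1 y)).
have := @integral_shift_itv R y (b1 - y) (b2 - y) _ m1 (Nd_ge0 I y); rewrite !subrK => ->.
have eN : (fun t : RR => Nd I y (t + y)) = (fun t : RR => Nd I y (y + t)).
  by apply/funext => t; rewrite addrC.
have m2 : measurable_fun setT (fun t : RR => Nd I y (y + t)).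
  by rewrite -eN; exact: (measurable_shift y m1).
rewrite eN.
apply: ge0_subset_integral => //; [exact: measurable_funTS|by move=> *; exact: Nd_ge0|].
by move=> t /=; rewrite !in_itv /=; lra.
Qed.

(** Substituting [y' = y + t] and exchanging the integrals leaves one vertical translation for each
    [t] in an interval of length [4 * v]. *)
Lemma integral_Nd_square (a : R) (v := cv i) :
  \int[mu]_(y' in `[(a + v)%R, (a + 3 * v)%R]) \int[mu]_(y in `[(a - v)%R, (a + v)%R]) Nd I y y' <=
  (40 / 3 * mv R L * cw i * (4 * v))%:E * \int[mu]_(y in `[(a - v)%R, (a + 5 * v)%R]) Gd I y.
Proof.
have v0 : (0 < v)%R by exact: cv0.
set Gam := \int[mu]_(y in `[(a - v)%R, (a + 5 * v)%R]) Gd I y.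
have Gam0 : 0 <= Gam by apply: integral_ge0 => *; exact: Gd_ge0.
have mN := measurable_Nd mI.
have ms : measurable_fun setT (fun z : RR * RR => (z.2, z.1) : RR * RR) by exact: measurable_swap.
have mN' : measurable_fun setT (fun z : RR * RR => Nd I z.2 z.1) by exact: (measurableT_comp mN ms).
have mN2 : measurable_fun setT (fun z : RR * RR => Nd I z.2 (z.2 + z.1)).
  have mp : measurable_fun setT (fun z : RR * RR => (z.2, (z.2 + z.1)%R) : RR * RR).
    apply/measurable_fun_pairP; split => /=; first exact: measurable_snd.
    by apply: measurable_funD; [exact: measurable_snd|exact: measurable_fst].
  exact: (measurableT_comp mN mp).
rewrite (@integral_swap R _ _ (fun z => Nd I z.2 z.1)) //=; last by move=> *; exact: Nd_ge0.
apply: (@le_trans _ _ (\int[mu]_(y in `[(a - v)%R, (a + v)%R]) \int[mu]_(t in `[0%R, (4 * v)%R]) Nd I y (y + t))).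
  have n1 (z : RR * RR) : 0 <= Nd I z.2 z.1 by exact: Nd_ge0.
  have n2 (z : RR * RR) : 0 <= Nd I z.2 (z.2 + z.1) by exact: Nd_ge0.
  apply: ge0_le_integral.
  - exact: measurable_itv.
  - by move=> *; apply: integral_ge0 => *; exact: Nd_ge0.
  - by apply: measurable_funTS; exact: (measurable_fun_integral_x (measurable_itv _) mN' n1).
  - by apply: measurable_funTS; exact: (measurable_fun_integral_x (measurable_itv _) mN2 n2).
  - by move=> y /=; rewrite in_itv /= => /andP[h1 h2]; apply: integral_Nd_shift; lra.
rewrite -(@integral_swap R _ _ (fun z => Nd I z.2 (z.2 + z.1))) //=; last by move=> *; exact: Nd_ge0.
apply: (@le_trans _ _ (\int[mu]_(t in `[0%R, (4 * v)%R]) ((40 / 3 * mv R L * cw i)%:E * Gam))).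
  pose f (z : RR * RR) := Nd I z.1 (z.1 + z.2).
  have mf : measurable_fun setT f by exact: (measurableT_comp mN2 ms).
  have f0 z : 0 <= f z by exact: Nd_ge0.
  apply: ge0_le_integral.
  - exact: measurable_itv.
  - by move=> *; apply: integral_ge0 => *; exact: Nd_ge0.
  - by apply: measurable_funTS; exact: (measurable_fun_integral_x (measurable_itv _) mf f0).
  - exact: measurable_cst.
  - move=> t /=; rewrite in_itv /= => /andP[h1 h2]; rewrite -/v in h2.
    by apply: Dd_le; rewrite -/v; lra.
rewrite integral_itv_cst; last by rewrite mulr_ge0// ltW.
by rewrite subr0 muleAC -EFinM.
Qed.

Lemma qd_le (m' y y' : R) : m' = u ((c%:~R * w)%R, y') ->
  qd m' y <= Nd I y y' + (2 * w)%:E * Gd I y'.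
Proof.
move=> ->; rewrite muleC -integral_I_cst /Nd -ge0_integralD; last 5 first.
- exact: mI.
- by move=> *; rewrite lee_fin.
- by apply: measurable_funTS; apply: measurable_EFin_dist; exact: mu_x.
- by move=> *; exact: Gd_ge0.
- exact: measurable_cst.
apply: ge0_le_integral => //.
- by apply: measurable_funTS; exact: measurable_dist_cst_x.
- apply: emeasurable_funD; [|exact: measurable_cst].
  by apply: measurable_funTS; apply: measurable_EFin_dist; exact: mu_x.
move=> x; rewrite /I /= in_itv /= => hx.
have hl : (c%:~R * w <= c%:~R * w <= (c + 2)%:~R * w)%R.
  by rewrite lexx /= ler_pM2r ?cw0// ler_int lerDl.
apply: le_trans (leeD (lexx _) (ug_itv y' hx hl)); rewrite -EFinD lee_fin.
exact: ler_distD.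
Qed.

(** The constant is the value of [u] at the left end of a well chosen row, found by averaging. The
    row is sought above the rectangle so that all translations go upwards, hence the asymmetric
    range up to [a + 5 * v]. *)
Lemma osc_exists (a : R) (v := cv i) :
  \int[mu]_(y in `[(a - v)%R, (a + 5 * v)%R]) Gd I y < +oo ->
  exists m, Osc a m <= (54 * mv R L * w)%:E * \int[mu]_(y in `[(a - v)%R, (a + 5 * v)%R]) Gd I y.
Proof.
have v0 : (0 < v)%R by exact: cv0.
have w0 : (0 < w)%R by exact: cw0.
have M0 := mv_ge (R := R) hL.
set Gam := integral _ _ _; have Gam0 : 0 <= Gam by apply: integral_ge0 => *; exact: Gd_ge0.
move=> Gfin; have Gf : Gam \is a fin_num by rewrite ge0_fin_numE.
pose V : set RR := `[(a - v)%R, (a + v)%R]%classic.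
pose V' : set RR := `[(a + v)%R, (a + 3 * v)%R]%classic.
have aV : (a - v <= a + v)%R by lra.
have mV : measurable V by exact: measurable_itv.
have mV' : measurable V' by exact: measurable_itv.
have mG := measurable_Gd mI.
have mN' : measurable_fun setT (fun z : RR * RR => Nd I z.1 z.2) by exact: measurable_Nd.
pose P1 (y' : RR) := \int[mu]_(y in V) Nd I y y'.
have mP1 : measurable_fun setT P1.
  by apply: (@measurable_fun_integral_x R _ RR V (fun z => Nd I z.1 z.2)) => // *; exact: Nd_ge0.
pose P2 (y' : RR) := (4 * v * w)%:E * Gd I y'.
have mP2 : measurable_fun setT P2 by apply: emeasurable_funM => //; exact: measurable_cst.
have P10 y' : 0 <= P1 y' by apply: integral_ge0 => *; exact: Nd_ge0.
have c0 : (0 <= 4 * v * w)%R by rewrite !mulr_ge0// ltW.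
have P20 y' : 0 <= P2 y' by rewrite mule_ge0 ?lee_fin// Gd_ge0.
have muV' : mu V' = (2 * v)%:E.
  rewrite /V' lebesgue_measure_itv /= lte_fin ifT; last by lra.
  by rewrite -EFinB; congr EFin; ring.
(* The measure [2 * v] of [V'] turns 27 into 54, which leaves room above [160 / 3] to absorb the
   term 4, as [mv] is at least 300. *)
have [|||||||y' Vy' Hy'] := @good_point V' (fun y' => P1 y' + P2 y') (27 * mv R L * w * fine Gam) .
- exact: mV'.
- by rewrite muV' lte_fin; lra.
- by rewrite muV' ltry.
- exact: emeasurable_funD.
- by move=> y; exact: adde_ge0.
- by rewrite mulr_ge0 ?fine_ge0// mulr_ge0 ?(ltW w0)//; lra.
- rewrite ge0_integralD//; [|exact: measurable_funTS..].
  rewrite ge0_integralZl//; [|exact: measurable_funTS|by move=> *; exact: Gd_ge0].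
  apply: le_trans (leeD (integral_Nd_square a) (lexx _)) _; rewrite -/v -/Gam.
  have h : \int[mu]_(y in V') Gd I y <= Gam.
    apply: ge0_subset_integral => //; [exact: measurable_funTS|by move=> *; exact: Gd_ge0|].
    by move=> y; rewrite /V' /= !in_itv /=; lra.
  apply: (@le_trans _ _ ((40 / 3 * mv R L * cw i * (4 * v))%:E * Gam + (4 * v * w)%:E * Gam)).
    by apply: leeD => //; exact: lee_wpmul2l.
  rewrite muV' -(fineK Gf) -!EFinM -EFinD lee_fin -mulrDl.
  have G0 : (0 <= fine Gam)%R by rewrite fine_ge0.
  have -> : (27 * mv R L * w * fine Gam * (2 * v) = (54 * mv R L * (w * v)) * fine Gam)%R by ring.
  apply: ler_wpM2r => //.
  have -> : (40 / 3 * mv R L * cw i * (4 * v) + 4 * v * w = (160 / 3 * mv R L + 4) * (w * v))%R.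
    by rewrite -/w; field.
  by rewrite ler_pM2r ?mulr_gt0//; lra.
exists (u ((c%:~R * w)%R, y')).
have -> : (54 * mv R L * w)%:E * Gam = (2 * (27 * mv R L * w * fine Gam))%:E.
  by rewrite -{1}(fineK Gf) -EFinM; congr EFin; ring.
apply: le_trans Hy'; rewrite /Osc -/v -/V.
have mNy : measurable_fun V (fun y : RR => Nd I y y').
  by apply: measurable_funTS; exact: (measurableT_comp mN' (measurable_pair2 y')).
apply: (@le_trans _ _ (\int[mu]_(y in V) (Nd I y y' + (2 * w)%:E * Gd I y'))).
  apply: ge0_le_integral.
  - exact: mV.
  - by move=> *; exact: qd_ge0.
  - by apply: measurable_funTS; exact: measurable_qd.
  - by apply: emeasurable_funD; [exact: mNy|exact: measurable_cst].
  - by move=> y _; exact: qd_le.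
rewrite ge0_integralD; last 5 first.
- exact: mV.
- by move=> *; exact: Nd_ge0.
- exact: mNy.
- by move=> *; rewrite mule_ge0 ?Gd_ge0// lee_fin width_ge0.
- exact: measurable_cst.
apply: leeD; first exact: lexx.
have -> : \int[mu]_(y in V) ((2 * w)%:E * Gd I y') = (2 * w)%:E * Gd I y' * (a + v - (a - v))%:E.
  exact: (integral_itv_cst _ aV).
rewrite muleAC -EFinM /P2 le_eqVlt; apply/orP; left; apply/eqP.
by congr (_%:E * _); ring.
Qed.

(** On the glued strip [m] and [m'] are compared through the midline of the window, where [u] agrees
    on both sides; this bounds [|m - m'|] times the area of the strip. Passing from its height
    [v / 4] to the height [2 * v] of the rectangle costs the factor 8. *)
Lemma link_osc (a a' m m' : R) (v := cv i) : link L i c a a' ->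
  Osc a' m <= Osc a' m' + 8%:E * (Osc a m + Osc a' m' + (2 * w)%:E *
    (\int[mu]_(y in `[(a - v)%R, (a + v)%R]) Gd I y + \int[mu]_(y in `[(a' - v)%R, (a' + v)%R]) Gd I y)).
Proof.
have v0 : (0 < v)%R by exact: cv0.
have w0 : (0 < w)%R by exact: cw0.
move=> [e [e1 e2 He]]; rewrite -/v in e1 e2 He; set s := (a' - a)%R in He.
set X := Osc a m + Osc a' m' + _; set d := `|m - m'|%R.
have d0 : (0 <= d)%R by exact: normr_ge0.
have mG := measurable_Gd mI.
have hx0 : (c%:~R * w <= (c + 1)%:~R * w <= (c + 2)%:~R * w)%R.
  by rewrite !ler_pM2r// !ler_int lerDl lerD2l.
have row y : (e <= y <= e + v / 4)%R ->
    (d * (2 * w))%:E <= qd m y + qd m' (y + s) + (2 * w)%:E * (Gd I y + Gd I (y + s)).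
  move=> hy.
  have eu : u (((c + 1)%:~R * w)%R, y) = u (((c + 1)%:~R * w)%R, (y + s)%R).
    apply: uinv; have := He (y - e)%R.
    by rewrite [in X in X -> _ ]/= (addrC e) subrK; apply; lra.
  rewrite EFinM -integral_I_cst muleC -integral_I_cst.
  rewrite /qd -ge0_integralD; last 5 first.
  - exact: mI.
  - by move=> *; rewrite lee_fin.
  - by apply: measurable_funTS; exact: measurable_dist_cst_x.
  - by move=> *; rewrite lee_fin.
  - by apply: measurable_funTS; exact: measurable_dist_cst_x.
  rewrite -ge0_integralD; last 5 first.
  - exact: mI.
  - by move=> *; rewrite adde_ge0// lee_fin.
  - by apply: emeasurable_funD; apply: measurable_funTS; exact: measurable_dist_cst_x.
  - by move=> *; rewrite adde_ge0// Gd_ge0.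
  - exact: measurable_cst.
  apply: ge0_le_integral.
  - exact: mI.
  - by move=> *; rewrite lee_fin.
  - exact: measurable_cst.
  - by apply: emeasurable_funD; [apply: emeasurable_funD; apply: measurable_funTS; exact: measurable_dist_cst_x|exact: measurable_cst].
  move=> x; rewrite /I /= in_itv /= => hx.
  have h1 := ug_itv y hx hx0; have h2 := ug_itv (y + s) hx0 hx.
  apply: le_trans (leeD (lexx _) (leeD h1 h2)); rewrite -!EFinD lee_fin eu /d.
  set p := u (x, y); set q := u (x, (y + s)%R); set z := u (_, (y + s)%R).
  have t1 := ler_distD p m m'; have t2 := ler_distD z p q; have t3 := ler_distD q p m'.
  by rewrite (distrC m p) in t1; lra.
have key : (d * (2 * w) * (v / 4))%:E <= X.
  have -> : (d * (2 * w) * (v / 4))%:E = \int[mu]_(y in `[e, (e + v / 4)%R]) (d * (2 * w))%:E.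
    by rewrite integral_itv_cst; [rewrite -EFinM; congr EFin; ring|lra].
  have mq k : measurable_fun setT (fun y : RR => qd k (y + s)).
    exact: (measurable_shift s (measurable_qd k)).
  have mGs : measurable_fun setT (fun y : RR => Gd I (y + s)) by exact: (measurable_shift s mG).
  have mGG : measurable_fun setT (fun y : RR => Gd I y + Gd I (y + s)) by exact: emeasurable_funD.
  have mqq : measurable_fun setT (fun y : RR => qd m y + qd m' (y + s)).
    by apply: emeasurable_funD => //; exact: measurable_qd.
  have mGw : measurable_fun setT (fun y : RR => (2 * w)%:E * (Gd I y + Gd I (y + s))).
    by apply: emeasurable_funM => //; exact: measurable_cst.
  have qq0 y : 0 <= qd m y + qd m' (y + s) by rewrite adde_ge0// qd_ge0.
  have GG0 y : 0 <= Gd I y + Gd I (y + s) by rewrite adde_ge0// Gd_ge0.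
  have Gw0 y : 0 <= (2 * w)%:E * (Gd I y + Gd I (y + s)) by rewrite mule_ge0// lee_fin width_ge0.
  apply: (@le_trans _ _ (\int[mu]_(y in `[e, (e + v / 4)%R])
      (qd m y + qd m' (y + s) + (2 * w)%:E * (Gd I y + Gd I (y + s))))).
    apply: ge0_le_integral.
    - exact: measurable_itv.
    - by move=> *; rewrite lee_fin mulr_ge0// width_ge0.
    - exact: measurable_cst.
    - by apply: measurable_funTS; exact: emeasurable_funD.
    - by move=> y /=; rewrite in_itv /=; exact: row.
  rewrite ge0_integralD; last 5 first.
  - exact: measurable_itv.
  - by move=> *; exact: qq0.
  - exact: measurable_funTS.
  - by move=> *; exact: Gw0.
  - exact: measurable_funTS.
  rewrite ge0_integralZl; last 4 first.
  - exact: measurable_itv.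
  - exact: measurable_funTS.
  - by move=> *; exact: GG0.
  - by rewrite lee_fin width_ge0.
  have sub k (f : RR -> \bar R) : measurable_fun setT f -> (forall y, 0 <= f y) -> k = a \/ k = a' ->
      \int[mu]_(y in `[e, (e + v / 4)%R]) f (y + (k - a))%R <= \int[mu]_(y in `[(k - v)%R, (k + v)%R]) f y.
    move=> mf f0 hk; rewrite -(@integral_shift_itv R (k - a) e (e + v / 4) _ mf f0).
    apply: ge0_subset_integral => //; first exact: measurable_funTS.
    by move=> y /=; rewrite !in_itv /=; lra.
  have sub0 (f : RR -> \bar R) : measurable_fun setT f -> (forall y, 0 <= f y) ->
      \int[mu]_(y in `[e, (e + v / 4)%R]) f y <= \int[mu]_(y in `[(a - v)%R, (a + v)%R]) f y.
    move=> mf f0; apply: ge0_subset_integral => //; first exact: measurable_funTS.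
    by move=> y /=; rewrite !in_itv /=; lra.
  apply: leeD.
    rewrite ge0_integralD; last 5 first.
    - exact: measurable_itv.
    - by move=> *; exact: qd_ge0.
    - by apply: measurable_funTS; exact: measurable_qd.
    - by move=> *; exact: qd_ge0.
    - exact: measurable_funTS.
    apply: leeD; first by apply: sub0; [exact: measurable_qd|exact: qd_ge0].
    by apply: sub; [exact: measurable_qd|exact: qd_ge0|right].
  apply: lee_wpmul2l; first by rewrite lee_fin width_ge0.
  rewrite ge0_integralD; last 5 first.
  - exact: measurable_itv.
  - by move=> *; exact: Gd_ge0.
  - exact: measurable_funTS.
  - by move=> *; exact: Gd_ge0.
  - exact: measurable_funTS.
  apply: leeD; first by apply: sub0; [exact: mG|exact: Gd_ge0].
  by apply: sub; [exact: mG|exact: Gd_ge0|right].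
apply: (@le_trans _ _ (Osc a' m' + 8%:E * (d * (2 * w) * (v / 4))%:E)); last first.
  by apply: leeD => //; apply: lee_wpmul2l.
have av : (a' - v <= a' + v)%R by lra.
have -> : 8%:E * (d * (2 * w) * (v / 4))%:E = (d * (2 * w))%:E * (a' + v - (a' - v))%:E.
  by rewrite -!EFinM; congr EFin; field.
have mqy : measurable_fun `[(a' - v)%R, (a' + v)%R]%classic (qd m' : RR -> \bar R).
  by apply: measurable_funTS; exact: measurable_qd.
apply: (@le_trans _ _ (\int[mu]_(y in `[(a' - v)%R, (a' + v)%R]) (qd m' y + (d * (2 * w))%:E))); last first.
  rewrite ge0_integralD; last 5 first.
  - exact: measurable_itv.
  - by move=> *; exact: qd_ge0.
  - exact: mqy.
  - by move=> *; rewrite lee_fin mulr_ge0// width_ge0.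
  - exact: measurable_cst.
  by apply: leeD; [exact: lexx|rewrite (integral_itv_cst _ av)].
apply: ge0_le_integral.
- exact: measurable_itv.
- by move=> *; exact: qd_ge0.
- by apply: measurable_funTS; exact: measurable_qd.
- by apply: emeasurable_funD; [exact: mqy|exact: measurable_cst].
move=> y _; rewrite EFinM -integral_I_cst.
apply: (@le_trans _ _ (\int[mu]_(x in I) ((`|u (x, y) - m'|%R)%:E + d%:E))); last first.
  rewrite ge0_integralD; last 5 first.
  - exact: mI.
  - by move=> *; rewrite lee_fin.
  - by apply: measurable_funTS; exact: measurable_dist_cst_x.
  - by move=> *; rewrite lee_fin.
  - exact: measurable_cst.
  exact: lexx.
apply: ge0_le_integral.
- exact: mI.
- by move=> *; rewrite lee_fin.
- by apply: measurable_funTS; exact: measurable_dist_cst_x.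
- by apply: emeasurable_funD; [apply: measurable_funTS; exact: measurable_dist_cst_x|exact: measurable_cst].
by move=> x _; rewrite -EFinD lee_fin /d (distrC m) ler_distD.
Qed.

Lemma chain_osc (a : R) (A : seq R) (Gam : \bar R) (v := cv i) : (size A <= 2)%N ->
  path (fun a a' => `[< link L i c a a' >]) a A -> Gam < +oo ->
  (forall a', a' \in a :: A -> \int[mu]_(y in `[(a' - v)%R, (a' + 5 * v)%R]) Gd I y <= Gam) ->
  exists m, forall a', a' \in a :: A -> Osc a' m <= (100 * 100 * mv R L * w)%:E * Gam.
Proof.
have v0 : (0 < v)%R by exact: cv0.
have w0 : (0 < w)%R by exact: cw0.
have M0 := mv_ge (R := R) hL; have mG := measurable_Gd mI.
move=> sA pA Gfin HG.
have Gam0 : 0 <= Gam.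
  by apply: le_trans (HG a (mem_head _ _)); apply: integral_ge0 => *; exact: Gd_ge0.
have Gf : Gam \is a fin_num by rewrite ge0_fin_numE.
have small b : b \in a :: A -> \int[mu]_(y in `[(b - v)%R, (b + v)%R]) Gd I y <= Gam.
  move=> /HG; apply: le_trans; apply: ge0_subset_integral => //.
  - exact: measurable_funTS.
  - by move=> *; exact: Gd_ge0.
  - by move=> y /=; rewrite !in_itv /=; lra.
have ex b : b \in a :: A -> exists m, Osc b m <= (54 * mv R L * w)%:E * Gam.
  move=> hb; have [|m Hm] := @osc_exists b; first exact: le_lt_trans (HG _ hb) Gfin.
  exists m; apply: le_trans Hm _; apply: lee_wpmul2l; last exact: HG.
  by rewrite lee_fin !mulr_ge0//; lra.
(* 487 is [54 + 8 * 54 + 1], the last unit times [mv] absorbing the remaining 32. From 54 the two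
   possible links lead to constants below 1000 and 10000. *)
have step b b' m k k' : b \in a :: A -> b' \in a :: A -> link L i c b b' -> (0 <= k)%R -> (8 * k + 487 <= k')%R ->
    Osc b m <= (k * mv R L * w)%:E * Gam -> Osc b' m <= (k' * mv R L * w)%:E * Gam.
  move=> hb hb' lk k0 kk' Hk; have [m' Hm'] := ex _ hb'.
  apply: le_trans (link_osc m m' lk) _.
  apply: (@le_trans _ _ ((54 * mv R L * w)%:E * Gam + 8%:E * ((k * mv R L * w)%:E * Gam + (54 * mv R L * w)%:E * Gam + (2 * w)%:E * (Gam + Gam)))).
    apply: leeD => //; apply: lee_wpmul2l => //; apply: leeD; first exact: leeD.
    apply: lee_wpmul2l; first by rewrite lee_fin width_ge0.
    by apply: leeD; exact: small.
  rewrite -(fineK Gf) -!(EFinM, EFinD) lee_fin.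
  have g0' : (0 <= w * fine Gam)%R by rewrite mulr_ge0 ?fine_ge0// ltW.
  set gg := fine Gam in g0' *.
  have -> : (54 * mv R L * w * gg + 8 * (k * mv R L * w * gg + 54 * mv R L * w * gg + 2 * w * (gg + gg)) =
    (54 * mv R L + 8 * (k * mv R L + 54 * mv R L + 4)) * (w * gg))%R by ring.
  have -> : (k' * mv R L * w * gg = (k' * mv R L) * (w * gg))%R by ring.
  apply: ler_wpM2r => //.
  have h0 : ((8 * k + 487) * mv R L <= k' * mv R L)%R by rewrite ler_pM2r//; lra.
  lra.
have [m Hm] := ex a (mem_head _ _); exists m.
have weaken k b : (k <= 100 * 100)%R -> Osc b m <= (k * mv R L * w)%:E * Gam ->
    Osc b m <= (100 * 100 * mv R L * w)%:E * Gam.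
  move=> hk h; apply: (le_trans h); apply: lee_wpmul2r => //.
  rewrite lee_fin -[leLHS]mulrA -[leRHS]mulrA; apply: ler_wpM2r => //.
  by rewrite mulr_ge0 ?ltW//; lra.
have mem0 b (B : seq R) : b \in b :: B by exact: mem_head.
have mem1 b b' (B : seq R) : b' \in [:: b, b' & B] by rewrite !inE eqxx orbT.
have mem2 b b' b'' (B : seq R) : b'' \in [:: b, b', b'' & B] by rewrite !inE eqxx !orbT.
case: A sA pA HG small ex step => [|b [|b' [|//]]] _ pA HG small ex step b0.
- by rewrite inE => /eqP ->; apply: (weaken 54%R) => //; lra.
- move: pA => /= /andP[/asboolP l1 _].
  have h1 : Osc b m <= (10 * 100 * mv R L * w)%:E * Gam.
    by apply: (step a b m 54%R) => //; lra.
  rewrite !inE => /orP[]/eqP ->; first by apply: (weaken 54%R) => //; lra.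
  by apply: (weaken (10 * 100)%R) => //; lra.
- move: pA => /= /andP[/asboolP l1 /andP[/asboolP l2 _]].
  have h1 : Osc b m <= (10 * 100 * mv R L * w)%:E * Gam.
    by apply: (step a b m 54%R) => //; lra.
  have h2 : Osc b' m <= (100 * 100 * mv R L * w)%:E * Gam.
    by apply: (step b b' m (10 * 100)%R) => //; lra.
  rewrite !inE => /or3P[]/eqP ->; first by apply: (weaken 54%R) => //; lra.
    by apply: (weaken (10 * 100)%R) => //; lra.
  exact: h2.
Qed.

End Window.

End Slices.

(** * Balls of the quotient and conclusion *)

Section Borel.
Context {R : realType} (L : nat).
Hypothesis hL : (100 <= L)%N.
Notation mu := (@lebesgue_measure R).
Notation RR := (measurableTypeR R).
Notation cw := (@cw R).
Notation cv := (@cv R L).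

Lemma cell_rectangle (k a b : int) : cell L k a b =
  `[a%:~R * cw k, (a + 1)%:~R * cw k]%classic `*` `[b%:~R * cv k, (b + 1)%:~R * cv k]%classic.
Proof. by apply/seteqP; split=> z /=; rewrite !in_itv. Qed.

Lemma measurable_cell (k a b : int) : measurable (cell L k a b : set (RR * RR)).
Proof. by rewrite cell_rectangle; apply: measurableX; exact: measurable_itv. Qed.

(** Around each of its points [A] contains a small cell, so it is the union of the countably many
    cells it contains. *)
Lemma measurable_dopen (A : set (R * R)) : dopen L A -> measurable (A : set (RR * RR)).
Proof.
move=> oA.
pose F (k : int * int * int) : set (RR * RR) :=
  if `[< cell L k.1.1 k.1.2 k.2 `<=` A >] then cell L k.1.1 k.1.2 k.2 else set0.
have -> : A = \bigcup_k F k.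
  apply/seteqP; split=> [x Ax|x [[[k a] b] _]]; last first.
    by rewrite /F /=; case: asboolP => // h /h.
  have [r r0 xr] := oA x Ax; have [k kr] := cw_pow_lt r0.
  exists (k, Num.floor (x.1 / cw k), Num.floor (x.2 / cv k)) => //.
  rewrite /F /= asboolT; first exact: cell_floor.
  move=> z cz; apply: xr; apply: le_lt_trans kr.
  exact: (dinf_cell (cell_floor hL k x) cz).
apply: countable_bigcupT_measurable; first exact: countableP.
move=> k; rewrite /F; case: ifP => _; [exact: measurable_cell|exact: measurable0].
Qed.

Lemma dball_open (p : R * R) (r : R) : dopen L (dball L p r).
Proof.
move=> x px; exists (r - dinf L p x); first by rewrite subr_gt0.
move=> y xy; rewrite /dball /=; have := dinf_tri hL x p y.
by move: xy; rewrite /dball /= ltrBrDl => h1 h2; exact: le_lt_trans h1.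
Qed.

Lemma measurable_Xborel (A : set (R * R)) : Xborel L A -> measurable (A : set (RR * RR)).
Proof.
have H : @Xborel R L `<=` [set A : set (R * R) | measurable (A : set (RR * RR))].
  apply: smallest_sub; last exact: measurable_dopen.
  exact: (@sigma_algebra_measurable _ (RR * RR)%type).
exact: H.
Qed.

(* Points at distance zero cannot be separated by open sets, hence not by Borel sets. *)
Lemma Xborel_saturated (A : set (R * R)) (p q : R * R) : Xborel L A -> Rinf L p q -> A p -> A q.
Proof.
move=> XA pq; suff [] : (A p -> A q) /\ (A q -> A p) by [].
have H : @Xborel R L `<=` [set A : set (R * R) | (A p -> A q) /\ (A q -> A p)].
  apply: smallest_sub.
  - split=> [|B [h1 h2]|F HF] /=; first by split.
    + by split=> -[_ h]; split=> // ?; apply: h; [exact: h2|exact: h1].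
    + by split=> -[n _ Fn]; exists n => //; have [h1 h2] := HF n; [exact: h1|exact: h2].
  - have d0 := dinf_Rinf hL pq.
    move=> B oB; split=> [/oB|/oB] [r r0]; apply; rewrite /dball /=; last rewrite (dinf_sym hL).
      by rewrite d0.
    by rewrite d0.
exact: H.
Qed.

Lemma Xmeasurable_measurable d (T : measurableType d) (f : R * R -> T) :
  Xmeasurable_fun L f -> measurable_fun setT (f : RR * RR -> T).
Proof. by move=> Xf _ B mB; rewrite setTI; apply: measurable_Xborel; exact: Xf. Qed.

Lemma Xmeasurable_Rinf (f : R * R -> R) (p q : R * R) :
  Xmeasurable_fun L f -> Rinf L p q -> f p = f q.
Proof.
move=> Xf pq; have /(_ _ _ pq) h := Xborel_saturated (Xf [set f p] (measurable_set1 _)).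
by apply/esym; apply: h.
Qed.

End Borel.

(** * Horizontal segments as test curves *)

Section HorizontalCurves.
Context {R : realType} (L : nat).
Hypothesis hL : (100 <= L)%N.
Notation mu := (@lebesgue_measure R).
Notation RR := (measurableTypeR R).

(** The sum over any subdivision telescopes, so the supremum runs over a single value. *)
Lemma curve_length_horizontal (y a t : R) : a <= t ->
  curve_length L (fun s => (s, y)) a t = (t - a)%:E.
Proof.
move=> at_.
have sumE (n : nat) (s : nat -> R) : (forall i, (i < n)%N -> s i <= s i.+1) ->
    \sum_(i < n) dinf L (s i, y) (s i.+1, y) = s n - s 0%N.
  move=> hs; rewrite -(telescope_sumr s (leq0n n)) big_mkord.
  apply: eq_bigr => i _; rewrite dinf_horizontal// distrC ger0_norm// subr_ge0.
  exact: hs.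
rewrite /curve_length; set S := [set v | _].
have -> : S = [set (t - a)%:E].
  apply/seteqP; split=> v /=.
    by move=> [n [s [s0 [sn [hs ->]]]]]; rewrite sumE// s0 sn.
  move=> ->; exists 1%N, (fun k => if k is 0%N then a else t); split=> //; split=> //.
  split; first by case.
  by rewrite big_ord1 /= dinf_horizontal// distrC ger0_norm ?subr_ge0.
exact: ereal_sup1.
Qed.

(** The map from [s] to [(s + x, y)] is an arclength parametrization of the segment. *)
Lemma horizontal_upper_gradient (u : R * R -> R) (g : R * R -> \bar R) :
  Xmeasurable_fun L g -> (forall z, 0 <= g z)%E -> upper_gradient L u g ->
  forall x x' y, x <= x' ->
  ((`|u (x, y) - u (x', y)|%R)%:E <= \int[mu]_(s in `[x, x']) g (s, y))%E.
Proof.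
move=> Xg g0 ug x x' y xx'.
have mg : measurable_fun setT (fun s : RR => g (s, y)).
  by apply: measurableT_comp => //; exact: (Xmeasurable_measurable hL).
have rect : rectifiable L (fun s => (s, y)) x x'.
  split=> //; split; last by rewrite curve_length_horizontal// ltry.
  by move=> t _ e e0; exists e => // s _ h; rewrite dinf_horizontal.
have := ug _ _ _ rect (fun s => (s + x, y)).
rewrite curve_length_horizontal//= => h; apply: le_trans (h _) _.
  move=> t /andP[t0 t1]; rewrite curve_length_horizontal//= subrK.
  exact: dinfxx.
have := @integral_shift_itv R x 0 (x' - x) _ mg (fun s => g0 (s, y)).
rewrite add0r subrK => ->; exact: lexx.
Qed.

End HorizontalCurves.

Section Covering.
Local Open Scope ereal_scope.

Lemma integral_cover d (T : measurableType d) (R : realType) (m : {measure set T -> \bar R})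
    (K : eqType) (A : seq K) (S : K -> set T) (B : set T) (f : T -> \bar R) :
  measurable B -> (forall a, measurable (S a)) -> measurable_fun setT f -> (forall x, 0 <= f x) ->
  (forall x, B x -> exists2 a, a \in A & S a x) ->
  \int[m]_(x in B) f x <= \sum_(a <- A) \int[m]_(x in S a) f x.
Proof.
move=> + mS mf f0; elim: A B => [|a A IH] B mB BA.
  rewrite big_nil; have -> : B = set0 by apply/seteqP; split=> // x /BA [].
  by rewrite integral_set0.
rewrite big_cons.
have -> : B = (B `&` S a) `|` (B `\` S a) by rewrite setUIDK.
have m1 : measurable (B `&` S a) by exact: measurableI.
have m2 : measurable (B `\` S a) by exact: measurableD.
rewrite ge0_integral_setU//; last 2 first.
- exact: measurable_funTS.
- by apply/disj_setPS => x [[_ h1] [_ h2]].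
apply: leeD.
  by apply: ge0_subset_integral => //; exact: measurable_funTS.
apply: IH => // x [Bx nSx]; have [b + Sb] := BA _ Bx.
by rewrite inE => /orP[/eqP e|bA]; [move: Sb; rewrite e|exists b].
Qed.

End Covering.

(** * Diameter and volume of the pieces of a ball *)

Section Balls.
Context {R : realType} (L : nat).
Hypothesis hL : (100 <= L)%N.
Notation mu := (@lebesgue_measure R).
Notation RR := (measurableTypeR R).
Notation cw := (@cw R).
Notation cv := (@cv R L).

(** Move to the glued strip, jump at no cost and move back; each move, of height at most [cv i],
    costs [2 * cw i]. *)
Lemma link_dinf (i c : int) (a a' : R) : link L i c a a' ->
  dinf L ((c + 1)%:~R * cw i, a) ((c + 1)%:~R * cw i, a') <= 4 * cw i.
Proof.
move=> [e [e1 e2 He]]; set x := (c + 1)%:~R * cw i in He *.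
have v0 := cv_gt0 (R := R) hL i.
have h0 : Rinf L (x, e) (x, e + (a' - a)).
  by have := He 0; rewrite addr0; apply; rewrite lexx /=; lra.
have d1 : dinf L (x, a) (x, e) <= 2 * 1%:R * cw i.
  by apply: (dinf_vertical hL); rewrite ler_norml; apply/andP; split; lra.
have d2 : dinf L (x, e + (a' - a)) (x, a') <= 2 * 1%:R * cw i.
  by apply: (dinf_vertical hL); rewrite ler_norml; apply/andP; split; lra.
have d3 := dinf_Rinf hL h0.
have t1 := dinf_tri hL (x, e) (x, a) (x, a').
have t2 := dinf_tri hL (x, e + (a' - a)) (x, e) (x, a').
lra.
Qed.

Lemma chain_dinf (i c : int) (a : R) (A : seq R) : (size A <= 2)%N ->
  path (fun a a' => `[< link L i c a a' >]) a A ->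
  forall b b', b \in a :: A -> b' \in a :: A ->
  dinf L ((c + 1)%:~R * cw i, b) ((c + 1)%:~R * cw i, b') <= 8 * cw i.
Proof.
set x := (c + 1)%:~R * cw i => sA pA; have w0 := cw_gt0 (R := R) i.
have H0 b : dinf L (x, b) (x, b) <= 8 * cw i by rewrite dinfxx//; lra.
have H1 b b' : link L i c b b' -> dinf L (x, b) (x, b') <= 8 * cw i /\ dinf L (x, b') (x, b) <= 8 * cw i.
  by move=> /link_dinf; rewrite -/x (dinf_sym hL (x, b') (x, b)) => h; split; lra.
have H2 b b' b'' : link L i c b b' -> link L i c b' b'' ->
    dinf L (x, b) (x, b'') <= 8 * cw i /\ dinf L (x, b'') (x, b) <= 8 * cw i.
  move=> /link_dinf h1 /link_dinf h2; rewrite -/x in h1 h2.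
  rewrite (dinf_sym hL (x, b'') (x, b)).
  by have := dinf_tri hL (x, b') (x, b) (x, b''); split; lra.
case: A sA pA => [|d [|e [|//]]] _ /=.
- by move=> _ b b'; rewrite !inE => /eqP -> /eqP ->.
- move=> /andP[/asboolP l1 _] b b'; have [g1 g2] := H1 _ _ l1.
  by rewrite !inE => /orP[]/eqP -> /orP[]/eqP ->.
- move=> /andP[/asboolP l1 /andP[/asboolP l2 _]] b b'.
  have [g1 g2] := H1 _ _ l1; have [g3 g4] := H1 _ _ l2; have [g5 g6] := H2 _ _ _ l1 l2.
  by rewrite !inE => /or3P[]/eqP -> /or3P[]/eqP ->.
Qed.

(** Along the midline of the window the path costs at most 2 + 2 + 8 + 10 + 2 = 24 widths: sideways,
    to the nearest height of the chain, along the chain, up to five rows away, and sideways. *)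
Lemma structure_dinf (p q : R * R) (i c : int) (a : R) (A : seq R) : (size A <= 2)%N ->
  path (fun a a' => `[< link L i c a a' >]) a A ->
  c%:~R * cw i <= p.1 <= (c + 2)%:~R * cw i -> c%:~R * cw i <= q.1 <= (c + 2)%:~R * cw i ->
  (exists2 b, b \in a :: A & `|p.2 - b| <= cv i) ->
  (exists2 b, b \in a :: A & `|q.2 - b| <= 5 * cv i) ->
  dinf L p q < 25 * cw i.
Proof.
move=> sA pA hp hq [b bA pb] [b' bA' qb'].
have ch := chain_dinf sA pA bA bA'; set x := (c + 1)%:~R * cw i in ch.
have w0 := cw_gt0 (R := R) i.
have hx : x = c%:~R * cw i + cw i by rewrite /x intrD mulrDl mul1r.
have hx2 : (c + 2)%:~R * cw i = c%:~R * cw i + 2 * cw i by rewrite intrD mulrDl.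
rewrite hx2 in hp hq.
have d1 : dinf L p (x, p.2) <= 2 * cw i.
  rewrite [p in dinf L p]surjective_pairing dinf_horizontal// ler_norml.
  by apply/andP; split; lra.
have d2 : dinf L (x, p.2) (x, b) <= 2 * 1%:R * cw i.
  by apply: (dinf_vertical hL); rewrite mul1r.
have d3 : dinf L (x, b') (x, q.2) <= 2 * 5%:R * cw i.
  by apply: (dinf_vertical hL); rewrite distrC.
have d4 : dinf L (x, q.2) q <= 2 * cw i.
  rewrite [X in dinf L _ X]surjective_pairing dinf_horizontal// ler_norml.
  by apply/andP; split; lra.
have t1 := dinf_tri hL (x, p.2) p q; have t2 := dinf_tri hL (x, b) (x, p.2) q.
have t3 := dinf_tri hL (x, b') (x, b) q; have t4 := dinf_tri hL (x, q.2) (x, b') q.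
lra.
Qed.

Local Open Scope ereal_scope.

Lemma leb2_rectangle (a b c d : R) : (a <= b)%R -> (c <= d)%R ->
  @leb2 R (`[a, b]%classic `*` `[c, d]%classic) = ((b - a) * (d - c))%:E.
Proof.
move=> ab cd; have e (x y : R) : (x <= y)%R -> mu `[x, y]%classic = (y - x)%:E.
  move=> xy; rewrite lebesgue_measure_itv /= lte_fin; case: ltP => h; first by rewrite -EFinB.
  by have -> : (y - x = 0)%R by lra.
rewrite EFinM -(e _ _ ab) -(e _ _ cd).
by apply: (product_measure1E mu mu); exact: measurable_itv.
Qed.

Lemma leb2_ball_ge (p : R * R) (r : R) (k : int) : (cw k < r)%R ->
  (cw k * cv k)%:E <= @leb2 R (dball L p r).
Proof.
move=> kr; have w0 := cw_gt0 (R := R) k; have v0 := cv_gt0 (R := R) hL k.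
set a := Num.floor (p.1 / cw k); set b := Num.floor (p.2 / cv k).
have -> : (cw k * cv k)%:E = @leb2 R (cell L k a b).
  rewrite cell_rectangle leb2_rectangle ?ler_pM2r ?ler_int ?lerDl//.
  by congr EFin; rewrite !intrD !mulrDl !mul1r; ring.
apply: (@le_measure _ _ _ (mu \x mu)); rewrite ?inE.
- exact: measurable_cell.
- by apply: (measurable_dopen hL); exact: dball_open.
- by move=> z cz; apply: le_lt_trans kr; exact: (dinf_cell (cell_floor hL k p) cz).
Qed.

(** At most three rectangles of width [2 * cw k] and height [2 * cv k] cover the ball. *)
Lemma leb2_ball_le (p : R * R) (k : int) :
  @leb2 R (dball L p (cw k / 12)) <= (12 * (cw k * cv k))%:E.
Proof.
have w0 := cw_gt0 (R := R) k; have v0 := cv_gt0 (R := R) hL k.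
have [c [a [A [sA _ HA]]]] := ball_structure hL p k.
pose I : set RR := `[(c%:~R * cw k)%R, ((c + 2)%:~R * cw k)%R]%classic.
pose V (b : R) : set RR := `[(b - cv k)%R, (b + cv k)%R]%classic.
have mB : measurable (dball L p (cw k / 12) : set (RR * RR)).
  by apply: (measurable_dopen hL); exact: dball_open.
have := @integral_cover _ _ R (mu \x mu) R (a :: A) (fun b => I `*` V b) _ (cst 1) mB.
rewrite integral_cst// mul1e => h; apply: le_trans (h _ _ _ _) _.
- by move=> b; apply: measurableX; exact: measurable_itv.
- exact: measurable_cst.
- by [].
- move=> q Bq; have [h1 [b bA hb]] := HA q Bq; exists b => //.
  rewrite /I /V; split; rewrite /= in_itv //=.
  by move: hb; rewrite ler_norml => /andP[h2 h3]; apply/andP; split; lra.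
have e b : \int[mu \x mu]_(x in I `*` V b) (cst 1 x) = (4 * (cw k * cv k))%:E.
  rewrite integral_cst; last by apply: measurableX; exact: measurable_itv.
  rewrite mul1e -[LHS]/(@leb2 R (I `*` V b)) /I /V leb2_rectangle; last 2 first.
  - by rewrite ler_pM2r// ler_int lerDl.
  - by lra.
  by congr EFin; rewrite intrD mulrDl; ring.
under eq_bigr do rewrite e.
have s4 : (0 <= 4 * (cw k * cv k))%R by rewrite mulr_ge0// mulr_ge0// ltW.
by case: A sA {HA h} => [|b [|b' [|//]]] _; rewrite !big_cons big_nil adde0 -?EFinD lee_fin; lra.
Qed.

End Balls.

(** * Oscillation about the mean *)

Section Averages.
Context {R : realType}.
Notation mu := (@lebesgue_measure R).
Notation RR := (measurableTypeR R).
Local Open Scope ereal_scope.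

Lemma leb2_integral_EFin (D : set (RR * RR)) (f : RR * RR -> R) :
  measurable D -> measurable_fun setT (f : _ -> RR) ->
  (mu \x mu).-integrable D (EFin \o f) ->
  \int[@leb2 R]_(x in (D : set (R * R))) (f x)%:E = \int[mu \x mu]_(x in D) (f x)%:E.
Proof.
move=> mD mf fi.
pose phi : RR * RR -> (R * R)%type := fun x => x.
have mphi : measurable_fun setT phi by move=> _ Y mY; rewrite setTI; exact: mY.
have mEf : measurable_fun setT (EFin \o f) by exact/measurable_EFinP.
have H := @integral_pushforward _ _ _ _ R phi mphi (mu \x mu) D (EFin \o f) mEf fi mD.
etransitivity; last exact: H.
by [].
Qed.

(** Averaging [u - k] gives [|uB - k| * m B <= \int |u - k|], so the mean is at worst twice as bad
    as any constant. *)
Lemma mean_oscillation d (T : measurableType d) (m : {measure set T -> \bar R}) (B : set T)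
    (u : T -> R) (k : R) (uB := fine ((m B)^-1 * \int[m]_(x in B) (u x)%:E)) :
  measurable B -> 0 < m B -> m B < +oo -> measurable_fun B u ->
  \int[m]_(x in B) (`|u x|%R)%:E < +oo ->
  \int[m]_(x in B) (`|u x - uB|%R)%:E <= 2%:E * \int[m]_(x in B) (`|u x - k|%R)%:E.
Proof.
move=> mB B0 Bfin mu_ iu; have Bf : m B \is a fin_num by rewrite ge0_fin_numE// ltW.
set b := fine (m B); have eb : m B = b%:E by rewrite /b fineK.
have b0 : (0 < b)%R by rewrite -lte_fin -eb.
have mEu : measurable_fun B (EFin \o u) by exact/measurable_EFinP.
have iu' : m.-integrable B (EFin \o u) by apply/integrableP; split.
have mdist c : measurable_fun B (fun x => (`|u x - c|%R)%:E : \bar R).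
  by apply/measurable_EFinP; apply: measurableT_comp => //; apply: measurable_funB => //; exact: measurable_cst.
have icst c : m.-integrable B (cst c%:E).
  apply/integrableP; split; first exact: measurable_cst.
  by rewrite integral_cst// eb -EFinM ltry.
set U := \int[m]_(x in B) (u x)%:E in uB *.
have Uf : U \is a fin_num by exact: (integrable_fin_num mB iu').
have euB : (uB * b)%:E = U.
  rewrite /uB eb -(fineK Uf) inver gt_eqF// -EFinM /=; congr EFin.
  by rewrite mulrC mulrA divff ?mul1r// gt_eqF.
have diff : ((uB - k) * b)%:E = \int[m]_(x in B) (u x - k)%:E.
  have -> : (fun x => (u x - k)%:E) = (EFin \o u) \- cst k%:E by apply/funext => x.
  rewrite integralB//= integral_cst// eb -EFinM.
  by rewrite mulrBl EFinB euB.
set J := \int[m]_(x in B) (`|u x - k|%R)%:E.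
have le1 : (`|uB - k| * b)%:E <= J.
  have -> : (`|uB - k| * b)%R = `|(uB - k) * b|%R by rewrite normrM (ger0_norm (ltW b0)).
  rewrite -abse_EFin diff; apply: le_trans (le_abse_integral _ _ _) _ => //.
  by apply/measurable_EFinP; apply: measurable_funB => //; exact: measurable_cst.
apply: (@le_trans _ _ (\int[m]_(x in B) ((`|u x - k|%R)%:E + (`|uB - k|%R)%:E))).
  apply: ge0_le_integral.
  - exact: mB.
  - by move=> *; rewrite lee_fin.
  - exact: mdist.
  - by apply: emeasurable_funD; [exact: mdist|exact: measurable_cst].
  - by move=> x _; rewrite -EFinD lee_fin (distrC uB) ler_distD.
rewrite ge0_integralD; last 5 first.
- exact: mB.
- by move=> *; rewrite lee_fin.
- exact: mdist.
- by move=> *; rewrite lee_fin.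
- exact: measurable_cst.
have -> : 2%:E = 1 + 1 :> \bar R by rewrite -EFinD.
have J0 : 0 <= J by apply: integral_ge0 => *; rewrite lee_fin.
rewrite ge0_muleDl// mul1e; apply: leeD; first exact: lexx.
have -> : \int[m]_(x in B) (`|uB - k|%R)%:E = (`|uB - k|%R)%:E * m B by exact: integral_cst.
by rewrite eb -EFinM.
Qed.

End Averages.

(** * Oscillation on a ball and the constant *)

Section Poincare.
Context {R : realType} (L : nat).
Hypothesis hL : (100 <= L)%N.
Notation mu := (@lebesgue_measure R).
Notation RR := (measurableTypeR R).
Notation cw := (@cw R).
Notation cv := (@cv R L).
Local Open Scope ereal_scope.

(** One constant serves all the rectangles covering the ball, whence the factor 3; the radius
    [25 * cw i] takes in all heights over which [g] is integrated for them. *)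
Lemma ball_oscillation (p : R * R) (i : int) (B : set (R * R)) (u : R * R -> R) (g : R * R -> \bar R)
    (lamB := dball L p (25 * cw i)) :
  Xmeasurable_fun L u -> \int[@leb2 R]_x (`|u x|%R)%:E < +oo ->
  (forall z, 0 <= g z) -> Xmeasurable_fun L g -> upper_gradient L u g ->
  measurable (B : set (RR * RR)) -> B `<=` dball L p (cw i / 12) ->
  \int[mu \x mu]_(x in (lamB : set (RR * RR))) g x < +oo ->
  exists m, \int[mu \x mu]_(x in (B : set (RR * RR))) (`|u x - m|%R)%:E <=
    (3 * (100 * 100 * mv R L * cw i))%:E * \int[mu \x mu]_(x in (lamB : set (RR * RR))) g x.
Proof.
move=> Xu iu g0 Xg ugr mB Bsub.
set Gam := \int[mu \x mu]_(x in (lamB : set (RR * RR))) g x => Gfin.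
have mu_ : measurable_fun setT (u : RR * RR -> RR) by exact: (Xmeasurable_measurable hL).
have mg : measurable_fun setT (g : RR * RR -> \bar R) by exact: (Xmeasurable_measurable hL).
have w0 := cw_gt0 (R := R) i; have v0 := cv_gt0 (R := R) hL i.
have M0 := mv_ge (R := R) hL.
have ugx := horizontal_upper_gradient hL Xg g0 ugr.
have uinv : forall x y, Rinf L x y -> u x = u y by move=> x y; exact: (Xmeasurable_Rinf hL Xu).
have iu' : \int[mu \x mu]_z (`|u z|%R)%:E < +oo.
  have mabs : measurable_fun setT (fun z : RR * RR => (`|u z|%R)%:E : \bar R).
    by apply/measurable_EFinP; exact: measurableT_comp.
  have abs0 (z : RR * RR) : 0 <= (`|u z|%R)%:E :> \bar R by rewrite lee_fin.
  by rewrite -(leb2_integral measurableT mabs abs0).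
have [c [a [A [sA pA HA]]]] := ball_structure hL p i.
pose I : set RR := `[(c%:~R * cw i)%R, ((c + 2)%:~R * cw i)%R]%classic.
have mI : measurable I by exact: measurable_itv.
have [pI [b0 b0A pb0]] : (c%:~R * cw i <= p.1 <= (c + 2)%:~R * cw i)%R /\
    exists2 b, b \in a :: A & (`|p.2 - b| <= cv i)%R.
  by apply: HA; rewrite dinfxx//; lra.
have mlam : measurable (lamB : set (RR * RR)).
  by apply: (measurable_dopen hL); exact: dball_open.
have HG b : b \in a :: A ->
    \int[mu]_(y in `[(b - cv i)%R, (b + 5 * cv i)%R]) Gd g I y <= Gam.
  move=> bA; have mJ : measurable (`[(b - cv i)%R, (b + 5 * cv i)%R]%classic : set RR) by exact: measurable_itv.
  rewrite /Gd -(integral_rectangle mI mJ mg g0).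
  apply: ge0_subset_integral.
  - by apply: measurableX => //; exact: measurable_itv.
  - exact: mlam.
  - exact: measurable_funTS.
  - by move=> *; exact: g0.
  - move=> q [] /=; rewrite /I /= !in_itv /= => q1 q2.
    apply: (structure_dinf hL sA pA pI q1); first by exists b0.
    by exists b => //; rewrite ler_norml; move: q2 => /andP[h1 h2]; apply/andP; split; lra.
have [m Hm] := @chain_osc R L hL u g mu_ mg g0 ugx uinv i c iu' a A Gam sA pA Gfin HG.
exists m.
pose V (b : R) : set RR := `[(b - cv i)%R, (b + cv i)%R]%classic.
have mV b : measurable (V b) by exact: measurable_itv.
have mdist : measurable_fun setT (fun z : RR * RR => (`|u z - m|%R)%:E : \bar R).
  by apply: measurable_EFin_dist => //; exact: measurable_cst.
have dist0 (z : RR * RR) : 0 <= (`|u z - m|%R)%:E :> \bar R by rewrite lee_fin.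
have mS b : measurable (I `*` V b) by exact: measurableX.
have BS : forall q, B q -> exists2 b, b \in a :: A & (I `*` V b) q.
  move=> q /Bsub Bq; have [h1 [b bA hb]] := HA q Bq; exists b => //.
  rewrite /I /V; split; rewrite /= in_itv //=.
  by move: hb; rewrite ler_norml => /andP[h2 h3]; apply/andP; split; lra.
apply: le_trans (@integral_cover _ _ R (mu \x mu) R (a :: A) _ _ _ mB mS mdist dist0 BS) _.
have G0 : 0 <= Gam by apply: integral_ge0 => *; exact: g0.
set k := (100 * 100 * mv R L * cw i)%R in Hm *.
have k0 : (0 <= k)%R by rewrite /k mulr_ge0 ?(ltW w0)// mulr_ge0//; lra.
have e b : b \in a :: A -> \int[mu \x mu]_(z in I `*` V b) (`|u z - m|%R)%:E <= k%:E * Gam.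
  move=> bA; rewrite (integral_rectangle mI (mV b) mdist dist0); exact: Hm.
have kG : 0 <= k%:E * Gam by rewrite mule_ge0.
have -> : (3 * k)%:E * Gam = k%:E * Gam + (k%:E * Gam + k%:E * Gam).
  have -> : (3 * k = k + (k + k))%R by ring.
  by rewrite !EFinD !ge0_muleDl ?lee_fin ?addr_ge0.
case: A sA {pA HA HG Hm BS b0A} e => [|b [|b' [|//]]] _ e; rewrite !big_cons big_nil adde0.
- apply: le_trans (e a (mem_head _ _)) _.
  by rewrite leeDl// adde_ge0.
- apply: leeD; first by apply: e; rewrite !inE eqxx.
  apply: (@le_trans _ _ (k%:E * Gam)); last by rewrite leeDl.
  by apply: e; rewrite !inE eqxx orbT.
- apply: leeD; first by apply: e; rewrite !inE eqxx.
  by apply: leeD; apply: e; rewrite !inE eqxx ?orbT.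
Qed.

(** The factors are, in order: twice the three rectangles, the constant of the chain, the area of a
    cell of scale [i] against that of the ball, [cw i] against [r], and the area of the dilated ball
    against that of the cell. *)
Definition poincare_constant : R :=
  6 * (100 * 100 * mv R L) * (64 * mv R L ^+ 3) * 48 * (12 * (4 ^+ 6 * mv R L ^+ 6)).

Lemma poincare_constant_ge1 : (1 <= poincare_constant)%R.
Proof.
have M0 := mv_ge (R := R) hL; have M1 : (1 <= mv R L)%R by lra.
have p3 : (1 <= mv R L ^+ 3)%R by exact: exprn_ege1.
have p6 : (1 <= mv R L ^+ 6)%R by exact: exprn_ege1.
have p4 : (1 <= 4 ^+ 6 :> R)%R by apply: exprn_ege1; lra.
have prod (x y : R) : (1 <= x -> 1 <= y -> 1 <= x * y)%R by move=> hx hy; exact: mulr_ege1.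
by rewrite /poincare_constant; do !apply: (prod); lra.
Qed.

End Poincare.

Section FinalComparison.
Context {R : realType}.

Lemma dball_subset (L : nat) (p : R * R) (r r' : R) : r <= r' -> dball L p r `<=` dball L p r'.
Proof. by move=> rr' x; rewrite /dball /= => h; exact: lt_le_trans rr'. Qed.

(** Here [b] and [l] stand for the measures of the ball and of its dilate, both compared with the
    area [w * v] of a cell. *)
Lemma ratio_bound (T P Q w v r b l G : R) : 0 < b -> 0 < l -> 0 <= T -> 0 <= P -> 0 <= Q ->
  0 < w -> 0 < v -> 0 <= G -> l <= P * (w * v) -> w <= 48 * r -> w * v <= Q * b ->
  b^-1 * (T * w * G) <= T * Q * 48 * P * r * (l^-1 * G).
Proof.
move=> b0 l0 T0 P0 Q0 w0 v0 G0 lP wr wvQ.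
have wv0 : 0 < w * v by rewrite mulr_gt0.
have h1 : w * l <= w * (P * (w * v)) by rewrite ler_pM2l.
have h2 : w * (w * v) <= 48 * r * (Q * b) by apply: ler_pM => //; exact: ltW.
have h3 : P * (w * (w * v)) <= P * (48 * r * (Q * b)) by exact: ler_wpM2l.
have h4 : T * w * l <= T * Q * 48 * P * r * b.
  have -> : T * w * l = T * (w * l) by ring.
  have -> : T * Q * 48 * P * r * b = T * (P * (48 * r * (Q * b))) by ring.
  by apply: ler_wpM2l => //; apply: le_trans h3; apply: le_trans h1 _; rewrite mulrCA.
rewrite mulrA [leRHS]mulrA; apply: ler_wpM2r => //.
rewrite mulrC ler_pdivrMr// mulrAC ler_pdivlMr//.
Qed.

End FinalComparison.

Unset Implicit Arguments.

Local Notation plane R := (measurableTypeR R * measurableTypeR R)%type.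
Local Notation lebesgue2 R := (@lebesgue_measure R \x @lebesgue_measure R)%E.

Theorem mainTheorem17 (R : realType) (L : nat) (hL : (100 <= L)%N) :
  exists C lam : R, 1 <= C /\ 1 <= lam /\
  forall (p : R * R) (r : R) (u : R * R -> R) (g : R * R -> \bar R),
    0 < r ->
    Xmeasurable_fun L u ->
    (\int[@leb2 R]_x (`| u x |)%:E < +oo)%E ->
    (forall x, (0 <= g x)%E) ->
    Xmeasurable_fun L g ->
    upper_gradient L u g ->
    let B := dball L p r in
    let lamB := dball L p (lam * r) in
    let uB : R := fine ((@leb2 R B)^-1 * \int[@leb2 R]_(x in B) (u x)%:E)%E in
    ((@leb2 R B)^-1 * \int[@leb2 R]_(x in B) (`| u x - uB |)%:E <=
      (C * r)%:E * ((@leb2 R lamB)^-1 * \int[@leb2 R]_(x in lamB) g x))%E.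
Proof.
exists (@poincare_constant R L), (48 * 25); split; first exact: poincare_constant_ge1.
split; first lra.
move=> p r u g r0 Xu iu g0 Xg ug; cbv zeta.
set B := dball L p r; set lamB := dball L p (48 * 25 * r).
have M0 := mv_ge (R := R) hL.
(* With [12 * r <= cw i < 48 * r] the ball has radius at most [cw i / 12], and [25 * cw i] is below
   [48 * 25 * r]. *)
have [|i [i1 i2]] := between_scale hL (_ : 0 < 12 * r); first lra.
have w0 := cw_gt0 (R := R) i; have v0 := cv_gt0 (R := R) hL i.
have mB : measurable (B : set (plane R)).
  by apply: (measurable_dopen hL); exact: dball_open.
have mlam : measurable (lamB : set (plane R)).
  by apply: (measurable_dopen hL); exact: dball_open.
have mu_ : measurable_fun setT (u : _ -> measurableTypeR R) := Xmeasurable_measurable hL Xu.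
have mg := Xmeasurable_measurable hL Xg.
have mEabs : measurable_fun setT (fun z : plane R => (`|u z|%R)%:E : \bar R).
  by apply/measurable_EFinP; exact: measurableT_comp.
have abs0 (z : plane R) : (0 <= (`|u z|%R)%:E :> \bar R)%E by rewrite lee_fin.
have iuB : (\int[lebesgue2 R]_(x in
    (B : set (plane R))) (`|u x|%R)%:E < +oo)%E.
  apply: le_lt_trans iu; rewrite (leb2_integral measurableT mEabs abs0).
  by apply: ge0_subset_integral.
have iB : (lebesgue2 R).-integrable
    (B : set (plane R)) (EFin \o u).
  by apply/integrableP; split=> //; apply: measurable_funTS; exact/measurable_EFinP.
rewrite (leb2_integral_EFin mB mu_ iB); set uB := fine _.
have mosc : measurable_fun setT (fun z : plane R => (`|u z - uB|%R)%:E : \bar R).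
  by apply: measurable_EFin_dist => //; exact: measurable_cst.
have osc0 (z : plane R) : (0 <= (`|u z - uB|%R)%:E :> \bar R)%E by rewrite lee_fin.
rewrite (leb2_integral mB (measurable_funTS mosc) osc0) (leb2_integral mlam (measurable_funTS mg) g0).
set G := (\int[lebesgue2 R]_(x in (lamB : set (plane R))) g x)%E.
have G0 : (0 <= G)%E by apply: integral_ge0 => *; exact: g0.
(* Six generations up: the dilated radius [1200 * r] is at most [100 * cw i], and [4 ^+ 6 / 12]
   exceeds 100. *)
have ew : @cw R (i - 6%N%:Z) = 4 ^+ 6 * cw i by rewrite (cwD (R := R) _ 6) subrK.
have ev : @cv R L (i - 6%N%:Z) = mv R L ^+ 6 * cv L i by rewrite (cvD (R := R) hL _ 6) subrK.
(* Three generations down: [cw i / 64] is less than [r], so a cell of that scale fits in the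
   ball. *)
have ew3 := cwD (R := R) i 3; have ev3 := cvD (R := R) hL i 3.
have w3 := cw_gt0 (R := R) (i + 3%N%:Z); have v3 := cv_gt0 (R := R) hL (i + 3%N%:Z).
have e64 : (4 : R) ^+ 3 = 64 by ring.
have e4096 : (4 : R) ^+ 6 = 64 * 64 by ring.
have bge : ((cw (i + 3%N%:Z) * cv L (i + 3%N%:Z))%:E <= @leb2 R B)%E.
  by apply: (leb2_ball_ge hL); move: ew3; rewrite e64; lra.
have lge : ((cw (i + 3%N%:Z) * cv L (i + 3%N%:Z))%:E <= @leb2 R lamB)%E.
  by apply: (leb2_ball_ge hL); move: ew3; rewrite e64; lra.
have sub1 : lamB `<=` dball L p (cw (i - 6%N%:Z) / 12).
  by apply: dball_subset; rewrite ew e4096; lra.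
have mle (D E : set (plane R)) : measurable D -> measurable E ->
    D `<=` E -> (@leb2 R D <= @leb2 R E)%E.
  move=> mD mE DE.
  by apply: (@le_measure _ _ _ (lebesgue2 R)); rewrite ?inE.
have lle : (@leb2 R lamB <= (12 * (cw (i - 6%N%:Z) * cv L (i - 6%N%:Z)))%:E)%E.
  apply: (le_trans _ (leb2_ball_le hL p _)); apply: mle => //.
  by apply: (measurable_dopen hL); exact: dball_open.
have ble : (@leb2 R B <= @leb2 R lamB)%E by apply: mle => //; apply: dball_subset; lra.
have wv3 : 0 < @cw R (i + 3%N%:Z) * cv L (i + 3%N%:Z) by rewrite mulr_gt0.
have wvE : (0 <= (@cw R (i + 3%N%:Z) * cv L (i + 3%N%:Z))%:E)%E by rewrite lee_fin ltW.
have lf : @leb2 R lamB \is a fin_num.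
  by rewrite ge0_fin_numE; [exact: le_lt_trans lle (ltry _)|exact: le_trans wvE lge].
have bf : @leb2 R B \is a fin_num.
  rewrite ge0_fin_numE; last exact: le_trans wvE bge.
  exact: le_lt_trans ble (le_lt_trans lle (ltry _)).
have [l el] : exists l : R, @leb2 R lamB = l%:E by exists (fine (@leb2 R lamB)); rewrite fineK.
have [b eb] : exists b : R, @leb2 R B = b%:E by exists (fine (@leb2 R B)); rewrite fineK.
rewrite el lee_fin in lge; rewrite el lee_fin in lle; rewrite eb lee_fin in bge.
have l0 : 0 < l by lra.
have b0 : 0 < b by lra.
have C0 : 0 < @poincare_constant R L by have := @poincare_constant_ge1 R L hL; lra.
rewrite el eb !inver !gt_eqF//.
(* If the integral of [g] is infinite, so is the right-hand side. *)
have [Gy|Gfin] := eqVneq G +oo%E.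
  by rewrite Gy gt0_muley ?lte_fin ?invr_gt0// gt0_muley ?leey// lte_fin mulr_gt0.
have Gf : G \is a fin_num by rewrite ge0_fin_numE// ltey.
have subB : B `<=` dball L p (cw i / 12) by apply: dball_subset; lra.
have mlam0 : measurable (dball L p (25 * cw i) : set (plane R)).
  by apply: (measurable_dopen hL); exact: dball_open.
have GG : (\int[lebesgue2 R]_(x in
    (dball L p (25 * cw i) : set (plane R))) g x <= G)%E.
  apply: ge0_subset_integral.
  - exact: mlam0.
  - exact: mlam.
  - exact: measurable_funTS.
  - by move=> *; exact: g0.
  - by apply: dball_subset; lra.
have [|m Hm] := ball_oscillation hL Xu iu g0 Xg ug mB subB; first by rewrite (le_lt_trans GG)// ltey.
have Hosc := @mean_oscillation R _ _ (lebesgue2 R) B u m mB _ _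
  (measurable_funTS mu_) iuB.
have X1 : (\int[lebesgue2 R]_(x in
    (B : set (plane R))) (`|u x - uB|%R)%:E <=
    2%:E * ((3 * (100 * 100 * mv R L * cw i))%:E * G))%E.
  apply: le_trans (Hosc _ _) _.
  - by rewrite -[X in (_ < X)%E]/(@leb2 R B) eb lte_fin.
  - by rewrite -[X in (X < _)%E]/(@leb2 R B) eb ltry.
  apply: lee_wpmul2l => //; apply: le_trans Hm _; apply: lee_wpmul2l => //.
  by rewrite lee_fin mulr_ge0// mulr_ge0 ?(ltW w0)//; lra.
apply: (@le_trans _ _ ((b^-1)%:E * (2%:E * ((3 * (100 * 100 * mv R L * cw i))%:E * G)))%E).
  by apply: lee_wpmul2l => //; rewrite lee_fin invr_ge0 ltW.
rewrite -(fineK Gf) -!EFinM lee_fin /poincare_constant.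
have -> : 2 * (3 * (100 * 100 * mv R L * cw i) * fine G) =
  6 * (100 * 100 * mv R L) * cw i * fine G by ring.
have Mn k : 0 <= mv R L ^+ k by apply: exprn_ge0; lra.
apply: (@ratio_bound R _ _ _ (cw i) (cv L i)) => //.
- by rewrite !mulr_ge0//; lra.
- by rewrite !mulr_ge0// exprn_ge0.
- by rewrite mulr_ge0.
- exact: fine_ge0.
- by rewrite (le_trans lle)// ew ev le_eqVlt; apply/orP; left; apply/eqP; ring.
- lra.
- rewrite ew3 ev3 e64.
  have -> : 64 * cw (i + 3%N%:Z) * (mv R L ^+ 3 * cv L (i + 3%N%:Z)) =
    64 * mv R L ^+ 3 * (cw (i + 3%N%:Z) * cv L (i + 3%N%:Z)) by ring.
  by apply: ler_wpM2l => //; rewrite mulr_ge0.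
Qed.
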